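(* Let $n\ge 1$ and consider the analytic differential system $\dot x=f(x)$, $x\in(\mathbb C^n,0)$, where $f$ is an analytic vector function in a neighborhood of $0\in\mathbb C^n$. Assume that $f(0)=0$ and let $\lambda=(\lambda_1,\ldots,\lambda_n)$ be the eigenvalues of the Jacobian matrix $Df(0)$. Then the number of functionally independent generalized rational first integrals of the system in $(\mathbb C^n,0)$ is at most the dimension of the minimal vector subspace of $\mathbb R^n$ containing the set $$\{\mathbf k\in\mathbb Z^n:\ \langle \mathbf k,\lambda\rangle=0,\ \mathbf k\neq 0\}.$$
   Context: $(\mathbb C^n,0)$ denotes a neighborhood of the origin in $\mathbb C^n$. For vectors, $\langle u,v\rangle=\sum_i u_iv_i$. The gradient of $F$ is $\partial_xF=(\partial F/\partial x_1,\ldots,\partial F/\partial x_n)$. A generalized rational first integral of $\dot x=f(x)$ in $(\mathbb C^n,0)$ is a function of the form $F=G/H$ with $G$ and $H$ analytic in $(\mathbb C^n,0)$ such that $\langle f(x),\partial_xF(x)\rangle\equiv 0$ in $(\mathbb C^n,0)$. Functions $F_1,\ldots,F_k$ are functionally independent in an open subset $U$ of $\mathbb C^n$ if their gradients have rank $k$ in a full Lebesgue measure subset of $U$. *)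

(* Defs.v *)
From mathcomp Require Import all_boot all_order all_algebra finmap complex.
From mathcomp Require Import all_classical all_reals all_analysis summability.

Set Implicit Arguments.
Unset Strict Implicit.
Unset Printing Implicit Defensive.

Import Order.TTheory GRing.Theory Num.Theory.
Import numFieldNormedType.Exports.

Local Open Scope classical_set_scope.
Local Open Scope ring_scope.

(* R[i] itself carries no topology in the libraries; packing it as a
   numClosedFieldType gives it the norm topology, and makes 'rV[CC R]_n a
   normed module (sup norm) over it. *)
Definition CC (R : realType) : numClosedFieldType := R[i].

Section Analytic.
Variables (R : realType) (n : nat).
Local Notation C := (CC R).

Definition monomial (m : {ffun 'I_n -> nat}) (y : 'rV[C]_n) : C :=
  \prod_(i < n) y 0 i ^+ m i.

(* The sum over multi-indices is unconditional, i.e. taken along the directed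
   set of finite sets of multi-indices. *)
Definition analytic_at (g : 'rV[C]_n -> C) (a : 'rV[C]_n) : Prop :=
  exists c : {ffun 'I_n -> nat} -> C,
    \forall x \near a,
      partial_sum (fun m => c m * monomial m (x - a)) @ totally --> g x.

Definition analytic_on (U : set 'rV[C]_n) (g : 'rV[C]_n -> C) : Prop :=
  forall a, U a -> analytic_at g a.

Definition gradient (F : 'rV[C]_n -> C) (x : 'rV[C]_n) : 'rV[C]_n :=
  \row_(i < n) 'D_(delta_mx 0 i) F x.

(* No complex conjugation. *)
Definition pairing (u v : 'rV[C]_n) : C := \sum_(i < n) u 0 i * v 0 i.

End Analytic.

Section LebesgueNull.
Variables (R : realType) (n : nat).
Local Notation C := (CC R).

Definition open_box (a b : 'rV[C]_n) : set 'rV[C]_n :=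
  [set z | forall i : 'I_n,
    complex.Re (a 0 i) < complex.Re (z 0 i) < complex.Re (b 0 i) /\
    complex.Im (a 0 i) < complex.Im (z 0 i) < complex.Im (b 0 i)].

Definition box_volume (a b : 'rV[C]_n) : R :=
  \prod_(i < n)
    (Num.max 0 (complex.Re (b 0 i) - complex.Re (a 0 i)) *
     Num.max 0 (complex.Im (b 0 i) - complex.Im (a 0 i))).

(* Lebesgue outer measure of C^n seen as R^(2n). *)
Definition lebesgue_outer (A : set 'rV[C]_n) : \bar R :=
  ereal_inf [set v | exists a b : nat -> 'rV[C]_n,
    A `<=` \bigcup_j open_box (a j) (b j) /\
    v = (\sum_(0 <= j <oo) (box_volume (a j) (b j))%:E)%E].

Definition full_measure_subset (A U : set 'rV[C]_n) : Prop :=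
  A `<=` U /\ lebesgue_outer (U `\` A) = 0%E.

End LebesgueNull.

Section FirstIntegrals.
Variables (R : realType) (n : nat).
Local Notation C := (CC R).

(* H is nonzero as a germ at 0, so that the quotient makes sense.  The values
   of F on the zero set of H are left unspecified. *)
Definition generalized_rational_first_integral (U : set 'rV[C]_n)
    (f : 'rV[C]_n -> 'rV[C]_n) (F : 'rV[C]_n -> C) : Prop :=
  exists G H : 'rV[C]_n -> C,
    [/\ analytic_on U G,
        analytic_on U H,
        ~ (\forall x \near (0 : 'rV[C]_n), H x = 0),
        forall x, U x -> H x != 0 -> F x = G x / H x &
        forall x, U x -> H x != 0 -> pairing (f x) (gradient F x) = 0].

Definition functionally_independent (k : nat) (U : set 'rV[C]_n)
    (F : 'I_k -> 'rV[C]_n -> C) : Prop :=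
  exists A : set 'rV[C]_n, full_measure_subset A U /\
    forall x, A x -> \rank (\matrix_(j < k) gradient (F j) x) = k.

End FirstIntegrals.

Section MinimalSubspace.
Variables (K : fieldType) (V : vectType K).

Definition is_minimal_subspace (S : set V) (W : {vspace V}) : Prop :=
  (forall v, S v -> v \in W) /\
  (forall W' : {vspace V}, (forall v, S v -> v \in W') -> (W <= W')%VS).

Definition minimal_subspace (S : set V) : {vspace V} :=
  xget fullv [set W | is_minimal_subspace S W].

Lemma minimal_subspaceP (S : set V) :
  is_minimal_subspace S (minimal_subspace S).
Proof.
suff [W SW] : exists W, is_minimal_subspace S W.
  by apply: (@xgetPex _ fullv [set W | is_minimal_subspace S W]); exists W.
pose P d := `[< exists2 W : {vspace V}, forall v, S v -> v \in W & \dim W = d >].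
have exP : exists d, P d.
  exists (\dim (fullv : {vspace V})); apply/asboolP; exists fullv => // v _.
  exact: memvf.
case: (ex_minnP exP) => d /asboolP[W SW dW] dmin.
exists W; split=> // W' SW'.
have SWW' v : S v -> v \in (W :&: W')%VS.
  by move=> Sv; rewrite memv_cap SW// SW'.
have : (W :&: W')%VS == W.
  rewrite eqEdim capvSl dW; apply: dmin.
  by apply/asboolP; exists (W :&: W')%VS => // v; exact: SWW'.
by move=> /eqP <-; exact: capvSr.
Qed.

End MinimalSubspace.

Definition resonances (R : realType) (n : nat) (lambda : 'rV[CC R]_n) :
    set 'rV[int]_n :=
  [set k | pairing (map_mx intr k) lambda = 0 /\ k != 0].

(* Main.v *)
Require Import Defs.
From mathcomp Require Import all_boot all_order all_algebra finmap complex.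
From mathcomp Require Import all_classical all_reals all_analysis summability.
From mathcomp Require Import perm ring lra zify.

Set Implicit Arguments.
Unset Strict Implicit.
Unset Printing Implicit Defensive.

Import Order.TTheory GRing.Theory Num.Theory.
Import numFieldNormedType.Exports.

Local Open Scope classical_set_scope.
Local Open Scope ring_scope.

(** Let [X] be the vector field with components [f]. In coordinates where the
    linear part of [X] is triangular ([triangularize]), [X] multiplies a
    monomial [x^m] by the number [<m, lambda>], up to monomials that come later
    in a suitable monomial order. If [G / H] is a first integral, then
    [H * X G = G * X H], and comparing leading terms shows that the leading
    exponents of [G] and [H] differ by a resonance or by 0
    ([hpolynomial_resonant]). So the leading exponents of all rational first
    integrals lie, up to translation, in a space [W] of dimension [r], the
    span of the resonances. The point is that [k] independent first integrals
    produce too many leading exponents if [k > r].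

    To see this, put the first integrals over a common denominator,
    [F j = G j / H] ([common_denominator]), and consider the polynomials in the
    [F j] of degree less than [d] in each variable. Multiplied by [H ^+ D], for
    [D = k * d], they form a space of analytic germs spanned by [d ^ k]
    elements. The zero estimate ([zero_estimate]) bounds the leading exponents
    of all its nontrivial combinations by a constant times [d]; an element of a
    translate of [W] being determined by [r] of its entries, only [O(d ^ r)]
    leading exponents are available. If [d ^ k] is larger, linear algebra gives
    a nontrivial combination whose Taylor coefficients vanish at all these
    exponents, although one of them is its leading exponent
    ([integrals_le_dim]).

    The zero estimate rests on functional independence: some maximal minor
    [delta] of the matrix of derivatives of the [F j] is a nonzero germ, and by
    Cramer's rule the partial derivatives with respect to the [F j] are, up to
    the factor [delta], vector fields with analytic coefficients. Differentiating
    lowers orders of vanishing by a bounded amount, and at most [D]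
    derivations turn a polynomial in the [F j] into a nonzero constant.

    The monomial order is realized by growth along a sequence: for pairwise
    coprime integers [a i > 1], the monomial [x^m] takes the value
    [(\prod_i a i ^ m i) ^ - s] at the point with coordinates [a i ^ - s]
    ([curve]), and these rates are distinct for distinct [m]. A nonzero germ is
    then equivalent to its leading monomial along the sequence, so that leading
    exponents are computed by limits, and multiplicativity is that of limits.

    Germs are treated as functions with an expansion in homogeneous forms
    ([expansion]); they are stable under sums, products, linear changes of
    coordinates and partial derivatives ([expansion_grad]). That the points of
    independence come close to the origin follows from the density of sets of
    full measure ([full_measure_dense]). *)

(** * The absolute value of complex numbers *)

Section Modulus.
Variable R : realType.
Local Notation C := (CC R).

(** The norm of [C] takes its values in [C]; estimates are easier with a
    modulus in the totally ordered field [R]. *)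
Definition nrm (z : C) : R := complex.Re `|z|.

Definition ofR (r : R) : C := real_complex R r.

Lemma nrmE z : `|z| = ofR (nrm z).
Proof. by rewrite /nrm /ofR; have -> : `|z| = real_complex R _ := @normc_def R z. Qed.

Lemma le_ofR x y : (ofR x <= ofR y) = (x <= y).
Proof. exact: (@lecR R). Qed.

Lemma lt_ofR x y : (ofR x < ofR y) = (x < y).
Proof. exact: (@ltcR R). Qed.

Lemma ofR_inj : injective ofR.
Proof. exact: (@complexI R). Qed.

Lemma ofR0 : ofR 0 = 0. Proof. by []. Qed.
Lemma ofRM x y : ofR (x * y) = ofR x * ofR y.
Proof. exact: (rmorphM (real_complex R)). Qed.
Lemma ofRD x y : ofR (x + y) = ofR x + ofR y.
Proof. exact: (rmorphD (real_complex R)). Qed.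

Lemma gt0_ofR (e : C) : 0 < e -> exists2 r, 0 < r & e = ofR r.
Proof.
move=> e0; exists (nrm e); last by rewrite -nrmE gtr0_norm.
by rewrite -lt_ofR -nrmE gtr0_norm.
Qed.

Lemma nrm_ge0 z : 0 <= nrm z.
Proof. by rewrite -le_ofR -nrmE normr_ge0. Qed.

Lemma nrm0 : nrm 0 = 0.
Proof. by apply: ofR_inj; rewrite -nrmE normr0. Qed.

Lemma nrm1 : nrm 1 = 1.
Proof. by apply: ofR_inj; rewrite -nrmE normr1. Qed.

Lemma nrmM z w : nrm (z * w) = nrm z * nrm w.
Proof. by apply: ofR_inj; rewrite ofRM -!nrmE normrM. Qed.

Lemma nrmD z w : nrm (z + w) <= nrm z + nrm w.
Proof. by rewrite -le_ofR ofRD -!nrmE ler_normD. Qed.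

Lemma nrmN z : nrm (- z) = nrm z.
Proof. by apply: ofR_inj; rewrite -!nrmE normrN. Qed.

Lemma nrmB z w : nrm (z - w) <= nrm z + nrm w.
Proof. by rewrite -[nrm w]nrmN nrmD. Qed.

Lemma nrm_eq0 z : nrm z = 0 -> z = 0.
Proof. by move=> z0; apply/eqP; rewrite -normr_eq0 nrmE z0 ofR0. Qed.

Lemma nrm_gt0 z : (0 < nrm z) = (z != 0).
Proof. by rewrite -lt_ofR -nrmE ofR0 normr_gt0. Qed.

Lemma nrmX z k : nrm (z ^+ k) = nrm z ^+ k.
Proof. by elim: k => [|k IH]; rewrite ?expr0 ?nrm1// !exprS nrmM IH. Qed.

Lemma nrmV z : nrm z^-1 = (nrm z)^-1.
Proof.
have [->|z0] := eqVneq z 0; first by rewrite invr0 nrm0 invr0.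
have n0 : nrm z != 0 by rewrite gt_eqF// nrm_gt0.
by apply: (mulfI n0); rewrite -nrmM divff// divff// nrm1.
Qed.

Lemma nrm_nat k : nrm k%:R = k%:R.
Proof.
apply: ofR_inj; rewrite -nrmE normr_nat.
by elim: k => // k IH; rewrite -!natr1 ofRD IH.
Qed.

Lemma nrm_ofR r : nrm (ofR r) = `|r|.
Proof.
wlog r0 : r / 0 <= r.
  move=> H; have [/H//|r0] := leP 0 r.
  have -> : ofR r = - ofR (- r).
    by apply/eqP; rewrite -subr_eq0 opprK -ofRD subrr.
  by rewrite nrmN H ?normrN// oppr_ge0 ltW.
by apply: ofR_inj; rewrite -nrmE !ger0_norm// -ofR0 le_ofR.
Qed.

Lemma nrm_sum (I : Type) (s : seq I) (P : pred I) (F : I -> C) :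
  nrm (\sum_(i <- s | P i) F i) <= \sum_(i <- s | P i) nrm (F i).
Proof.
elim/big_rec2: _ => [|i x y _ IH]; first by rewrite nrm0.
by apply: (le_trans (nrmD _ _)); rewrite lerD2l.
Qed.

Lemma Re_le_nrm (z : C) : `|complex.Re z| <= nrm z.
Proof. by rewrite -le_ofR -nrmE; exact: (@normc_ge_Re R z). Qed.

Lemma Im_le_nrm (z : C) : `|complex.Im z| <= nrm z.
Proof.
rewrite -le_ofR -nrmE; have -> : `|z| = ofR _ := @normc_def R z; rewrite le_ofR.
rewrite -sqrtr_sqr ler_sqrt ?sqr_ge0//; last by rewrite addr_ge0// sqr_ge0.
by rewrite lerDr sqr_ge0.
Qed.

Lemma nrm_le_ReIm (z : C) : nrm z <= `|complex.Re z| + `|complex.Im z|.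
Proof.
rewrite -le_ofR -nrmE; have -> : `|z| = ofR _ := @normc_def R z; rewrite le_ofR.
set a := complex.Re z; set b := complex.Im z.
have ab0 : 0 <= `|a| + `|b| by rewrite addr_ge0.
rewrite -(ler_pXn2r (n := 2))// ?nnegrE ?sqrtr_ge0// sqr_sqrtr ?addr_ge0 ?sqr_ge0//.
rewrite sqrrD -!normrX !(ger0_norm (sqr_ge0 _)).
by rewrite -addrA lerD2l lerDr mulrn_wge0// mulr_ge0.
Qed.

Lemma nrm_cvgP (T : Type) (A : set_system T) {FA : Filter A} (f : T -> C) (l : C) :
  (f @ A --> l) <-> (forall e : R, 0 < e -> \forall t \near A, nrm (f t - l) < e).
Proof.
split.
  move=> /cvgrPdist_lt H e e0.
  have : (0 : C) < ofR e by rewrite -ofR0 lt_ofR.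
  move=> /H; apply: filterS => t; rewrite distrC nrmE lt_ofR//.
move=> H; apply/cvgrPdist_lt => e /gt0_ofR[r r0 ->].
by apply: filterS (H _ r0) => t; rewrite distrC nrmE lt_ofR.
Qed.

Lemma nbhs_rVP n (x : 'rV[C]_n) (P : set 'rV[C]_n) :
  nbhs x P <-> exists2 e : R, 0 < e &
    forall y : 'rV[C]_n, (forall i, nrm (y 0 i - x 0 i) < e) -> P y.
Proof.
split.
  move=> /nbhs_ballP[e /= /gt0_ofR[r r0 ->] H]; exists r => // y Hy.
  apply: H; split=> [|i j]; first by rewrite -ofR0 lt_ofR.
  by rewrite ord1 /ball /= distrC nrmE lt_ofR; exact: Hy.
move=> [e e0 H]; apply/nbhs_ballP; exists (ofR e) => /=.
  by rewrite -ofR0 lt_ofR.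
move=> y [_ Hy]; apply: H => i; move: (Hy 0 i).
by rewrite /ball /= distrC nrmE lt_ofR.
Qed.

End Modulus.

(** * Homogeneous forms *)

Section Forms.
Variables (R : realType) (n : nat).
Local Notation C := (CC R).
Local Notation V := 'rV[C]_n.

Definition polydisc (rho : R) (x : V) := forall i, nrm (x 0 i) <= rho.

(** [B] bounds the sum of the moduli of the coefficients. An inductive
    definition, rather than one by coefficients, reduces the estimates and
    the closure properties below to one multiplication by a coordinate. *)
Inductive hform : nat -> R -> (V -> C) -> Prop :=
| hform0 d B : 0 <= B -> hform d B (fun=> 0)
| hformC c B : nrm c <= B -> hform 0 B (fun=> c)
| hformX i d B p : hform d B p -> hform d.+1 B (fun x => x 0 i * p x)
| hformD d B B' p q : hform d B p -> hform d B' q ->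
    hform d (B + B') (fun x => p x + q x).

Lemma hform_ge0 d B p : hform d B p -> 0 <= B.
Proof.
elim=> // [c b|d' b b' p' q _ ? _ ?]; first exact: le_trans (nrm_ge0 _).
exact: addr_ge0.
Qed.

Lemma hform_le d B B' p : B <= B' -> hform d B p -> hform d B' p.
Proof.
move=> BB' fp; have := hformD fp (hform0 d _).
move=> /(_ (B' - B)); rewrite subr_ge0 => /(_ BB'); rewrite addrC subrK.
by congr hform; apply/funext => x; rewrite addr0.
Qed.

Lemma hform_bound d B p rho x : 0 <= rho -> polydisc rho x ->
  hform d B p -> nrm (p x) <= B * rho ^+ d.
Proof.
move=> rho0 xr; elim=> {d B p} [d B B0|c B cB|i d B p fp IH|d B B' p q _ IHp _ IHq].
- by rewrite nrm0 mulr_ge0// exprn_ge0.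
- by rewrite expr0 mulr1.
- rewrite nrmM exprS mulrCA; apply: ler_pM => //; exact: nrm_ge0.
- by apply: (le_trans (nrmD _ _)); rewrite mulrDl lerD.
Qed.

Lemma hformZ c d B p : hform d B p -> hform d (nrm c * B) (fun x => c * p x).
Proof.
elim=> {d B p} [d B B0|c' B cB|i d B p fp IH|d B B' p q _ IHp _ IHq].
- have -> : (fun x : V => c * 0) = (fun=> 0) by apply/funext => x; rewrite mulr0.
  by apply: hform0; rewrite mulr_ge0// nrm_ge0.
- by apply: hformC; rewrite nrmM ler_wpM2l// nrm_ge0.
- have -> : (fun x : V => c * (x 0 i * p x)) = (fun x => x 0 i * (c * p x)).
    by apply/funext => x; rewrite mulrCA.
  exact: hformX.
- rewrite mulrDr.
  have -> : (fun x : V => c * (p x + q x)) = (fun x => c * p x + c * q x).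
    by apply/funext => x; rewrite mulrDr.
  exact: hformD.
Qed.

Lemma hformM d B p d' B' p' : hform d B p -> hform d' B' p' ->
  hform (d + d')%N (B * B') (fun x => p x * p' x).
Proof.
move=> fp fp'; elim: fp => {d B p} [d B B0|c B cB|i d B p fp IH|d B B'' p q _ IHp _ IHq].
- have -> : (fun x : V => 0 * p' x) = (fun=> 0) by apply/funext => x; rewrite mul0r.
  by apply: hform0; rewrite mulr_ge0// (hform_ge0 fp').
- apply: (@hform_le _ (nrm c * B')); last exact: hformZ.
  by rewrite ler_wpM2r// (hform_ge0 fp').
- have -> : (fun x : V => x 0 i * p x * p' x) = (fun x => x 0 i * (p x * p' x)).
    by apply/funext => x; rewrite mulrA.
  by rewrite addSn; exact: hformX.
- rewrite mulrDl.
  have -> : (fun x : V => (p x + q x) * p' x) = (fun x => p x * p' x + q x * p' x).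
    by apply/funext => x; rewrite mulrDl.
  exact: hformD.
Qed.

Lemma hform_sum (I : Type) (s : seq I) (P : pred I) d (B : I -> R) (p : I -> V -> C) :
  (forall i, P i -> hform d (B i) (p i)) ->
  hform d (\sum_(i <- s | P i) B i) (fun x => \sum_(i <- s | P i) p i x).
Proof.
move=> H; elim: s => [|i s IH].
  have -> : (fun x : V => \sum_(i <- [::] | P i) p i x) = (fun=> 0).
    by apply/funext => x; rewrite big_nil.
  by rewrite big_nil; apply: hform0.
rewrite big_cons.
have -> : (fun x : V => \sum_(i <- i :: s | P i) p i x) =
  (fun x : V => if P i then p i x + \sum_(i <- s | P i) p i x else \sum_(i <- s | P i) p i x).
  by apply/funext => x; rewrite big_cons.
by case: ifP => // Pi; apply: hformD => //; exact: H.
Qed.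

Lemma hform_subst (P : 'M[C]_n) d B p : hform d B p ->
  hform d (B * (\sum_i \sum_j nrm (P i j)) ^+ d) (fun x => p (x *m P)).
Proof.
set L := \sum_i _.
have L0 : 0 <= L by do 2![apply: sumr_ge0 => ? _]; exact: nrm_ge0.
elim=> {d B p} [d B B0|c B cB|i d B p fp IH|d B B' p q _ IHp _ IHq].
- by apply: hform0; rewrite mulr_ge0// exprn_ge0.
- by apply: hformC; rewrite expr0 mulr1.
- have f1 : hform 1 L (fun x => (x *m P) 0 i).
    apply: (@hform_le _ (\sum_j nrm (P j i))).
      apply: ler_sum => j _; rewrite (bigD1 i)//= lerDl.
      by apply: sumr_ge0 => ? _; exact: nrm_ge0.
    have -> : (fun x : V => (x *m P) 0 i) = (fun x => \sum_j x 0 j * P j i).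
      by apply/funext => x; rewrite mxE.
    apply: hform_sum => j _; apply: hformX; exact: hformC.
  rewrite -add1n exprD mulrCA expr1; exact: hformM.
- by rewrite mulrDl; exact: hformD.
Qed.

(** Replacing the coefficients by their moduli and the point by [rho], the
    first two Taylor remainders at an increment [tau * s] become polynomials
    in [tau] with nonnegative coefficients, divisible by [tau] and [tau ^+ 2];
    as [tau <= 1] they are at most [tau] and [tau ^+ 2] times the value at
    [rho + s]. *)
Lemma hform_diff d B p : hform d B p -> exists q : 'I_n -> V -> C,
  [/\ forall i, hform d.-1 (d%:R * B) (q i),
      d = 0%N -> forall i, q i = (fun=> 0) &
      forall rho s tau x h, 0 <= rho -> 0 <= s -> 0 <= tau <= 1 ->
        polydisc rho x -> polydisc (tau * s) h ->
        nrm (p (x + h) - p x) <= B * tau * (rho + s) ^+ d /\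
        nrm (p (x + h) - p x - \sum_i h 0 i * q i x)
          <= B * tau ^+ 2 * (rho + s) ^+ d].
Proof.
elim=> {d B p} [d B B0|c B cB|i d B p fp [q [fq q0 Hq]]|d B B' p p' _ [q [fq q0 Hq]] _ [q' [fq' q0' Hq']]].
- exists (fun _ _ => 0); split=> // [i|rho s tau x h rho0 s0 /andP[t0 t1] _ _].
    by apply: hform0; rewrite mulr_ge0.
  rewrite (eq_bigr (fun=> 0)); last by move=> ? _; rewrite mulr0.
  rewrite big1// !subr0 nrm0.
  by split; rewrite !mulr_ge0 ?exprn_ge0// addr_ge0.
- have B0 : 0 <= B := le_trans (nrm_ge0 _) cB.
  exists (fun _ _ => 0); split=> // [i|rho s tau x h rho0 s0 /andP[t0 t1] _ _].
    by apply: hform0; rewrite mul0r.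
  rewrite (eq_bigr (fun=> 0)); last by move=> ? _; rewrite mulr0.
  rewrite big1// subrr subr0 nrm0.
  by split; rewrite !mulr_ge0 ?exprn_ge0// addr_ge0.
- have B0 := hform_ge0 fp.
  exists (fun j x => (if j == i then p x else 0) + x 0 i * q j x).
  split=> // [j|rho s tau x h rho0 s0 /andP[t0 t1] xr hs].
    rewrite -natr1 mulrDl mul1r addrC; apply: hformD.
      case: eqP => _ //=; exact: hform0.
    case: d fp fq q0 Hq => [|d] fp fq q0 Hq; last exact: hformX.
    rewrite (q0 erefl) mul0r.
    have -> : (fun x : V => x 0 i * 0) = (fun=> 0) by apply/funext => ?; rewrite mulr0.
    exact: hform0.
  have rs0 : 0 <= rho + s by rewrite addr_ge0.
  have [H1 H2] := Hq rho s tau x h rho0 s0 (introT andP (conj t0 t1)) xr hs.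
  have xhr : polydisc (rho + s) (x + h).
    move=> j; rewrite mxE; apply: (le_trans (nrmD _ _)); apply: lerD => //.
    by apply: (le_trans (hs j)); rewrite ler_piMl.
  have H3 := hform_bound rs0 xhr fp.
  rewrite !mxE; split.
    have -> : (x 0 i + h 0 i) * p (x + h) - x 0 i * p x =
       x 0 i * (p (x + h) - p x) + h 0 i * p (x + h) by ring.
    apply: (le_trans (nrmD _ _)); rewrite !nrmM.
    apply: (@le_trans _ _ (rho * (B * tau * (rho + s) ^+ d) +
                           (tau * s) * (B * (rho + s) ^+ d))).
      by apply: lerD; apply: ler_pM => //; exact: nrm_ge0.
    by rewrite exprS le_eqVlt; apply/orP; left; apply/eqP; ring.
  have -> : (x 0 i + h 0 i) * p (x + h) - x 0 i * p x
      - \sum_j h 0 j * ((if j == i then p x else 0) + x 0 i * q j x) =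
      x 0 i * (p (x + h) - p x - \sum_j h 0 j * q j x) + h 0 i * (p (x + h) - p x).
    have -> : \sum_j h 0 j * ((if j == i then p x else 0) + x 0 i * q j x) =
      h 0 i * p x + x 0 i * \sum_j h 0 j * q j x.
      under eq_bigr do rewrite mulrDr.
      rewrite big_split /=; congr (_ + _).
        rewrite (bigD1 i)//= eqxx big1 ?addr0// => j /negPf ->.
        by rewrite mulr0.
      by rewrite mulr_sumr; apply: eq_bigr => j _; rewrite mulrCA.
    by ring.
  apply: (le_trans (nrmD _ _)); rewrite !nrmM.
  apply: (@le_trans _ _ (rho * (B * tau ^+ 2 * (rho + s) ^+ d) +
                         (tau * s) * (B * tau * (rho + s) ^+ d))).
    by apply: lerD; apply: ler_pM => //; exact: nrm_ge0.
  by rewrite [_ ^+ d.+1]exprS le_eqVlt; apply/orP; left; apply/eqP; ring.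
- exists (fun i x => q i x + q' i x); split=> [i|d0 i|rho s tau x h rho0 s0 t01 xr hs].
  + by rewrite mulrDr; exact: hformD.
  + by rewrite (q0 d0) (q0' d0); apply/funext => x; rewrite addr0.
  + have [H1 H2] := Hq _ _ _ _ _ rho0 s0 t01 xr hs.
    have [H1' H2'] := Hq' _ _ _ _ _ rho0 s0 t01 xr hs.
    rewrite !mulrDl; split.
      rewrite opprD addrACA; by apply: (le_trans (nrmD _ _)); apply: lerD.
    have -> : p (x + h) + p' (x + h) - (p x + p' x)
        - \sum_i h 0 i * (q i x + q' i x) =
      (p (x + h) - p x - \sum_i h 0 i * q i x) +
      (p' (x + h) - p' x - \sum_i h 0 i * q' i x).
      under eq_bigr do rewrite mulrDr.
      by rewrite big_split /=; ring.
    by apply: (le_trans (nrmD _ _)); apply: lerD.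
Qed.

End Forms.

(** * Germs of analytic functions *)

Section Germs.
Variables (R : realType) (n : nat).
Local Notation C := (CC R).
Local Notation V := 'rV[C]_n.
Local Notation hform := (@hform R n).
Local Notation polydisc := (@polydisc R n).

(** Homogeneous parts, unlike monomials, are respected by linear changes of
    coordinates. The single constant [K] bounds the forms, the remainders and
    the inverse of the radius of convergence: all three conditions weaken as
    [K] grows, so that two expansions can be given the same [K]. *)
Definition expansion (K : R) (p : nat -> V -> C) (g : V -> C) :=
  [/\ 1 <= K, forall d, hform d (K ^+ d.+1) (p d) &
     forall rho x N, 0 <= rho -> K * rho <= 1 -> polydisc rho x ->
       nrm (g x - \sum_(d < N) p d x) <= K ^+ N.+1 * rho ^+ N].

Definition germ (g : V -> C) := exists K p, expansion K p g.

Lemma expansion_le K K' p g : K <= K' -> expansion K p g -> expansion K' p g.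
Proof.
move=> KK [K1 fp Hg]; have K0 : 0 <= K by exact: le_trans K1.
split=> [|d|rho x N r0 Kr xr]; first exact: le_trans KK.
  by apply: hform_le (fp d); apply: lerXn2r => //; rewrite nnegrE (le_trans K0).
apply: (le_trans (Hg rho x N r0 _ xr)); first by apply: le_trans Kr; rewrite ler_wpM2r.
by rewrite ler_wpM2r ?exprn_ge0// lerXn2r ?nnegrE// (le_trans K0).
Qed.

Lemma expansion_ext K p g g' r : 0 < r -> (forall x, polydisc r x -> g x = g' x) ->
  expansion K p g -> expansion (Num.max K r^-1) p g'.
Proof.
move=> r0 gg' Hg.
have [K1 fp Hg'] : expansion (Num.max K r^-1) p g.
  by apply: expansion_le Hg; rewrite le_max lexx.
split=> // rho x N rho0 Kr xr; rewrite -gg'; first exact: Hg'.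
move=> i; apply: (le_trans (xr i)).
have : r^-1 * rho <= 1.
  by apply: le_trans Kr; rewrite ler_wpM2r// le_max lexx orbT.
by rewrite mulrC ler_pdivrMr// mul1r.
Qed.

Lemma germ_ext g g' : (\forall x \near (0 : V), g x = g' x) -> germ g -> germ g'.
Proof.
move=> /nbhs_rVP[e e0 H] [K [p Hp]].
exists (Num.max K (e / 2)^-1), p; apply: expansion_ext Hp; first by rewrite divr_gt0.
move=> x xe; apply: H => i; rewrite mxE subr0; apply: le_lt_trans (xe i) _.
by rewrite ltr_pdivrMr// ltr_pMr// ltr1n.
Qed.

Lemma expansionC c :
  expansion (1 + nrm c) (fun d _ => if d == 0%N then c else 0) (fun=> c).
Proof.
have c0 := nrm_ge0 c.
split=> [|[|d]|rho x [|N] r0 Kr xr]; first by rewrite lerDl.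
- by apply: hformC; rewrite expr1 lerDr.
- by apply: hform0; rewrite exprn_ge0// addr_ge0.
- by rewrite big_ord0 subr0 expr1 expr0 mulr1 lerDr.
- by rewrite big_ord_recl /= big1// addr0 subrr nrm0 mulr_ge0 ?exprn_ge0// addr_ge0.
Qed.

Lemma germC c : germ (fun=> c).
Proof. by eexists _, _; exact: expansionC. Qed.

Lemma expansionD K p g K' p' g' : expansion K p g -> expansion K' p' g' ->
  expansion (K + K') (fun d x => p d x + p' d x) (fun x => g x + g' x).
Proof.
move=> [K1 fp Hg] [K'1 fp' Hg'].
have K0 : 0 <= K by exact: le_trans K1.
have K'0 : 0 <= K' by exact: le_trans K'1.
have XD d : K ^+ d.+1 + K' ^+ d.+1 <= (K + K') ^+ d.+1.
  rewrite exprS [K' ^+ _]exprS [(K + K') ^+ _]exprS mulrDl; apply: lerD.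
    by apply: ler_wpM2l => //; rewrite lerXn2r ?nnegrE// ?addr_ge0// lerDl.
  by apply: ler_wpM2l => //; rewrite lerXn2r ?nnegrE// ?addr_ge0// lerDr.
split=> [|d|rho x N r0 Kr xr]; first by rewrite (le_trans K1)// lerDl.
  by apply: hform_le (XD d) _; apply: hformD.
rewrite big_split /= opprD addrACA.
apply: (@le_trans _ _ ((K ^+ N.+1 + K' ^+ N.+1) * rho ^+ N)); last first.
  by rewrite ler_wpM2r// exprn_ge0.
rewrite mulrDl; apply: (le_trans (nrmD _ _)); apply: lerD.
  by apply: Hg => //; apply: le_trans Kr; rewrite ler_wpM2r// lerDl.
by apply: Hg' => //; apply: le_trans Kr; rewrite ler_wpM2r// lerDr.
Qed.

Lemma germD g g' : germ g -> germ g' -> germ (fun x => g x + g' x).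
Proof. by move=> [K [p H]] [K' [p' H']]; eexists _, _; exact: expansionD H H'. Qed.

Lemma natS_le_2X N : N.+1%:R <= 2 ^+ N.+1 :> R.
Proof. by rewrite -natrX ler_nat ltnW// ltn_expl. Qed.

(** The factor 2 absorbs the number [d.+1] of terms of degree [d] in the
    Cauchy product. *)
Lemma expansionM K p g p' g' : expansion K p g -> expansion K p' g' ->
  expansion (2 * K ^+ 2) (fun d x => \sum_(i < d.+1) p i x * p' (d - i)%N x)
    (fun x => g x * g' x).
Proof.
move=> [K1 fp Hg] [_ fp' Hg'].
have K0 : 0 <= K by exact: le_trans K1.
have bd N : N.+1%:R * K ^+ N.+2 <= (2 * K ^+ 2) ^+ N.+1.
  rewrite exprMn -exprM; apply: ler_pM => //.
  - exact: exprn_ge0.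
  - exact: natS_le_2X.
  - by rewrite ler_weXn2l//; lia.
have K2 : K <= 2 * K ^+ 2.
  by rewrite expr2 mulrA ler_peMl// mulr_ege1// ler1n.
split=> [|d|rho x N r0 Kr xr]; first exact: le_trans K1 K2.
  apply: hform_le (bd d) _.
  have -> : d.+1%:R * K ^+ d.+2 = \sum_(i < d.+1) K ^+ d.+2.
    by rewrite sumr_const card_ord mulr_natl.
  apply: hform_sum => i _; have id : (i <= d)%N by rewrite -ltnS.
  have {1}-> : d = (i + (d - i))%N by rewrite subnKC.
  have -> : d.+2 = (i.+1 + (d - i).+1)%N by rewrite addSn addnS subnKC.
  rewrite exprD; exact: hformM.
have Kr' : K * rho <= 1 by apply: le_trans Kr; rewrite ler_wpM2r.
have Kr0 : 0 <= K * rho by rewrite mulr_ge0.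
have bdg' : nrm (g' x) <= K.
  by have := Hg' rho x 0%N r0 Kr' xr; rewrite big_ord0 subr0 expr1 expr0 mulr1.
have bdp (i : nat) : nrm (p i x) <= K ^+ i.+1 * rho ^+ i by apply: hform_bound.
(* the partial sums of the Cauchy product, summed along the first factor *)
have -> : \sum_(d < N) \sum_(i < d.+1) p i x * p' (d - i)%N x =
    \sum_(i < N) p i x * \sum_(j < N - i) p' j x.
  elim: N => [|N IH]; first by rewrite !big_ord0.
  rewrite big_ord_recr IH [RHS]big_ord_recr /= subSnn big_ord1.
  rewrite [X in _ + X]big_ord_recr /= subnn addrA -big_split /=; congr (_ + _).
  apply: eq_bigr => i _; rewrite -mulrDr subSn ?[(i <= N)%N]ltnW//.
  by rewrite big_ord_recr.
have -> : g x * g' x - \sum_(i < N) p i x * \sum_(j < N - i) p' j x =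
    (g x - \sum_(i < N) p i x) * g' x +
    \sum_(i < N) p i x * (g' x - \sum_(j < N - i) p' j x).
  under [X in _ = _ + X]eq_bigr do rewrite mulrBr.
  by rewrite sumrB mulrBl mulr_suml addrA subrK.
apply: (le_trans (nrmD _ _)).
apply: (@le_trans _ _ (N.+1%:R * K ^+ N.+2 * rho ^+ N)); last first.
  by rewrite ler_wpM2r// exprn_ge0.
rewrite -natr1 [(_ + 1) * _]mulrDl mul1r [X in _ <= X]mulrDl addrC; apply: lerD.
  apply: (le_trans (nrm_sum _ _ _)).
  have -> : N%:R * K ^+ N.+2 * rho ^+ N = \sum_(i < N) K ^+ N.+2 * rho ^+ N.
    by rewrite sumr_const card_ord -mulrA mulr_natl.
  apply: ler_sum => i _; rewrite nrmM.
  have iN : (i <= N)%N by rewrite ltnW.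
  have -> : K ^+ N.+2 * rho ^+ N =
     (K ^+ i.+1 * rho ^+ i) * (K ^+ (N - i).+1 * rho ^+ (N - i)%N).
    by rewrite mulrACA -!exprD addSn addnS subnKC.
  by apply: ler_pM; rewrite ?nrm_ge0//; exact: Hg'.
rewrite nrmM exprSr mulrAC; apply: ler_pM; rewrite ?nrm_ge0//; exact: Hg.
Qed.

Lemma germM g g' : germ g -> germ g' -> germ (fun x => g x * g' x).
Proof.
move=> [K [p H]] [K' [p' H']].
have [HK HK'] : K <= Num.max K K' /\ K' <= Num.max K K'.
  by rewrite !le_max !lexx orbT.
eexists _, _; exact: expansionM (expansion_le HK H) (expansion_le HK' H').
Qed.

Lemma germN g : germ g -> germ (fun x => - g x).
Proof.
move=> /(germM (germC (-1))); apply: germ_ext.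
by near=> x; rewrite mulN1r.
Unshelve. all: end_near. Qed.

Lemma germB g g' : germ g -> germ g' -> germ (fun x => g x - g' x).
Proof. by move=> ? ?; apply: germD => //; apply: germN. Qed.

Lemma germX g k : germ g -> germ (fun x => g x ^+ k).
Proof.
move=> Hg; elim: k => [|k IH].
  by apply: germ_ext (germC 1); near=> x; rewrite expr0.
by apply: germ_ext (germM Hg IH); near=> x; rewrite exprS.
Unshelve. all: end_near. Qed.

Lemma germ_sum (I : Type) (s : seq I) (P : pred I) (g : I -> V -> C) :
  (forall i, P i -> germ (g i)) -> germ (fun x => \sum_(i <- s | P i) g i x).
Proof.
move=> H; elim: s => [|i s IH].
  by apply: germ_ext (germC 0); near=> x; rewrite big_nil.
case: (boolP (P i)) => Pi.
  by apply: germ_ext (germD (H i Pi) IH); near=> x; rewrite big_cons Pi.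
by apply: germ_ext IH; near=> x; rewrite big_cons (negPf Pi).
Unshelve. all: end_near. Qed.

Lemma germ_prod (I : Type) (s : seq I) (P : pred I) (g : I -> V -> C) :
  (forall i, P i -> germ (g i)) -> germ (fun x => \prod_(i <- s | P i) g i x).
Proof.
move=> H; elim: s => [|i s IH].
  by apply: germ_ext (germC 1); near=> x; rewrite big_nil.
case: (boolP (P i)) => Pi.
  by apply: germ_ext (germM (H i Pi) IH); near=> x; rewrite big_cons Pi.
by apply: germ_ext IH; near=> x; rewrite big_cons (negPf Pi).
Unshelve. all: end_near. Qed.

Lemma germ_det k (M : 'I_k -> 'I_k -> V -> C) : (forall i j, germ (M i j)) ->
  germ (fun x => \det (\matrix_(i, j) M i j x)).
Proof.
move=> HM; rewrite /determinant.
have Hs (s : 'S_k) : germ (fun x => \prod_i (\matrix_(i0, j) M i0 j x) i (s i)).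
  apply: germ_prod => i _; have := HM i (s i); congr germ.
  by apply/funext => x; rewrite mxE.
by apply: germ_sum => s _; apply: germM; [exact: germC|exact: Hs].
Qed.

Lemma germ_subst (P : 'M[C]_n) g : germ g -> germ (fun x => g (x *m P)).
Proof.
move=> [K [p [K1 fp Hg]]].
pose L := \sum_i \sum_j nrm (P i j).
have L0 : 0 <= L by do 2![apply: sumr_ge0 => ? _]; exact: nrm_ge0.
have K0 : 0 <= K by exact: le_trans K1.
exists (K * (L + 1)), (fun d x => p d (x *m P)); split.
- by rewrite mulr_ege1// lerDr.
- move=> d; apply: hform_le (hform_subst P (fp d)).
  rewrite exprMn ler_wpM2l ?exprn_ge0// -/L.
  apply: (@le_trans _ _ ((L + 1) ^+ d)).
    by rewrite lerXn2r ?nnegrE ?addr_ge0// lerDl.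
  by rewrite ler_weXn2l// lerDr.
move=> rho x N r0 Kr xr.
have xPr : polydisc ((L + 1) * rho) (x *m P).
  move=> i; rewrite mxE; apply: (le_trans (nrm_sum _ _ _)).
  apply: (@le_trans _ _ (L * rho)); last by rewrite ler_wpM2r// lerDl.
  rewrite mulr_suml; apply: ler_sum => j _; rewrite nrmM mulrC.
  apply: ler_pM; rewrite ?nrm_ge0//.
  by rewrite (bigD1 i)//= lerDl sumr_ge0// => ? _; exact: nrm_ge0.
apply: (le_trans (Hg ((L + 1) * rho) (x *m P) N _ _ xPr)).
- by rewrite mulr_ge0// addr_ge0.
- by rewrite mulrA.
- rewrite !exprMn mulrA ler_wpM2r ?exprn_ge0// ler_wpM2l ?exprn_ge0//.
  by rewrite ler_weXn2l// lerDr.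
Qed.

End Germs.

(** * Partial derivatives of germs *)

Section Completeness.
Variable R : realType.
Local Notation C := (CC R).

Lemma halfX_small (B e : R) : 0 < e -> exists N, B / 2 ^+ N < e.
Proof.
move=> e0; exists (Num.truncn (B / e)).+1.
rewrite ltr_pdivrMr ?exprn_gt0// mulrC -ltr_pdivrMr//.
apply: lt_trans (truncnS_gt _) _.
by rewrite -natrX ltr_nat ltn_expl.
Qed.

Lemma halfX_cvg (B : R) : (fun N => B / 2 ^+ N) @ \oo --> (0 : R).
Proof.
have -> : (fun N => B / 2 ^+ N) = (fun N => B * (2^-1) ^+ N).
  by apply/funext => N; rewrite exprVn.
rewrite -[0](mulr0 B); apply: cvgM; first exact: cvg_cst.
by apply: cvg_expr; rewrite ger0_norm// invf_lt1// ltr1n.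
Qed.

(** Completeness of [C], inherited from [R] through real and imaginary
    parts. *)
Lemma geometric_cauchy_cvg (z : nat -> C) (B : R) :
  (forall N M, (N <= M)%N -> nrm (z M - z N) <= B / 2 ^+ N) ->
  exists l : C, z @ \oo --> l.
Proof.
move=> Hz.
have cc (f : C -> R) : (forall a b, f (a - b) = f a - f b) ->
    (forall a, `|f a| <= nrm a) -> exists l : R, (f \o z) @ \oo --> l.
  move=> fB fn; have : cvg ((f \o z) @ \oo); last by move=> H; eexists; exact: H.
  apply/cauchy_cvgP; apply: cauchy_exP => e e0.
  have [N HN] := halfX_small B e0; exists (f (z N)).
  exists N => // M /= NM; rewrite /ball /= distrC -fB.
  by apply: le_lt_trans (fn _) _; apply: le_lt_trans HN; exact: Hz.
pose re : C -> R := fun w => complex.Re w; pose im : C -> R := fun w => complex.Im w.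
have [a Ha] : exists l : R, (re \o z) @ \oo --> l.
  by apply: cc => [[? ?] [? ?]//|]; exact: Re_le_nrm.
have [b Hb] : exists l : R, (im \o z) @ \oo --> l.
  by apply: cc => [[? ?] [? ?]//|]; exact: Im_le_nrm.
exists (Complex a b : C); apply/nrm_cvgP => e e0.
have e20 : 0 < e / 2 by rewrite divr_gt0.
move/cvgrPdist_lt : Ha => /(_ _ e20) Ha; move/cvgrPdist_lt : Hb => /(_ _ e20) Hb.
near=> N; apply: le_lt_trans (nrm_le_ReIm _) _.
have -> : complex.Re (z N - Complex a b : C) = complex.Re (z N) - a.
  by case: (z N).
have -> : complex.Im (z N - Complex a b : C) = complex.Im (z N) - b.
  by case: (z N).
rewrite (splitr e); apply: ltrD; rewrite distrC; near: N; [exact: Ha|exact: Hb].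
Unshelve. all: end_near. Qed.

Lemma nrm_cvg_le (z : nat -> C) (l : C) (B : R) :
  (forall N, nrm (z N) <= B) -> z @ \oo --> l -> nrm l <= B.
Proof.
move=> zB /nrm_cvgP zl; apply/ler_addgt0Pr => e e0.
have [N _ HN] := zl _ e0.
have -> : l = z N - (z N - l) by rewrite subKr.
apply: (le_trans (nrmB _ _)); apply: lerD => //; apply: ltW; exact: HN (leqnn N).
Qed.

Lemma nrm_squeeze (z : nat -> C) (l : C) (w : nat -> R) :
  (forall N, nrm (z N - l) <= w N) -> w @ \oo --> (0 : R) -> z @ \oo --> l.
Proof.
move=> zw /cvgr0Pnorm_lt w0; apply/nrm_cvgP => e /w0; apply: filterS => N.
by apply: le_lt_trans; apply: le_trans (zw N) _; rewrite ler_norm.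
Qed.

Lemma near0_nrm_lt (e : R) : 0 < e -> \forall z \near (0 : C), nrm z < e.
Proof.
move=> e0; apply/nbhs_ballP; exists (ofR e); first by rewrite /= -ofR0 lt_ofR.
by move=> z; rewrite /ball /= sub0r normrN nrmE lt_ofR.
Qed.

Lemma cvg_bigsum (I : Type) (s : seq I) (P : pred I) (z : I -> nat -> C) (l : I -> C) :
  (forall i, P i -> z i @ \oo --> l i) ->
  (fun N => \sum_(i <- s | P i) z i N) @ \oo --> \sum_(i <- s | P i) l i.
Proof.
move=> H; elim: s => [|i s IH].
  rewrite big_nil; have -> : (fun N => \sum_(i <- [::] | P i) z i N) = (fun=> 0).
    by apply/funext => N; rewrite big_nil.
  exact: cvg_cst.
rewrite big_cons.
have -> : (fun N => \sum_(j <- i :: s | P j) z j N) =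
  (fun N => if P i then z i N + \sum_(j <- s | P j) z j N else \sum_(j <- s | P j) z j N).
  by apply/funext => N; rewrite big_cons.
case: ifP => Pi; last exact: IH.
exact: (cvgD (H i Pi) IH).
Qed.

End Completeness.

Section Derivatives.
Variables (R : realType) (n : nat).
Local Notation C := (CC R).
Local Notation V := 'rV[C]_n.
Local Notation hform := (@hform R n).
Local Notation polydisc := (@polydisc R n).

(** Fréchet differentiability with a quadratic remainder; the increment is
    measured by [tau] as in [hform_diff]. *)
Definition has_grad (g : V -> C) (x : V) (a : 'I_n -> C) :=
  exists s B : R, 0 < s /\ forall tau h, 0 <= tau <= 1 -> polydisc (tau * s) h ->
    nrm (g (x + h) - g x - \sum_i h 0 i * a i) <= B * tau ^+ 2.

Fact pd_key : unit. Proof. exact: tt. Qed.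

(** Partial derivatives, locked because the unifier would otherwise unfold
    them down to the limit that defines them. *)
Definition pd : 'I_n -> (V -> C) -> V -> C :=
  locked_with pd_key (fun i g x => 'D_(delta_mx 0 i) g x).

Lemma pdE : pd = fun i g x => 'D_(delta_mx 0 i) g x.
Proof. by rewrite /pd; case: pd_key. Qed.

Lemma has_grad_derive g x a v : has_grad g x a ->
  derivable g x v /\ 'D_v g x = \sum_i v 0 i * a i.
Proof.
move=> [s [B [s0 H]]].
suff dl : (fun h : C => h^-1 *: ((g \o shift x) (h *: v) - g x)) @ 0^'
    --> \sum_i v 0 i * a i.
  by split; [exact: cvgP dl|exact: cvg_lim dl].
have B0 : 0 <= B.
  have := H 1 0; rewrite ler01 lexx expr1n mulr1 => H1.
  apply: le_trans (H1 _ _) => //; first exact: nrm_ge0.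
  by move=> i; rewrite mxE nrm0 mul1r ltW.
pose m := 1 + \sum_i nrm (v 0 i).
have m0 : 0 < m by rewrite ltr_pwDl// sumr_ge0// => ? _; exact: nrm_ge0.
have vm i : nrm (v 0 i) <= m.
  rewrite /m (bigD1 i)//= addrCA lerDl addr_ge0// sumr_ge0// => ? _; exact: nrm_ge0.
pose D := B * (m / s) ^+ 2 + 1.
have D0 : 0 < D by rewrite ltr_pwDr// mulr_ge0// sqr_ge0.
apply/nrm_cvgP => e e0.
have : \forall h \near (0 : C)^', nrm h < s / m.
  have d0 : 0 < s / m by rewrite divr_gt0.
  by apply: nbhs_dnbhs; exact: near0_nrm_lt.
have : \forall h \near (0 : C)^', nrm h < e / D.
  have d0 : 0 < e / D by rewrite divr_gt0.
  by apply: nbhs_dnbhs; exact: near0_nrm_lt.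
have : \forall h \near (0 : C)^', h != 0 by exact: nbhs_dnbhs_neq.
apply: filterS3 => h h0 he hs /=.
have nh0 : 0 < nrm h by rewrite nrm_gt0.
have := H (nrm h * m / s) (h *: v).
have tau1 : nrm h * m / s <= 1.
  by rewrite ler_pdivrMr// mul1r -ler_pdivlMr// ltW.
have tau0 : 0 <= nrm h * m / s by rewrite !mulr_ge0 ?invr_ge0 ?ltW.
rewrite tau0 tau1 => /(_ isT) H1.
have {}H1 := H1 _; rewrite [h *: v + x]addrC.
have -> : h^-1 *: (g (x + h *: v) - g x) - \sum_i v 0 i * a i =
   h^-1 * (g (x + h *: v) - g x - \sum_i (h *: v) 0 i * a i).
  rewrite -[h^-1 *: _]/(h^-1 * _) [RHS]mulrBr; congr (_ - _).
  rewrite mulr_sumr; apply: eq_bigr => i _.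
  by rewrite mxE !mulrA mulVf// mul1r.
rewrite nrmM nrmV mulrC ltr_pdivrMr//.
apply: (@le_lt_trans _ _ (B * (nrm h * m / s) ^+ 2)).
  apply: H1 => i; rewrite mxE nrmM divfK ?gt_eqF//.
  by rewrite ler_wpM2l ?nrm_ge0.
have -> : B * (nrm h * m / s) ^+ 2 = nrm h * (B * (m / s) ^+ 2) * nrm h by ring.
rewrite ltr_pM2r//; apply: (@le_lt_trans _ _ (nrm h * D)).
  by rewrite ler_wpM2l ?nrm_ge0// lerDl.
by rewrite -ltr_pdivlMr.
Qed.

Lemma has_grad_pd g x a i : has_grad g x a -> pd i g x = a i.
Proof.
move=> /(@has_grad_derive _ _ _ (delta_mx 0 i))[_]; rewrite pdE => ->.
rewrite (bigD1 i)//= mxE !eqxx mul1r big1 ?addr0// => j /negPf ji.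
by rewrite mxE eqxx /= ji mul0r.
Qed.

Lemma hform_grad d B p : hform d B p ->
  [/\ forall i, hform d.-1 (d%:R * B) (pd i p),
      (d = 0%N -> forall i, pd i p = (fun=> 0)),
      forall x, has_grad p x (pd^~ p ^~ x) &
      forall rho s tau x h, 0 <= rho -> 0 <= s -> 0 <= tau <= 1 ->
        polydisc rho x -> polydisc (tau * s) h ->
        nrm (p (x + h) - p x - \sum_i h 0 i * pd i p x)
          <= B * tau ^+ 2 * (rho + s) ^+ d].
Proof.
move=> /hform_diff[q [fq q0 Hq]].
have gq x : has_grad p x (q ^~ x).
  pose rho := \sum_i nrm (x 0 i).
  have r0 : 0 <= rho by rewrite sumr_ge0// => ? _; exact: nrm_ge0.
  exists 1, (B * (rho + 1) ^+ d); split => // tau h t01 hs.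
  have xr : polydisc rho x.
    move=> i; rewrite /rho (bigD1 i)//= lerDl sumr_ge0// => ? _; exact: nrm_ge0.
  have [_] := Hq rho 1 tau x h r0 ler01 t01 xr hs.
  by rewrite mulrAC.
have pq i : pd i p = q i by apply/funext => x; exact: has_grad_pd (gq x).
have gp x : (pd^~ p ^~ x) = q^~ x by apply/funext => i; rewrite pq.
split=> [i|d0 i|x|rho s tau x h r0 s0 t01 xr hs].
- by rewrite pq.
- by rewrite pq q0.
- by rewrite gp.
have [_] := Hq rho s tau x h r0 s0 t01 xr hs.
by under [X in _ -> nrm (_ - X) <= _]eq_bigr do rewrite pq.
Qed.

Lemma hform_series_tail K p rho x N M : 1 <= K ->
  (forall d, hform d (K ^+ d.+1) (p d)) -> 0 <= rho -> K * rho <= 2^-1 ->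
  polydisc rho x -> (N <= M)%N ->
  nrm (\sum_(d < M) p d x - \sum_(d < N) p d x) <= 2 * K * (K * rho) ^+ N.
Proof.
move=> K1 fp r0 Kr xr.
have K0 : 0 <= K by exact: le_trans K1.
have Kr0 : 0 <= K * rho by rewrite mulr_ge0.
suff H k : nrm (\sum_(d < N + k) p d x - \sum_(d < N) p d x) <=
    2 * K * (K * rho) ^+ N * (1 - (2^-1) ^+ k).
  move=> /subnKC <-; apply: le_trans (H _) _.
  rewrite ler_piMr ?mulr_ge0 ?exprn_ge0// lerBlDl lerDr exprn_ge0//.
elim: k => [|k IH]; first by rewrite addn0 subrr nrm0 expr0 subrr mulr0.
rewrite addnS big_ord_recr /= addrAC.
apply: (le_trans (nrmD _ _)); apply: (le_trans (lerD IH (hform_bound r0 xr (fp _)))).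
have -> : 2 * K * (K * rho) ^+ N * (1 - 2^-1 ^+ k.+1) =
   2 * K * (K * rho) ^+ N * (1 - 2^-1 ^+ k) + K * (K * rho) ^+ N * 2^-1 ^+ k.
  by rewrite exprS; field.
rewrite lerD2l exprSr mulrAC -exprMn mulrC exprD -mulrA ler_wpM2l// ler_wpM2l ?exprn_ge0//.
by rewrite lerXn2r ?nnegrE.
Qed.

(** The forms decrease geometrically, so that mere convergence of the partial
    sums already gives remainders of the required size. *)
Lemma expansion_of_cvg K p r g : 1 <= K -> (forall d, hform d (K ^+ d.+1) (p d)) ->
  0 < r -> (forall x, polydisc r x -> (fun N => \sum_(d < N) p d x) @ \oo --> g x) ->
  expansion (Num.max (2 * K) r^-1) p g.
Proof.
move=> K1 fp r0 Hg.
have K0 : 0 <= K by exact: le_trans K1.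
set K' := Num.max _ _.
have KK' : 2 * K <= K' by rewrite le_max lexx.
have K2 : K <= K' by apply: le_trans KK'; rewrite ler_peMl// ler1n.
split=> [|d|rho x N rho0 Kr xr]; first exact: le_trans K2.
  by apply: hform_le (fp d); rewrite lerXn2r ?nnegrE// (le_trans K0).
have xr' : polydisc r x.
  move=> i; apply: (le_trans (xr i)).
  have : r^-1 * rho <= 1.
    by apply: le_trans Kr; rewrite ler_wpM2r// le_max lexx orbT.
  by rewrite mulrC ler_pdivrMr// mul1r.
have Kr2 : K * rho <= 2^-1.
  rewrite -[2^-1]mul1r ler_pdivlMr// mulrC mulrA; apply: le_trans Kr.
  by rewrite ler_wpM2r.
apply: (@nrm_cvg_le _ (fun M => \sum_(d < M + N) p d x - \sum_(d < N) p d x)).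
  move=> M; apply: le_trans (hform_series_tail K1 fp rho0 Kr2 xr (leq_addl _ _)) _.
  rewrite exprMn mulrA ler_wpM2r ?exprn_ge0// exprS; apply: ler_pM => //.
    by rewrite mulr_ge0.
  by rewrite exprn_ge0.
  by rewrite lerXn2r ?nnegrE// (le_trans K0).
apply: cvgB; last exact: cvg_cst.
by have := Hg x xr'; rewrite -(cvg_shiftn N).
Qed.

Lemma expansion_cvg K p g rho x : expansion K p g -> 0 <= rho -> K * rho <= 2^-1 ->
  polydisc rho x -> (fun N => \sum_(d < N) p d x) @ \oo --> g x.
Proof.
move=> [K1 fp Hg] r0 Kr xr; have K0 : 0 <= K by exact: le_trans K1.
apply: (@nrm_squeeze _ _ _ (fun N => K / 2 ^+ N)); last exact: halfX_cvg.
move=> N; rewrite -nrmN opprB; apply: (le_trans (Hg rho x N r0 _ xr)).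
  by apply: le_trans Kr _; rewrite invf_le1// ler1n.
rewrite exprS -mulrA -exprMn ler_wpM2l// -exprVn lerXn2r ?nnegrE ?mulr_ge0//.
Qed.

(** Termwise differentiation: the quadratic remainders of the homogeneous
    parts are bounded by a convergent geometric series, uniformly in the
    increment, and hence survive the passage to the limit. *)
Lemma expansion_grad K p g : expansion K p g ->
  exists r K', [/\ 0 < r, forall x, polydisc r x -> has_grad g x (pd^~ g ^~ x) &
    forall i, expansion K' (fun d => pd i (p d.+1)) (pd i g)].
Proof.
move=> Hg; have [K1 fp _] := Hg; have K0 : 0 < K by exact: lt_le_trans K1.
pose K' := 2 * K ^+ 2; pose r := (4 * K ^+ 2)^-1.
have KK : K <= K ^+ 2 by rewrite expr2 ler_peMl// ltW.
have r0 : 0 < r by rewrite invr_gt0 mulr_gt0// exprn_gt0.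
have K'1 : 1 <= K' by rewrite mulr_ege1 ?ler1n// expr_ge1// ltW.
have K'r : K' * r = 2^-1.
  by rewrite /K' /r; field; rewrite gt_eqF.
have K2r : K * (r + r) <= 2^-1.
  by rewrite -K'r /K' -mulr2n mulrnAr -mulrnAl -mulr_natl ler_wpM2r ?(ltW r0)// ler_wpM2l.
have Kr : K * r <= 2^-1.
  by apply: le_trans K2r; rewrite ler_wpM2l ?(ltW K0)// lerDl ltW.
have fq i d : hform d (K' ^+ d.+1) (pd i (p d.+1)).
  have [/(_ i) H _ _ _] := hform_grad (fp d.+1); apply: hform_le H.
  rewrite /K' exprMn -exprM; apply: ler_pM.
  - by [].
  - by rewrite exprn_ge0// ltW.
  - by rewrite -natrX ler_nat ltnW// ltn_expl.
  - by rewrite ler_weXn2l//; lia.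
have HC i x : polydisc r x -> exists l : C, (fun N => \sum_(d < N) pd i (p d.+1) x) @ \oo --> l.
  move=> xr; apply: (@geometric_cauchy_cvg _ _ (2 * K')) => N M NM.
  have := hform_series_tail K'1 (fq i) (ltW r0) _ xr NM.
  by rewrite K'r exprVn; apply.
pose dg i x := lim ((fun N => \sum_(d < N) pd i (p d.+1) x) @ \oo).
have dgP i x : polydisc r x ->
    (fun N => \sum_(d < N) pd i (p d.+1) x) @ \oo --> dg i x.
  by move=> /(HC i x)[l Hl]; rewrite /dg (cvg_lim _ Hl).
have Hgr x : polydisc r x -> has_grad g x (dg^~ x).
  move=> xr; exists r, (2 * K); split=> // tau h /andP[t0 t1] hr.
  have hr' : polydisc (r + r) (x + h).
    move=> i; rewrite mxE; apply: (le_trans (nrmD _ _)); apply: lerD => //.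
    by apply: le_trans (hr i) _; rewrite ler_piMl// ltW.
  apply: (@nrm_cvg_le _ (fun N => \sum_(d < N.+1) p d (x + h) - \sum_(d < N.+1) p d x
      - \sum_i h 0 i * \sum_(d < N) pd i (p d.+1) x)); last first.
    apply: cvgB; first apply: cvgB.
    - have := expansion_cvg Hg (addr_ge0 (ltW r0) (ltW r0)) K2r hr'.
      by rewrite -(cvg_shiftS).
    - by have := expansion_cvg Hg (ltW r0) Kr xr; rewrite -(cvg_shiftS).
    - apply: cvg_bigsum => i _; apply: cvgM; first exact: cvg_cst.
      exact: dgP.
  move=> N.
  have -> : \sum_i h 0 i * \sum_(d < N) pd i (p d.+1) x =
      \sum_(d < N.+1) \sum_i h 0 i * pd i (p d) x.
    rewrite big_ord_recl /= [X in _ = X + _]big1 ?add0r; last first.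
      move=> i _; have [_ -> // _ _] := hform_grad (fp 0%N).
      by rewrite mulr0.
    rewrite exchange_big /=; apply: eq_bigr => i _; rewrite mulr_sumr.
    exact: eq_bigr.
  rewrite -!sumrB; apply: (le_trans (nrm_sum _ _ _)).
  apply: (@le_trans _ _ (\sum_(d < N.+1) K * tau ^+ 2 * 2^-1 ^+ d)).
    apply: ler_sum => d _.
    have [_ _ _ H] := hform_grad (fp d).
    apply: le_trans (H r r tau x h (ltW r0) (ltW r0) _ xr hr) _; first by rewrite t0.
    have -> : K ^+ d.+1 * tau ^+ 2 * (r + r) ^+ d =
        K * tau ^+ 2 * (K * (r + r)) ^+ d.
      by rewrite [K ^+ d.+1]exprS exprMn; ring.
    rewrite ler_wpM2l ?mulr_ge0 ?sqr_ge0 ?(ltW K0)//.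
    by rewrite lerXn2r ?nnegrE// mulr_ge0 ?(ltW K0)// addr_ge0// ltW.
  have -> : 2 * K * tau ^+ 2 = K * tau ^+ 2 * 2 by ring.
  rewrite -mulr_sumr ler_wpM2l ?mulr_ge0 ?sqr_ge0 ?(ltW K0)//.
  have -> : \sum_(d < N.+1) (2^-1 : R) ^+ d = 2 - 2^-1 ^+ N.
    elim: N => [|N IH]; first by rewrite big_ord1 expr0; ring.
    by rewrite big_ord_recr /= IH exprS; field.
  by rewrite lerBlDl lerDr exprn_ge0.
have pdE x : polydisc r x -> (pd^~ g ^~ x) = (dg^~ x).
  by move=> /Hgr gx; apply/funext => i; exact: has_grad_pd gx.
exists r, (Num.max (2 * K') r^-1); split=> // [x xr|i].
  by rewrite pdE//; exact: Hgr.
apply: expansion_of_cvg => // x xr.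
have -> : pd i g x = dg i x by have := pdE x xr => /(congr1 (fun f => f i)).
exact: dgP.
Qed.

Lemma germ_has_grad g : germ g -> \forall x \near (0 : V), has_grad g x (pd^~ g ^~ x).
Proof.
move=> [K [p /expansion_grad[r [K' [r0 Hr _]]]]]; apply/nbhs_rVP; exists r => // y Hy.
by apply: Hr => i; have := Hy i; rewrite mxE subr0 => /ltW.
Qed.

Lemma germ_pd g i : germ g -> germ (pd i g).
Proof. by move=> [K [p /expansion_grad[r [K' [r0 _ H]]]]]; eexists _, _; exact: H. Qed.

End Derivatives.

(** * Power series expansions *)

Section PartialDerivativeRules.
Variables (R : realType) (n : nat).
Local Notation C := (CC R).
Local Notation V := 'rV[C]_n.

Definition derivable_at (g : V -> C) (x : V) := forall v, derivable g x v.

Lemma has_grad_derivable g (x : V) a : has_grad g x a -> derivable_at g x.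
Proof. by move=> gx v; have [] := has_grad_derive v gx. Qed.

Lemma germ_derivable g : germ g -> \forall x \near (0 : V), derivable_at g x.
Proof. by move=> /germ_has_grad; apply: filterS => x /has_grad_derivable. Qed.

Lemma derivable_atM f g (x : V) : derivable_at f x -> derivable_at g x ->
  derivable_at (fun y => f y * g y) x.
Proof. by move=> fx gx v; apply: derivableM. Qed.

Lemma pdC i c (x : V) : pd i (fun=> c) x = 0.
Proof. by rewrite pdE; exact: derive_cst. Qed.

Lemma derivable_atC c (x : V) : derivable_at (fun=> c) x.
Proof. by move=> v; exact: derivable_cst. Qed.

Lemma pdD i f g (x : V) : derivable_at f x -> derivable_at g x ->
  pd i (fun y => f y + g y) x = pd i f x + pd i g x.
Proof. by move=> fx gx; rewrite pdE; apply: deriveD. Qed.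

Lemma pd_near i f g (x : V) : (\forall y \near x, f y = g y) -> pd i f x = pd i g x.
Proof. by move=> fg; rewrite pdE; exact: near_eq_derive. Qed.

Lemma pdM i f g (x : V) : derivable_at f x -> derivable_at g x ->
  pd i (fun y => f y * g y) x = f x * pd i g x + g x * pd i f x.
Proof. by move=> fx gx; rewrite pdE; apply: deriveM. Qed.

Lemma derivable_at_sum (I : Type) (s : seq I) (P : pred I) (f : I -> V -> C) (x : V) :
  (forall j, P j -> derivable_at (f j) x) ->
  derivable_at (fun y => \sum_(j <- s | P j) f j y) x.
Proof.
move=> H; elim: s => [|j s IH].
  have -> : (fun y : V => \sum_(j <- [::] | P j) f j y) = (fun=> 0).
    by apply/funext => y; rewrite big_nil.
  exact: derivable_atC.
have -> : (fun y : V => \sum_(k <- j :: s | P k) f k y) =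
  (fun y => if P j then f j y + \sum_(k <- s | P k) f k y else \sum_(k <- s | P k) f k y).
  by apply/funext => y; rewrite big_cons.
case: (boolP (P j)) => Pj; last exact: IH.
by move=> v; apply: derivableD; [exact: H|exact: IH].
Qed.

Lemma pd_sum i (I : Type) (s : seq I) (P : pred I) (f : I -> V -> C) (x : V) :
  (forall j, P j -> derivable_at (f j) x) ->
  pd i (fun y => \sum_(j <- s | P j) f j y) x = \sum_(j <- s | P j) pd i (f j) x.
Proof.
move=> H; elim: s => [|j s IH].
  have -> : (fun y : V => \sum_(j <- [::] | P j) f j y) = (fun=> 0).
    by apply/funext => y; rewrite big_nil.
  by rewrite big_nil pdC.
have -> : (fun y : V => \sum_(k <- j :: s | P k) f k y) =
  (fun y => if P j then f j y + \sum_(k <- s | P k) f k y else \sum_(k <- s | P k) f k y).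
  by apply/funext => y; rewrite big_cons.
rewrite big_cons; case: (boolP (P j)) => Pj; last exact: IH.
by rewrite pdD ?IH//; [exact: H|exact: derivable_at_sum].
Qed.

Lemma has_grad_coord j (x : V) : has_grad (fun y : V => y 0 j) x (fun i => (i == j)%:R).
Proof.
exists 1, 0; split=> // tau h _ _.
rewrite (bigD1 j)//= eqxx mulr1 big1 ?addr0 => [|i /negPf ->]; last by rewrite mulr0.
by rewrite mxE [x 0 j + _]addrC addrK subrr nrm0 mul0r.
Qed.

End PartialDerivativeRules.

Section MultiIndices.
Variable n : nat.
Local Notation multi := {ffun 'I_n -> nat}.
Implicit Types m : multi.

Definition mdeg m : nat := \sum_i m i.

Definition mshift (i : 'I_n) m : multi := [ffun j => (m j + (j == i))%N].

Definition multis (d : nat) : seq multi :=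
  [seq [ffun i => (b i : nat)] | b : {ffun 'I_n -> 'I_d.+1} <-
     [seq b : {ffun 'I_n -> 'I_d.+1} <- enum {ffun 'I_n -> 'I_d.+1} |
        \sum_i (b i : nat) == d]]%N.

Lemma leq_mdeg m i : (m i <= mdeg m)%N.
Proof. by rewrite /mdeg (bigD1 i)//= leq_addr. Qed.

Lemma mem_multis d m : (m \in multis d) = (mdeg m == d).
Proof.
apply/mapP/eqP => [[b]|md].
  rewrite mem_filter => /andP[/eqP bd _] ->.
  by rewrite -[RHS]bd; apply: eq_bigr => i _; rewrite ffunE.
exists [ffun i => inord (m i)].
  rewrite mem_filter mem_enum inE andbT; apply/eqP.
  rewrite -[RHS]md; apply: eq_bigr => i _.
  by rewrite ffunE inordK// ltnS -md leq_mdeg.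
by apply/ffunP => i; rewrite !ffunE inordK// ltnS -md leq_mdeg.
Qed.

Lemma multis_uniq d : uniq (multis d).
Proof.
rewrite map_inj_uniq; first by apply: filter_uniq; exact: enum_uniq.
move=> b b' /ffunP H.
by apply/ffunP => i; apply/val_inj; have := H i; rewrite !ffunE.
Qed.

Lemma size_multis d : (size (multis d) <= d.+1 ^ n)%N.
Proof.
rewrite size_map size_filter; apply: leq_trans (count_size _ _) _.
by rewrite -cardE card_ffun !card_ord.
Qed.

Lemma mdeg_shift i m : mdeg (mshift i m) = (mdeg m).+1.
Proof.
rewrite /mdeg; under eq_bigr do rewrite ffunE.
rewrite big_split /= -addn1; congr (_ + _)%N.
by rewrite (bigD1 i)//= eqxx big1 ?addn0// => j /negPf ->.
Qed.

Lemma mshift_inj i : injective (mshift i).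
Proof.
by move=> m m' /ffunP H; apply/ffunP => j; have := H j; rewrite !ffunE => /addIn.
Qed.

(** Multiplication by the coordinate [i] acts on the coefficients of a form
    through this bijection. *)
Lemma multis_shift i d :
  perm_eq [seq mshift i m | m <- multis d] [seq m : multi <- multis d.+1 | 0 < m i]%N.
Proof.
apply: uniq_perm.
- by rewrite map_inj_uniq ?multis_uniq//; exact: mshift_inj.
- by rewrite filter_uniq// multis_uniq.
move=> m; rewrite mem_filter mem_multis; apply/mapP/andP => [[m' + ->]|[m0 /eqP md]].
  by rewrite mem_multis => /eqP <-; rewrite ffunE eqxx addn1 mdeg_shift.
have mE : m = mshift i [ffun j => (m j - (j == i))%N].
  apply/ffunP => j; rewrite !ffunE subnK//.
  by case: eqP => [->|].
exists [ffun j => (m j - (j == i))%N] => //.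
by rewrite mem_multis -eqSS -md -(mdeg_shift i) -mE.
Qed.

End MultiIndices.

Section Coefficients.
Variables (R : realType) (n : nat).
Local Notation C := (CC R).
Local Notation V := 'rV[C]_n.
Local Notation multi := {ffun 'I_n -> nat}.
Local Notation hform := (@hform R n).
Local Notation polydisc := (@polydisc R n).

Lemma monomial_shift i (m : multi) (x : V) :
  monomial (mshift i m) x = x 0 i * monomial m x.
Proof.
rewrite /monomial; under eq_bigr do rewrite ffunE exprD.
rewrite big_split /= mulrC; congr (_ * _).
by rewrite (bigD1 i)//= eqxx expr1 big1 ?mulr1// => j /negPf ->; rewrite expr0.
Qed.

Lemma hform_monomial (m : multi) : hform (mdeg m) 1 (monomial m).
Proof.
rewrite /mdeg; have -> : monomial m = (fun x : V => \prod_i x 0 i ^+ m i) by [].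
elim: (index_enum _) => [|i s IH].
  have -> : (fun x : V => \prod_(i <- [::]) x 0 i ^+ m i) = (fun=> 1).
    by apply/funext => x; rewrite big_nil.
  by rewrite big_nil; apply: hformC; rewrite nrm1.
have -> : (fun x : V => \prod_(j <- i :: s) x 0 j ^+ m j) =
   (fun x : V => x 0 i ^+ m i * \prod_(j <- s) x 0 j ^+ m j).
  by apply/funext => x; rewrite big_cons.
rewrite big_cons -[1]mulr1; apply: hformM => //.
elim: (m i) => [|k IHk].
  by have : hform 0 1 (fun=> 1) by apply: hformC; rewrite nrm1.
have -> : (fun x : V => x 0 i ^+ k.+1) = (fun x => x 0 i * x 0 i ^+ k).
  by apply/funext => x; rewrite exprS.
exact: hformX.
Qed.

(** Derivatives are described through the Euler operators [x_i * d/dx_i]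
    because these act diagonally on monomials, without shifting exponents. *)
Lemma hform_coef d B p : hform d B p -> exists c : multi -> C,
  (forall x, p x = \sum_(m <- multis n d) c m * monomial m x) /\
  forall i (x : V), x 0 i * pd i p x = \sum_(m <- multis n d) c m * (m i)%:R * monomial m x.
Proof.
elim=> {d B p} [d B B0|c B cB|i d B p fp [c [Hc Hd]]|d B B' p q fp [c [Hc Hd]] fq [c' [Hc' Hd']]].
- exists (fun=> 0); split=> [x|i x]; first by rewrite big1// => *; rewrite mul0r.
  by rewrite pdC mulr0 big1// => *; rewrite !mul0r.
- have multis0 : multis n 0 = [:: [ffun=> 0%N]].
    apply/perm_small_eq => //; apply: uniq_perm => //; first exact: multis_uniq.
    move=> m; rewrite mem_multis inE; apply/eqP/eqP => [m0|->].
      apply/ffunP => i; rewrite ffunE; apply/eqP; rewrite -leqn0 -m0; exact: leq_mdeg.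
    by rewrite /mdeg big1// => i _; rewrite ffunE.
  exists (fun=> c); split=> [x|i x]; rewrite multis0 big_seq1.
    by rewrite /monomial big1 ?mulr1// => i _; rewrite ffunE expr0.
  by rewrite pdC mulr0 ffunE mulr0 mul0r.
- have dp x := has_grad_derivable (let: And4 _ _ H _ := hform_grad fp in H x).
  pose c' (m : multi) : C :=
    if (0 < m i)%N then c [ffun j => (m j - (j == i))%N] else 0.
  have c'E m : c' (mshift i m) = c m.
    rewrite /c' ffunE eqxx addn1 /=; congr c.
    by apply/ffunP => j; rewrite !ffunE addnK.
  have sumE (F : multi -> C) : \sum_(m <- multis n d.+1) c' m * F m =
      \sum_(m <- multis n d) c m * F (mshift i m).
    rewrite (bigID (fun m : multi => 0 < m i)%N)/= [X in _ + X]big1 ?addr0; last first.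
      by move=> m /negPf m0; rewrite /c' m0 mul0r.
    rewrite -big_filter -(perm_big _ (multis_shift i d)) big_map.
    by apply: eq_bigr => m _; rewrite c'E.
  exists c'; split=> [x|j x].
    rewrite sumE Hc mulr_sumr; apply: eq_bigr => m _.
    by rewrite monomial_shift mulrCA.
  under eq_bigr do rewrite -mulrA.
  rewrite (sumE (fun m => (m j)%:R * monomial m x)) pdM//; last first.
    exact: has_grad_derivable (has_grad_coord i x).
  rewrite (has_grad_pd _ (has_grad_coord i x)) mulrDr mulrCA Hd.
  have -> : x 0 j * (p x * (j == i)%:R) =
     x 0 i * \sum_(m <- multis n d) c m * (j == i)%:R * monomial m x.
    have [->|_] := eqVneq j i; last first.
      by rewrite !mulr0 big1 ?mulr0// => m _; rewrite mulr0 mul0r.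
    by rewrite mulr1 Hc; congr (_ * _); apply: eq_bigr => m _; rewrite mulr1.
  rewrite -mulrDr -big_split mulr_sumr /=; apply: eq_bigr => m _.
  by rewrite monomial_shift ffunE natrD; ring.
- have dp x := has_grad_derivable (let: And4 _ _ H _ := hform_grad fp in H x).
  have dq x := has_grad_derivable (let: And4 _ _ H _ := hform_grad fq in H x).
  exists (fun m => c m + c' m); split=> [x|i x].
    by rewrite Hc Hc' -big_split; apply: eq_bigr => m _; rewrite mulrDl.
  rewrite (pdD i (dp x) (dq x)).
  rewrite mulrDr; apply: (etrans (congr2 +%R (Hd i x) (Hd' i x))).
  rewrite -big_split; apply: eq_bigr => m _.
  by rewrite !mulrDl.
Qed.

(** ** Convergent power series are germs *)

(** Beyond a finite set of indices, adding one more index to a partial sum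
    moves it by less than 2. *)
Lemma totally_bounded (t : multi -> C) (l : C) :
  partial_sum t @ totally --> l -> exists B : R, forall m, nrm (t m) <= B.
Proof.
move=> tl; have FT : Filter (@totally multi) by case: (@totally_filter multi).
have [A _ HA] := (nrm_cvgP (partial_sum t) l).1 tl 1 ltr01.
have A0 : 0 <= \sum_(m <- A) nrm (t m) by apply: sumr_ge0 => *; exact: nrm_ge0.
exists (2 + \sum_(m <- A) nrm (t m)) => m.
case: (boolP (m \in A)) => mA.
  rewrite (big_fsetD1 m)//= addrCA lerDl addr_ge0// sumr_ge0// => *; exact: nrm_ge0.
have HA0 := HA A (fsubset_refl A).
have HA1 := HA (m |` A)%fset (fsubsetU1 m A).
move: HA0 HA1; rewrite /= /partial_sum -!(big_seq_fsetE _ _ xpredT t)/=.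
rewrite big_fsetU1//= => HA0 HA1.
have -> : t m = (t m + \sum_(i <- A) t i - l) - (\sum_(i <- A) t i - l) by ring.
apply: (le_trans (nrmB _ _)); apply: (@le_trans _ _ (1 + 1)).
  by apply: lerD; exact: ltW.
by rewrite lerDl.
Qed.

Lemma totally_cvg_by_degree (t : multi -> C) (l : C) :
  partial_sum t @ totally --> l ->
  (fun N => \sum_(d < N) \sum_(m <- multis n d) t m) @ \oo --> l.
Proof.
move=> tl; apply/nrm_cvgP => e e0.
have FT : Filter (@totally multi) by case: (@totally_filter multi).
have [A _ HA] := (nrm_cvgP (partial_sum t) l).1 tl e e0.
exists (\sum_(m <- A) mdeg m).+1 => // N /= AN.
pose s := flatten [seq multis n d | d <- iota 0 N].
have mems m : (m \in s) = (mdeg m < N)%N.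
  apply/flatten_mapP/idP => [[d]|mN].
    by rewrite mem_iota mem_multis => /andP[_ dN] /eqP ->.
  by exists (mdeg m); rewrite ?mem_iota// mem_multis.
have us : uniq s.
  rewrite /s; elim: N {AN mems s} => [//|N IH].
  rewrite -addn1 iotaD add0n map_cat flatten_cat cat_uniq IH /= cats0 multis_uniq andbT.
  apply/hasPn => m; rewrite mem_multis => /eqP mN.
  apply/negP => /flatten_mapP[d]; rewrite mem_iota mem_multis mN => /andP[_ dN] /eqP Nd.
  by rewrite -Nd ltnn in dN.
have := HA [fset m in s]%fset; rewrite /partial_sum -!(big_seq_fsetE _ _ xpredT t)/=.
have -> : \sum_(m <- [fset m in s]%fset) t m = \sum_(d < N) \sum_(m <- multis n d) t m.
  rewrite (perm_big s); last first.
    by apply: uniq_perm; rewrite ?fset_uniq// => m; rewrite in_fset.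
  by rewrite big_flatten big_map -{1}(subn0 N) big_mkord.
apply; apply/fsubsetP => m mA; rewrite in_fset /= mems.
apply: leq_trans AN; rewrite ltnS (big_fsetD1 m)//=; exact: leq_addr.
Qed.

(** Convergence at one point with equal positive coordinates bounds the
    coefficients geometrically, and the number of monomials of degree [d] is
    itself at most exponential in [d]. *)
Lemma analytic_at_germ (g : V -> C) : analytic_at g 0 -> germ g.
Proof.
move=> [c /nbhs_rVP[e e0 H]].
have {}H (x : V) : (forall i, nrm (x 0 i) < e) ->
    partial_sum (fun m => c m * monomial m x) @ totally --> g x.
  move=> xe; have := H x; rewrite subr0; apply => i.
  by rewrite mxE subr0.
pose rho := e / 2.
have rho0 : 0 < rho by rewrite divr_gt0.
have rhoe : rho < e by rewrite ltr_pdivrMr// ltr_pMr// ltr1n.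
have [B HB] : exists B, forall m, nrm (c m) * rho ^+ mdeg m <= B.
  have [i|B HB] := totally_bounded (H (\row_i ofR rho) _).
    by rewrite mxE nrm_ofR ger0_norm// ltW.
  exists B => m; have := HB m; rewrite nrmM; congr (_ * _ <= _).
  rewrite /monomial /mdeg -prodrXr.
  elim/big_rec2: _ => [|i y z _ IH]; first by rewrite nrm1.
  by rewrite nrmM IH mxE nrmX nrm_ofR ger0_norm// ltW.
have B0 : 0 <= B.
  by apply: le_trans (HB [ffun=> 0%N]); rewrite mulr_ge0 ?nrm_ge0// exprn_ge0// ltW.
pose K := 2 ^+ n * (B + 1) * (1 + rho^-1).
have rV0 : 0 < rho^-1 by rewrite invr_gt0.
have K1 : 1 <= K.
  apply: mulr_ege1; last by rewrite lerDl ltW.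
  apply: mulr_ege1; last by rewrite lerDr.
  by apply: exprn_ege1; rewrite ler1n.
exists (Num.max (2 * K) rho^-1), (fun d (x : V) => \sum_(m <- multis n d) c m * monomial m x).
apply: expansion_of_cvg => //; last first.
  move=> x xr; apply: totally_cvg_by_degree; apply: H => i.
  exact: le_lt_trans (xr i) _.
move=> d; apply: (@hform_le _ _ _ (\sum_(m <- multis n d) nrm (c m))); last first.
  rewrite big_seq_cond.
  have -> : (fun x : V => \sum_(m <- multis n d) c m * monomial m x) =
     (fun x => \sum_(m <- multis n d | (m \in multis n d) && true) c m * monomial m x).
    by apply/funext => x; rewrite -big_seq_cond.
  apply: hform_sum => m /andP[+ _]; rewrite mem_multis => /eqP <-.
  rewrite -[nrm (c m)]mulr1; exact: hformZ (hform_monomial m).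
apply: (@le_trans _ _ (\sum_(m <- multis n d) B / rho ^+ d)).
  rewrite big_seq_cond [leRHS]big_seq_cond; apply: ler_sum => m /andP[+ _].
  rewrite mem_multis => /eqP <-; rewrite ler_pdivlMr ?exprn_gt0//; exact: HB.
rewrite big_const_seq count_predT iter_addr_0 -mulr_natl.
rewrite [K ^+ _]exprMn [(2 ^+ n * _) ^+ _]exprMn -mulrA.
apply: ler_pM => //.
- by rewrite mulr_ge0// invr_ge0 exprn_ge0// ltW.
- rewrite -!natrX ler_nat; apply: leq_trans (size_multis _ _) _.
  rewrite -expnM mulnC expnM; case: (n) => // k.
  by rewrite leq_exp2r// ltnW// ltn_expl.
apply: ler_pM => //.
- by rewrite invr_ge0 exprn_ge0// ltW.
- rewrite exprS; apply: (@le_trans _ _ (B + 1)); first by rewrite lerDl.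
  by rewrite ler_peMr ?addr_ge0// exprn_ege1// lerDr.
- rewrite -exprVn exprS; apply: (@le_trans _ _ ((1 + rho^-1) ^+ d)).
    by rewrite lerXn2r ?nnegrE ?addr_ge0 ?(ltW rV0)// lerDr.
  by rewrite ler_peMl ?exprn_ge0 ?addr_ge0 ?(ltW rV0)// lerDl ltW.
Qed.

End Coefficients.

(** * Leading exponents along a sequence tending to the origin *)

Section Curve.
Variables (R : realType) (n : nat) (a : 'I_n -> nat).
Local Notation C := (CC R).
Local Notation V := 'rV[C]_n.
Local Notation multi := {ffun 'I_n -> nat}.
Local Notation hform := (@hform R n).
Local Notation polydisc := (@polydisc R n).
Hypothesis a_gt1 : forall i, (1 < a i)%N.
Hypothesis a_coprime : forall i j, i != j -> coprime (a i) (a j).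

(** Every monomial decays along this sequence at an exponential rate of its
    own, the weight of its exponent. Comparing rates of decay thus plays the
    role of a monomial order, and leading terms become limits. *)
Definition curve (s : nat) : V := \row_i (a i)%:R^-1 ^+ s.

Definition weight (m : multi) : nat := \prod_i a i ^ m i.

Lemma weight_gt0 m : (0 < weight m)%N.
Proof. by apply: prodn_gt0 => i; rewrite expn_gt0 ltnW. Qed.

Lemma monomial_curve m s : monomial m (curve s) = (weight m)%:R^-1 ^+ s.
Proof.
rewrite /monomial /weight natr_prod -prodfV -prodrXl.
apply: eq_bigr => i _; rewrite mxE -exprM natrX -exprVn -exprM mulnC //.
Qed.

Lemma expn2_mdeg_weight m : (2 ^ mdeg m <= weight m)%N.
Proof.
rewrite /mdeg /weight expn_sum; apply: leq_prod => i _.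
by case: (m i) => // k; rewrite leq_exp2r.
Qed.

(** A prime factor of [a i] divides no other [a j], so that its multiplicity
    in the weight of [m] determines [m i]. *)
Lemma weight_inj : injective weight.
Proof.
move=> m m' mm'; apply/ffunP => i.
pose q := pdiv (a i); have q_pr : prime q by rewrite pdiv_prime.
have qa : (0 < logn q (a i))%N by rewrite logn_gt0 mem_primes q_pr pdiv_dvd ltnW.
suff H k : logn q (weight k) = (k i * logn q (a i))%N.
  by apply/eqP; rewrite -(eqn_pmul2r qa) -!H mm'.
rewrite /weight (bigD1 i)//= lognM ?expn_gt0 ?(ltnW (a_gt1 _))//; last first.
  by apply: prodn_gt0 => j; rewrite expn_gt0 ltnW.
rewrite lognX [X in (_ + X)%N](_ : _ = 0%N) ?addn0//.
apply: logn_coprime; elim/big_rec: _ => [|j y ji IH]; first exact: coprimen1.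
rewrite coprimeMr IH andbT coprimeXr//.
by apply: coprime_dvdl (pdiv_dvd _) _; rewrite a_coprime// eq_sym.
Qed.

Lemma curve_polydisc s : polydisc (2^-1 ^+ s) (curve s).
Proof.
move=> i; rewrite mxE nrmX nrmV nrm_nat lerXn2r ?nnegrE ?invr_ge0//.
by rewrite lef_pV2 ?posrE ?ltr0n ?ler_nat// ltnW.
Qed.

Lemma near_curve (P : set V) : (\forall x \near (0 : V), P x) ->
  \forall s \near \oo, P (curve s).
Proof.
move=> /nbhs_rVP[e e0 HP].
have := @cvg_expr R 2^-1; rewrite ger0_norm// invf_lt1// ltr1n => /(_ isT).
move=> /cvgr0Pnorm_lt /(_ _ e0); apply: filterS => s.
rewrite ger0_norm ?exprn_ge0// => se; apply: HP => i.
by rewrite [X in _ - X]mxE subr0; apply: le_lt_trans se; exact: curve_polydisc.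
Qed.

Lemma cvg_ratioR (p q : nat) : (p < q)%N ->
  (fun s => (q%:R^-1 * p%:R : R) ^+ s) @ \oo --> (0 : R).
Proof.
move=> pq; have q0 : (0 : R) < q%:R by rewrite ltr0n; case: q pq.
apply: cvg_expr; rewrite ger0_norm ?mulr_ge0 ?invr_ge0 ?ler0n//.
by rewrite mulrC ltr_pdivrMr// mul1r ltr_nat.
Qed.

Lemma cvg_ratio (p q : nat) : (p < q)%N ->
  (fun s => (q%:R^-1 * p%:R : C) ^+ s) @ \oo --> (0 : C).
Proof.
move=> /cvg_ratioR; apply: nrm_squeeze.
by move=> s; rewrite subr0 nrmX nrmM nrmV !nrm_nat.
Qed.

(** Multiplied by [weight m0 ^ s], the term of exponent [m] is geometric of
    ratio [weight m0 / weight m]; the remainder is negligible as soon as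
    [weight m0 < 2 ^ N], because all the [a i] are at least 2. *)
Lemma weighted_sum_cvg (b : multi -> C) N m0 (r : nat -> C) (B : R) :
  (forall m, (weight m < weight m0)%N -> b m = 0) -> (weight m0 < 2 ^ N)%N ->
  (\forall s \near \oo, nrm (r s) <= B * (2^-1 ^+ s) ^+ N) ->
  (fun s => (\sum_(d < N) \sum_(m <- multis n d) b m * monomial m (curve s) + r s)
      * (weight m0)%:R ^+ s) @ \oo --> b m0.
Proof.
move=> bm0 m0N rB.
have m0d : (mdeg m0 < N)%N.
  by rewrite -(ltn_exp2l _ _ (ltnSn 1)); apply: leq_ltn_trans (expn2_mdeg_weight _) _.
pose t s := \sum_(d < N) \sum_(m <- multis n d)
   b m * ((weight m)%:R^-1 * (weight m0)%:R) ^+ s.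
pose r' s := r s * (weight m0)%:R ^+ s.
have -> : (fun s => (\sum_(d < N) \sum_(m <- multis n d) b m * monomial m (curve s) + r s)
      * (weight m0)%:R ^+ s) = (fun s => t s + r' s).
  apply/funext => s; rewrite mulrDl; congr (_ + _); rewrite mulr_suml.
  apply: eq_bigr => d _; rewrite mulr_suml; apply: eq_bigr => m _.
  by rewrite monomial_curve exprMn mulrA.
have tE : t @ \oo --> b m0.
  have -> : b m0 = \sum_(d < N) \sum_(m <- multis n d) (if m == m0 then b m0 else 0).
    rewrite (bigD1 (Ordinal m0d))//= [X in _ + X]big1 ?addr0; last first.
      move=> d dm; rewrite big_seq big1// => m; rewrite mem_multis => /eqP md.
      case: eqP => // mm0; case/eqP: dm; apply/val_inj => /=; by rewrite -md mm0.
    rewrite (bigD1_seq m0) ?multis_uniq ?mem_multis//= eqxx big1 ?addr0//.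
    by move=> m /negPf ->.
  apply: cvg_bigsum => d _; apply: cvg_bigsum => m _.
  case: eqP => [->|/eqP mm0].
    rewrite mulVf; last by rewrite pnatr_eq0 -lt0n weight_gt0.
    have -> : (fun s => b m0 * (1 : C) ^+ s) = (fun=> b m0).
      by apply/funext => s; rewrite expr1n mulr1.
    exact: cvg_cst.
  have [ltm|gtm|/weight_inj eqm] := ltngtP (weight m) (weight m0).
  - have -> : (fun s => b m * ((weight m)%:R^-1 * (weight m0)%:R) ^+ s) = (fun=> 0).
      by apply/funext => s; rewrite bm0// mul0r.
    exact: cvg_cst.
  - rewrite -(mulr0 (b m)); apply: cvgM; [exact: cvg_cst|exact: cvg_ratio].
  - by rewrite eqm eqxx in mm0.
have r'E : r' @ \oo --> (0 : C).
  have gs := cvg_ratioR m0N.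
  have : (fun s => B * ((2 ^ N)%:R^-1 * (weight m0)%:R : R) ^+ s) @ \oo --> (0 : R).
    by rewrite -(mulr0 B); apply: cvgM gs; exact: cvg_cst.
  move=> /cvgr0Pnorm_lt H; apply/nrm_cvgP => e e0.
  apply: filterS2 rB (H e e0) => s rs; apply: le_lt_trans.
  rewrite subr0 nrmM nrmX nrm_nat; apply: le_trans (ler_norm _).
  rewrite exprMn mulrA ler_wpM2r ?exprn_ge0//.
  by apply: le_trans rs _; rewrite natrX -exprVn -!exprM mulnC.
rewrite -[b m0]addr0; exact: (cvgD tE r'E).
Qed.

Lemma eq_cvg_seq (z z' : nat -> C) (l : C) : z =1 z' -> z @ \oo --> l -> z' @ \oo --> l.
Proof. by move=> /funext ->. Qed.

Definition taylor (c : multi -> C) (g : V -> C) := exists K p,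
  [/\ expansion K p g,
      forall d x, p d x = \sum_(m <- multis n d) c m * monomial m x &
      forall d i (x : V), x 0 i * pd i (p d) x =
        \sum_(m <- multis n d) c m * (m i)%:R * monomial m x].

Lemma germ_taylor g : germ g -> exists c, taylor c g.
Proof.
move=> [K [p Hp]]; have [_ fp _] := Hp.
have [c Hc] := choice (fun d => hform_coef (fp d)).
exists (fun m => c (mdeg m) m), K, p; split=> // [d x|d i x].
  rewrite (Hc d).1 big_seq [RHS]big_seq; apply: eq_bigr => m.
  by rewrite mem_multis => /eqP ->.
rewrite (Hc d).2 big_seq [RHS]big_seq; apply: eq_bigr => m.
by rewrite mem_multis => /eqP ->.
Qed.

Definition has_value (g : V -> C) (m : multi) (e : C) :=
  (fun s => g (curve s) * (weight m)%:R ^+ s) @ \oo --> e.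

(** [m] and [e] are the leading exponent and coefficient of [g]; an Euler
    operator keeps the exponent and multiplies the coefficient by an entry of
    [m]. Only when [e != 0] does this determine [m]. *)
Definition has_lead (g : V -> C) (m : multi) (e : C) :=
  has_value g m e /\
  forall i, has_value (fun x => x 0 i * pd i g x) m ((m i)%:R * e).

Lemma taylor_has_lead c g m0 : taylor c g ->
  (forall m, (weight m < weight m0)%N -> c m = 0) -> has_lead g m0 (c m0).
Proof.
move=> [K [p [Hp pE dpE]]] cm0.
pose N := (weight m0).
have wN : (weight m0 < 2 ^ N)%N by exact: ltn_expl.
have half_cvg := @cvg_expr R 2^-1.
rewrite ger0_norm// invf_lt1// ltr1n in half_cvg.
have rem (K' : R) p' g' : expansion K' p' g' -> \forall s \near \oo, forall N,
    nrm (g' (curve s) - \sum_(d < N) p' d (curve s)) <= K' ^+ N.+1 * (2^-1 ^+ s) ^+ N.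
  move=> [K1 _ Hg']; have K0 : 0 < K' by exact: lt_le_trans K1.
  have KV : 0 < K'^-1 by rewrite invr_gt0.
  move/cvgr0Pnorm_lt : (half_cvg isT) => /(_ _ KV); apply: filterS => s.
  rewrite ger0_norm ?exprn_ge0// => Ks N'; apply: Hg'; first exact: exprn_ge0.
    by rewrite mulrC -ler_pdivlMr// mul1r ltW.
  exact: curve_polydisc.
split.
  pose r s := g (curve s) - \sum_(d < N) p d (curve s).
  have := @weighted_sum_cvg c N m0 r (K ^+ N.+1) cm0 wN _.
  have H : \forall s \near \oo, nrm (r s) <= K ^+ N.+1 * (2^-1 ^+ s) ^+ N.
    by apply: filterS (rem _ _ _ Hp) => s; exact.
  move=> /(_ H); apply: eq_cvg_seq => s.
  congr (_ * _); rewrite /r; under eq_bigr do rewrite -pE.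
  by rewrite addrC subrK.
move=> i; have [_ [K' [_ _ /(_ i) Hdp]]] := expansion_grad Hp.
pose r s := (curve s) 0 i * (pd i g (curve s) - \sum_(d < N) pd i (p d.+1) (curve s)).
pose b (m : multi) := c m * (m i)%:R.
have wN' : (weight m0 < 2 ^ N.+1)%N by apply: ltn_trans wN _; rewrite ltn_exp2l.
have bm0 m : (weight m < weight m0)%N -> b m = 0 by move=> /cm0; rewrite /b => ->; rewrite mul0r.
have := @weighted_sum_cvg b N.+1 m0 r (K' ^+ N.+1) bm0 wN' _.
have H : \forall s \near \oo, nrm (r s) <= K' ^+ N.+1 * (2^-1 ^+ s) ^+ N.+1.
  apply: filterS (rem _ _ _ Hdp) => s /(_ N) Hs.
  rewrite /r nrmM [(_ ^+ s) ^+ N.+1]exprSr mulrA mulrC; apply: ler_pM; rewrite ?nrm_ge0//.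
  exact: curve_polydisc.
move=> /(_ H); rewrite /b [_ * _%:R]mulrC.
apply: eq_cvg_seq => s; congr (_ * _).
under eq_bigr do rewrite -dpE.
rewrite big_ord_recl /=.
have -> : curve s 0 i * pd i (p 0%N) (curve s) = 0.
  rewrite (dpE 0%N i (curve s)) big_seq big1// => m; rewrite mem_multis => /eqP m0'.
  have -> : m i = 0%N by apply/eqP; rewrite -leqn0 -m0' leq_mdeg.
  by rewrite mulr0 mul0r.
by rewrite add0r /r mulrBr mulr_sumr addrC subrK.
Qed.

Lemma taylor_eq0 c g : taylor c g -> (forall m, c m = 0) ->
  \forall x \near (0 : V), g x = 0.
Proof.
move=> [K [p [[K1 fp Hg] pE _]]] c0; have K0 : 0 < K by exact: lt_le_trans K1.
apply/nbhs_rVP; exists (K^-1 / 2); first by rewrite divr_gt0// invr_gt0.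
move=> x Hx; apply/nrm_eq0/eqP; rewrite eq_le nrm_ge0 andbT.
apply/ler_addgt0Pr => e e0; rewrite add0r.
have [N HN] := halfX_small K e0; apply: le_trans (ltW HN).
have := Hg (K^-1 / 2) x N; rewrite big1 ?subr0; last first.
  by move=> d _; rewrite pE big1// => m _; rewrite c0 mul0r.
move=> /(_ _ _ _)/le_trans; apply.
- by rewrite divr_ge0// invr_ge0 ltW.
- by rewrite mulrA divff ?gt_eqF// mul1r invf_le1// ler1n.
- by move=> i; have := Hx i; rewrite mxE subr0 => /ltW.
- rewrite exprMn exprS -mulrA [_ ^+ N * _]mulrA -exprMn divff ?gt_eqF// expr1n mul1r.
  by rewrite exprVn.
Qed.

(** The leading exponent is the one of least weight among the exponents with a
    nonzero coefficient; there is one, for otherwise all the partial sums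
    vanish. *)
Lemma taylor_lead c g : taylor c g -> ~ (\forall x \near (0 : V), g x = 0) ->
  exists2 m, c m != 0 & has_lead g m (c m).
Proof.
move=> cg g0; pose P k := `[< exists2 m, weight m = k & c m != 0 >].
have : exists k, P k.
  apply: contrapT => nP; apply: g0; apply: taylor_eq0 cg _ => m.
  apply/eqP/negPn/negP => cm; apply: nP; exists (weight m).
  by apply/asboolP; exists m.
move=> exP; case: (ex_minnP exP) => k /asboolP[m wm cm] kmin.
exists m => //; apply: taylor_has_lead => // m' m'm.
apply/eqP/negPn/negP => cm'.
have := kmin (weight m'); rewrite leqNgt -wm m'm => H.
by have : false by apply: H; apply/asboolP; exists m'.
Qed.

Lemma germ_lead g : germ g -> ~ (\forall x \near (0 : V), g x = 0) ->
  exists m e, e != 0 /\ has_lead g m e.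
Proof.
by move=> /germ_taylor[c cg] /(taylor_lead cg)[m cm Hm]; exists m, (c m).
Qed.

Lemma has_value_neq0 g m e : has_value g m e -> e != 0 ->
  \forall s \near \oo, g (curve s) != 0.
Proof.
move=> gm e0; have ne : 0 < nrm e by rewrite nrm_gt0.
move/nrm_cvgP : gm => /(_ _ ne); apply: filterS => s; apply: contraTneq => ->.
by rewrite mul0r sub0r nrmN ltxx.
Qed.

Lemma has_value_nonzero g m e : has_value g m e -> e != 0 ->
  ~ (\forall x \near (0 : V), g x = 0).
Proof.
move=> gm e0 /near_curve g0.
have [s [/eqP]] : exists s, (g (curve s) != 0) /\ g (curve s) = 0.
  have := filterI (has_value_neq0 gm e0) g0.
  by move=> [N _ HN]; exists N; exact: HN (leqnn N).
by [].
Qed.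

Definition madd (m m' : multi) : multi := [ffun i => (m i + m' i)%N].

Lemma weightD m m' : weight (madd m m') = (weight m * weight m')%N.
Proof.
rewrite /weight -big_split; apply: eq_bigr => i _.
by rewrite ffunE expnD.
Qed.

Lemma has_valueM g m e g' m' e' : has_value g m e -> has_value g' m' e' ->
  has_value (fun x => g x * g' x) (madd m m') (e * e').
Proof.
move=> gm gm'; apply: (eq_cvg_seq _ (cvgM gm gm')) => s.
by rewrite weightD natrM exprMn mulrACA.
Qed.

(** The leading coefficient of a product is the product of the leading
    coefficients. *)
Lemma germM_nonzero g g' : germ g -> germ g' ->
  ~ (\forall x \near (0 : V), g x = 0) -> ~ (\forall x \near (0 : V), g' x = 0) ->
  ~ (\forall x \near (0 : V), g x * g' x = 0).
Proof.
move=> /germ_lead H /germ_lead H' /H[m [e [e0 [gm _]]]] /H'[m' [e' [e0' [gm' _]]]].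
by apply: has_value_nonzero (has_valueM gm gm') _; rewrite mulf_neq0.
Qed.

End Curve.

(** * The twisted derivation *)

Section TwistedDerivation.
Variables (R : realType) (n : nat) (I : finType) (iota : I -> 'I_n).
Local Notation C := (CC R).
Local Notation V := 'rV[C]_n.

Definition vder (v : I -> C) (g : V -> C) (x : V) : C :=
  \sum_p v p * pd (iota p) g x.

Variables (H : V -> C) (x : V) (v : I -> C).
Hypothesis dH : derivable_at H x.

(** The value [e] is [H ^+ (D + 1)] times the derivative of [b / H ^+ D],
    written without denominators; it vanishes when this fraction is a first
    integral. *)
Definition twisted (D : nat) (b : V -> C) (e : C) :=
  derivable_at b x /\ H x * vder v b x - D%:R * b x * vder v H x = e.

Lemma vderM f g : derivable_at f x -> derivable_at g x ->
  vder v (fun y => f y * g y) x = f x * vder v g x + g x * vder v f x.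
Proof.
move=> df dg; rewrite /vder !mulr_sumr -big_split; apply: eq_bigr => p _.
by rewrite pdM// mulrDr; congr (_ + _); rewrite mulrCA.
Qed.

Lemma twistedM D b e D' b' e' : twisted D b e -> twisted D' b' e' ->
  twisted (D + D') (fun y => b y * b' y) (b x * e' + b' x * e).
Proof.
move=> [db <-] [db' <-]; split; first exact: derivable_atM.
by rewrite vderM// natrD; ring.
Qed.

Lemma twisted_cst c : twisted 0 (fun=> c) 0.
Proof.
split; first exact: derivable_atC.
rewrite mul0r mul0r subr0 /vder big1 ?mulr0// => p _.
by rewrite pdC mulr0.
Qed.

Lemma twistedH : twisted 1 H 0.
Proof. by split=> //; rewrite mul1r subrr. Qed.

Lemma twistedX b e k : twisted 1 b e ->
  twisted k (fun y => b y ^+ k) (k%:R * b x ^+ k.-1 * e).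
Proof.
move=> be; elim: k => [|k IH].
  rewrite mul0r mul0r; have := twisted_cst 1; congr twisted.
have := twistedM be IH; rewrite add1n.
have -> : (fun y => b y * b y ^+ k) = (fun y => b y ^+ k.+1).
  by apply/funext => y; rewrite exprS.
congr twisted; rewrite -natr1 /=; case: k {IH be} => [|k] /=; first by ring.
by rewrite exprS; ring.
Qed.

Lemma twisted_prod0 (J : Type) (s : seq J) (P : pred J) (D : J -> nat) (b : J -> V -> C) :
  (forall j, P j -> twisted (D j) (b j) 0) ->
  twisted (\sum_(j <- s | P j) D j) (fun y => \prod_(j <- s | P j) b j y) 0.
Proof.
move=> Hb; elim: s => [|j s IH].
  have -> : (fun y : V => \prod_(j <- [::] | P j) b j y) = (fun=> 1).
    by apply/funext => y; rewrite big_nil.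
  rewrite big_nil; exact: twisted_cst.
have -> : (fun y : V => \prod_(k <- j :: s | P k) b k y) =
  (fun y => if P j then b j y * \prod_(k <- s | P k) b k y else \prod_(k <- s | P k) b k y).
  by apply/funext => y; rewrite big_cons.
rewrite big_cons; case: (boolP (P j)) => Pj; last exact: IH.
by have := twistedM (Hb j Pj) IH; rewrite !mulr0 addr0.
Qed.

Lemma twisted_sum D (J : Type) (s : seq J) (P : pred J) (c : J -> C) (b : J -> V -> C)
    (e : J -> C) : (forall j, P j -> twisted D (b j) (e j)) ->
  twisted D (fun y => \sum_(j <- s | P j) c j * b j y) (\sum_(j <- s | P j) c j * e j).
Proof.
move=> Hb; have dcb j : P j -> derivable_at (fun y => c j * b j y) x.
  by move=> /Hb[db _]; exact: (derivable_atM (@derivable_atC R n (c j) x) db).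
split; first exact: derivable_at_sum.
have -> : vder v (fun y => \sum_(j <- s | P j) c j * b j y) x =
    \sum_(j <- s | P j) c j * vder v (b j) x.
  rewrite /vder; under [RHS]eq_bigr do rewrite mulr_sumr.
  rewrite [RHS]exchange_big /=; apply: eq_bigr => p _.
  rewrite pd_sum// mulr_sumr; apply: eq_bigr => j Pj.
  rewrite (pdM _ (@derivable_atC R n (c j) x) (Hb j Pj).1) pdC mulr0 addr0.
  by rewrite mulrCA.
rewrite [D%:R * _]mulr_sumr mulr_suml mulr_sumr -sumrB; apply: eq_bigr => j Pj.
by have [_ <-] := Hb j Pj; ring.
Qed.

End TwistedDerivation.

Section HomogeneousMonomials.
Variables (R : realType) (n k : nat).
Local Notation C := (CC R).
Local Notation V := 'rV[C]_n.
Local Notation multik := {ffun 'I_k -> nat}.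
Variables (G : 'I_k -> V -> C) (H : V -> C).

(** The numerator over [H ^+ D] of a monomial in the fractions [G j / H]. *)
Definition hmonomial (D : nat) (q : multik) (x : V) : C :=
  (\prod_j G j x ^+ q j) * H x ^+ (D - mdeg q).

Definition mpred (i : 'I_k) (q : multik) : multik := [ffun j => (q j - (j == i))%N].

Lemma mpredK i (q : multik) : (0 < q i)%N -> mshift i (mpred i q) = q.
Proof.
by move=> qi; apply/ffunP => j; rewrite !ffunE subnK//; case: eqP => [->|].
Qed.

Lemma mdeg_pred i (q : multik) : (0 < q i)%N -> (mdeg (mpred i q)).+1 = mdeg q.
Proof. by move=> qi; rewrite -(mdeg_shift i) mpredK. Qed.

(** The fractions [G j / H] with [j != i] are constant along [v] and the
    [i]-th one has derivative [delta / H ^+ 2]: up to this factor, [v] acts on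
    monomials in the fractions as differentiation with respect to the [i]-th
    one. For [delta = 0] all of them are constant. *)
Lemma twisted_hmonomial (I : finType) (iota : I -> 'I_n) (x : V) (v : I -> C)
    (i : 'I_k) (delta : C) D q : derivable_at H x ->
  (forall j, twisted iota H x v 1 (G j) (if j == i then delta else 0)) ->
  (mdeg q <= D)%N ->
  twisted iota H x v D (hmonomial D q)
    ((q i)%:R * delta * hmonomial D.-1 (mpred i q) x).
Proof.
move=> dH HG qD.
have H1 := twistedX (q i) (HG i); rewrite eqxx in H1.
have H2 : twisted iota H x v (\sum_(j | j != i) q j)
    (fun y => \prod_(j | j != i) G j y ^+ q j) 0.
  apply: twisted_prod0 => j /negPf ji; have := twistedX (q j) (HG j).
  by rewrite ji mulr0.
have H3 := twistedX (D - mdeg q) (twistedH iota v dH); rewrite mulr0 in H3.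
have := twistedM (twistedM H1 H2) H3.
have -> : (q i + \sum_(j | j != i) q j + (D - mdeg q))%N = D.
  by have -> : (q i + \sum_(j | j != i) q j = mdeg q)%N; [rewrite [RHS](bigD1 i)|rewrite subnKC].
have -> : (fun y => G i y ^+ q i * \prod_(j | j != i) G j y ^+ q j * H y ^+ (D - mdeg q))
    = hmonomial D q.
  by apply/funext => y; rewrite /hmonomial [in RHS](bigD1 i).
congr twisted; rewrite !mulr0 !add0r.
case: (posnP (q i)) => [->|qi]; first by rewrite !mul0r !mulr0.
have -> : hmonomial D.-1 (mpred i q) x =
    G i x ^+ (q i).-1 * (\prod_(j | j != i) G j x ^+ q j) * H x ^+ (D - mdeg q).
  rewrite /hmonomial (bigD1 i)//= ffunE eqxx subn1; congr (_ * _ * _).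
    by apply: eq_bigr => j /negPf ji; rewrite ffunE ji subn0.
  by rewrite -(mdeg_pred qi) -subn1 -subnDA add1n.
by ring.
Qed.

Lemma germ_hmonomial D q : (forall j, germ (G j)) -> germ H -> germ (hmonomial D q).
Proof.
move=> gG gH; apply: germM; last exact: germX.
by apply: germ_prod => j _; exact: germX.
Qed.

End HomogeneousMonomials.

(** * The zero estimate *)

Section ZeroEstimate.
Variables (R : realType) (n : nat) (a : 'I_n -> nat).
Local Notation C := (CC R).
Local Notation V := 'rV[C]_n.
Local Notation multi := {ffun 'I_n -> nat}.
Hypothesis a_gt1 : forall i, (1 < a i)%N.
Hypothesis a_coprime : forall i j, i != j -> coprime (a i) (a j).
Local Notation curve := (curve R a).
Local Notation weight := (weight a).

Definition seq_bounded (z : nat -> C) :=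
  exists B : R, \forall s \near \oo, nrm (z s) <= B.

Lemma seq_bounded_cvg z (l : C) : z @ \oo --> l -> seq_bounded z.
Proof.
move=> /nrm_cvgP /(_ 1 ltr01) Hz; exists (nrm l + 1); apply: filterS Hz => s Hs.
have -> : z s = l + (z s - l) by rewrite addrC subrK.
by apply: (le_trans (nrmD _ _)); rewrite lerD2l ltW.
Qed.

Lemma seq_boundedM z z' : seq_bounded z -> seq_bounded z' ->
  seq_bounded (fun s => z s * z' s).
Proof.
move=> [B HB] [B' HB']; exists (B * B'); apply: filterS2 HB HB' => s Hs Hs'.
by rewrite nrmM; apply: ler_pM; rewrite ?nrm_ge0.
Qed.

Lemma seq_boundedB z z' : seq_bounded z -> seq_bounded z' ->
  seq_bounded (fun s => z s - z' s).
Proof.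
move=> [B HB] [B' HB']; exists (B + B'); apply: filterS2 HB HB' => s Hs Hs'.
by apply: (le_trans (nrmB _ _)); exact: lerD.
Qed.

Lemma seq_bounded_sum (I : Type) (s : seq I) (P : pred I) (z : I -> nat -> C) :
  (forall i, seq_bounded (z i)) -> seq_bounded (fun N => \sum_(i <- s | P i) z i N).
Proof.
move=> H; elim: s => [|i s [B IH]].
  by exists 0; apply: nearW => N; rewrite big_nil nrm0.
have [B' HB'] := H i; exists (`|B'| + `|B|); apply: filterS2 IH HB' => N HN HN'.
rewrite big_cons; case: ifP => _.
  apply: (le_trans (nrmD _ _)); apply: lerD.
    by apply: le_trans HN' _; exact: ler_norm.
  by apply: le_trans HN _; exact: ler_norm.
by apply: le_trans HN _; apply: le_trans (ler_norm _) _; rewrite lerDr.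
Qed.

Lemma seq_bounded_near z z' : (\forall s \near \oo, z s = z' s) ->
  seq_bounded z -> seq_bounded z'.
Proof. by move=> zz' [B HB]; exists B; apply: filterS2 zz' HB => s ->. Qed.

Lemma germ_curve_bounded g : germ g -> seq_bounded (fun s => g (curve s)).
Proof.
move=> [K [p [K1 _ Hg]]]; have K0 : 0 < K by exact: lt_le_trans K1.
exists K; apply: (near_curve a_gt1 (P := [set x | nrm (g x) <= K])).
apply/nbhs_rVP; exists K^-1; first by rewrite invr_gt0.
move=> x Hx /=; have := Hg K^-1 x 0%N; rewrite big_ord0 subr0 expr1 expr0 mulr1; apply.
- by rewrite invr_ge0 ltW.
- by rewrite divff// gt_eqF.
- by move=> i; have := Hx i; rewrite mxE subr0 => /ltW.
Qed.

(** If [p * weight m < w], the boundedness assumption would force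
    [g (curve s) * weight m ^ s] to tend to 0. *)
Lemma bounded_weight_le g m e (w p : nat) : has_value a g m e -> e != 0 -> (0 < p)%N ->
  seq_bounded (fun s => g (curve s) * (p%:R^-1 * w%:R) ^+ s) ->
  (w <= p * weight m)%N.
Proof.
move=> gm e0 p0 [B HB]; rewrite leqNgt; apply/negP => wlt.
have w0 : (0 < w)%N by apply: leq_ltn_trans wlt.
have pC : p%:R != 0 :> C by rewrite pnatr_eq0 -lt0n.
have wC : w%:R != 0 :> C by rewrite pnatr_eq0 -lt0n.
suff gm0 : (fun s => g (curve s) * (weight m)%:R ^+ s) @ \oo --> (0 : C).
  by move: e0; rewrite -(cvg_lim (@norm_hausdorff _ _) gm) (cvg_lim (@norm_hausdorff _ _) gm0) eqxx.
have := @cvg_ratioR R _ _ wlt => rt.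
have : (fun s => B * (w%:R^-1 * (p * weight m)%:R) ^+ s) @ \oo --> (0 : R).
  by rewrite -(mulr0 B); apply: cvgM rt; exact: cvg_cst.
move=> /cvgr0Pnorm_lt H; apply/nrm_cvgP => ep ep0.
apply: filterS2 HB (H ep ep0) => s Hs; apply: le_lt_trans.
rewrite subr0; apply: le_trans (ler_norm _).
have -> : g (curve s) * (weight m)%:R ^+ s =
   g (curve s) * (p%:R^-1 * w%:R) ^+ s * (w%:R^-1 * (p * weight m)%:R) ^+ s.
  rewrite -mulrA -exprMn; congr (_ * _ ^+ _).
  by rewrite natrM; field; rewrite pC wC.
rewrite nrmM; apply: ler_pM; rewrite ?nrm_ge0//.
by rewrite nrmX nrmM nrmV !nrm_nat.
Qed.

Lemma has_value_weight_le (g : V -> C) m e m' e' : has_value a g m e -> has_value a g m' e' ->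
  e' != 0 -> (weight m <= weight m')%N.
Proof.
move=> gm gm' e0; rewrite -[leqRHS]mul1n; apply: (bounded_weight_le gm' e0) => //.
apply: (@seq_bounded_cvg _ e); apply: eq_cvg_seq gm => s.
by rewrite invr1 mul1r.
Qed.

Lemma has_valueX (g : V -> C) m e D : has_value a g m e ->
  has_value a (fun x => g x ^+ D) [ffun i => (D * m i)%N] (e ^+ D).
Proof.
move=> gm; elim: D => [|D IH].
  rewrite /has_value; apply: (@eq_cvg_seq _ (fun=> 1)); last exact: cvg_cst.
  move=> s; rewrite expr0 /weight big1 ?expr1n ?mulr1// => i _.
  by rewrite ffunE.
have := has_valueM gm IH; rewrite exprS.
have -> : madd m [ffun i => (D * m i)%N] = [ffun i => (D.+1 * m i)%N].
  by apply/ffunP => i; rewrite !ffunE mulSn.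
by apply: eq_cvg_seq => s; rewrite exprS.
Qed.

Lemma weight_scale (m : multi) D : weight [ffun i => (D * m i)%N] = (weight m ^ D)%N.
Proof.
rewrite /weight (big_morph (fun w => w ^ D)%N (fun x y => expnMn x y D) (exp1n D)).
by apply: eq_bigr => i _; rewrite ffunE mulnC expnM.
Qed.

Variables (k : nat) (G : 'I_k -> V -> C) (H : V -> C) (sigma : 'I_k -> 'I_n).
Hypotheses (gG : forall j, germ (G j)) (gH : germ H).

(** [H ^+ 2] times the derivative of [G j / H] in the direction [l]. *)
Definition wronskian (j : 'I_k) (l : 'I_n) (x : V) : C :=
  H x * pd l (G j) x - G j x * pd l H x.

Definition wronskian_minor (x : V) : 'M[C]_k :=
  \matrix_(j, p) wronskian j (sigma p) x.

Lemma germ_wronskian j l : germ (wronskian j l).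
Proof. by apply: germB; apply: germM => //; exact: germ_pd. Qed.

Lemma germ_wronskian_adj p i : germ (fun x => (\adj (wronskian_minor x)) p i).
Proof.
have -> : (fun x => (\adj (wronskian_minor x)) p i) =
    (fun x => (-1) ^+ (i + p) * \det (\matrix_(u, w) wronskian (lift i u) (sigma (lift p w)) x)).
  apply/funext => x; rewrite mxE /cofactor; congr (_ * \det _).
  by apply/matrixP => u w; rewrite !mxE.
apply: germM; first exact: germC.
by apply: germ_det => u w; exact: germ_wronskian.
Qed.

(** Cramer's rule: column [i] of the adjugate is a vector field dual to the
    differential of the [i]-th fraction, up to the determinant. *)
Lemma wronskian_twisted i (x : V) j : derivable_at (G j) x ->
  twisted sigma H x (fun p => (\adj (wronskian_minor x)) p i) 1 (G j)
    (if j == i then \det (wronskian_minor x) else 0).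
Proof.
move=> dG; split=> //; rewrite /vder !mulr_sumr mul1r -sumrB.
have := congr1 (fun M : 'M[C]_k => M j i) (mul_mx_adj (wronskian_minor x)).
rewrite !mxE => E; rewrite -[RHS](_ : \det (wronskian_minor x) *+ (j == i) = _); last first.
  by case: eqP.
rewrite -E; apply: eq_bigr => p _; rewrite [in RHS]mxE /wronskian; ring.
Qed.

Variable amax : nat.
Hypotheses (amax0 : (0 < amax)%N) (a_le : forall i, (a i <= amax)%N).
Hypotheses (H_nz : ~ (\forall x \near (0 : V), H x = 0))
  (det_nz : ~ (\forall x \near (0 : V), \det (wronskian_minor x) = 0)).

(** The numerator over [H ^+ D] of a polynomial in the fractions [G j / H]. *)
Definition hpolynomial (J : finType) (A : pred J) (q : J -> {ffun 'I_k -> nat})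
    (c : J -> C) (D : nat) (x : V) : C :=
  \sum_(j | A j) c j * hmonomial G H D (q j) x.

Lemma germ_hpolynomial (J : finType) (A : pred J) q c D :
  germ (@hpolynomial J A q c D).
Proof.
by apply: germ_sum => j _; apply: germM; [exact: germC|exact: germ_hmonomial].
Qed.

(** This is where functional independence enters. A polynomial of degree at
    most [D] in the fractions is reduced to a constant by at most [D] partial
    derivatives, and each of them is realized, up to the factor [det], by a
    vector field with analytic coefficients. A derivation divides the weight
    of the leading exponent by [amax] at most, while the factor [det]
    contributes its own weight; so the weight before the derivation is at
    most a constant times the weight after it. *)
Lemma zero_estimate : exists beta : nat, forall D (J : finType) (A : pred J)
    (q : J -> {ffun 'I_k -> nat}) (c : J -> C),
  (exists j, A j) -> (forall j, A j -> c j != 0) -> {in A &, injective q} ->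
  (forall j, A j -> mdeg (q j) <= D)%N ->
  exists m e, [/\ e != 0, has_lead a (hpolynomial A q c D) m e &
    (weight m <= beta ^ D)%N].
Proof.
have [mH [eH [eH0 [vH _]]]] := germ_lead a_gt1 a_coprime gH H_nz.
have gdet : germ (fun x => \det (wronskian_minor x)).
  by apply: germ_det => j p; exact: germ_wronskian.
have [md [ed [ed0 [vd _]]]] := germ_lead a_gt1 a_coprime gdet det_nz.
have wpos := weight_gt0 a_gt1.
pose beta := (amax * weight md * weight mH)%N; exists beta.
have lead_of_value (g : V -> C) m e : germ g -> has_value a g m e -> e != 0 ->
    exists m' e', [/\ e' != 0, has_lead a g m' e' & (weight m' <= weight m)%N].
  move=> gg gm e0; have nz := has_value_nonzero a_gt1 gm e0.
  have [m' [e' [e'0 Hm']]] := germ_lead a_gt1 a_coprime gg nz.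
  exists m', e'; split=> //; have [vm' _] := Hm'.

  exact: (has_value_weight_le vm' gm e0).
(* a constant [c], whose numerator is [c * H ^+ D] *)
have const D (J : finType) (A : pred J) (q : J -> {ffun 'I_k -> nat}) (c : J -> C) :
    (exists j, A j) -> (forall j, A j -> c j != 0) -> {in A &, injective q} ->
    (forall j, A j -> forall i, q j i = 0%N) ->
    exists m e, [/\ e != 0, has_lead a (hpolynomial A q c D) m e &
      (weight m <= beta ^ D)%N].
  move=> [j0 Aj0] c0 qinj q0.
  have uE : hpolynomial A q c D = (fun x => c j0 * H x ^+ D).
    apply/funext => x; rewrite /hpolynomial (bigD1 j0)//= big1 ?addr0; last first.
      move=> j /andP[Aj /eqP[]]; apply: qinj => //.
      by apply/ffunP => i; rewrite !q0.
    rewrite /hmonomial big1 => [|i _]; last by rewrite q0.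
    by rewrite mul1r /mdeg big1 ?subn0// => i _; rewrite q0.
  have val : has_value a (hpolynomial A q c D) [ffun i => (D * mH i)%N] (c j0 * eH ^+ D).
    have cc : (fun _ : nat => c j0) @ \oo --> c j0 by exact: cvg_cst.
    rewrite uE /has_value.
    apply: (eq_cvg_seq _ (cvgM cc (has_valueX (D := D) vH))) => s.
    by rewrite /= mulrA.
  have [m [e [e0 Hm wm]]] := lead_of_value _ _ _ (germ_hpolynomial A q c D) val
     (mulf_neq0 (c0 _ Aj0) (expf_neq0 D eH0)).
  exists m, e; split=> //; apply: leq_trans wm _; rewrite weight_scale.
  by case: (D) => // D'; rewrite leq_exp2r// /beta leq_pmull// muln_gt0 wpos andbT.
elim=> [|D IH] J A q c exA c0 qinj qD.
  apply: const => // j Aj i; apply/eqP; rewrite -leqn0.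
  by apply: leq_trans (qD j Aj); exact: leq_mdeg.
have [[j1 [i [Aj1 qi]]]|nq] := pselect (exists j i, A j /\ (0 < q j i)%N); last first.
  apply: const => // j Aj i; apply/eqP; rewrite -leqn0 leqNgt; apply/negP => qi.
  by apply: nq; exists j, i.
(* the derivative with respect to the [i]-th fraction; keeping the index set
   [J] and restricting [A] avoids any re-indexing *)
pose A' j := A j && (0 < q j i)%N.
pose q' j := mpred i (q j); pose c' j := (q j i)%:R * c j.
have [] := IH J A' q' c'.
- by exists j1; rewrite /A' Aj1.
- move=> j /andP[Aj qj]; rewrite /c' mulf_neq0 ?c0//.
  by rewrite pnatr_eq0 -lt0n.
- move=> j j' /andP[Aj qj] /andP[Aj' qj'] E; apply: qinj => //.
  by rewrite -(mpredK qj) -/(q' j) E mpredK.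
- by move=> j /andP[Aj qj]; rewrite -ltnS mdeg_pred// qD.
move=> m' [e' [e'0 [vu' _] wm']].
pose u := hpolynomial A q c D.+1; pose u' := hpolynomial A' q' c' D.
pose del x := \det (wronskian_minor x).
pose adj p x := (\adj (wronskian_minor x)) p i.
have gu : germ u by exact: germ_hpolynomial.
have tw : \forall x \near (0 : V),
    twisted sigma H x (adj^~ x) D.+1 u (del x * u' x).
  have dG : \forall x \near (0 : V), forall j, derivable_at (G j) x.
    exact: (@filter_forall V 'I_k (fun j => [set x | derivable_at (G j) x])
      (nbhs (0 : V)) _ (fun j => germ_derivable (gG j))).
  apply: filterS2 dG (germ_derivable gH) => x dG dH.
  have -> : del x * u' x =
      \sum_(j | A j) c j * ((q j i)%:R * del x * hmonomial G H D (mpred i (q j)) x).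
    rewrite (bigID (fun j => 0 < q j i)%N)/= [X in _ = _ + X]big1 ?addr0; last first.
      by move=> j /andP[_]; rewrite -eqn0Ngt => /eqP ->; rewrite !mul0r mulr0.
    by rewrite mulr_sumr; apply: eq_bigr => j _; rewrite /c' /q'; ring.
  have tq j : A j -> twisted sigma H x (adj^~ x) D.+1 (hmonomial G H D.+1 (q j))
      ((q j i)%:R * del x * hmonomial G H D (mpred i (q j)) x).
    move=> Aj; exact: (twisted_hmonomial dH
      (fun j' => wronskian_twisted i (dG j')) (qD j Aj)).
  exact: (twisted_sum (index_enum J) c tq).
have vT : has_value a (fun x => del x * u' x) (madd md m') (ed * e').
  exact: (has_valueM vd vu').
have T0 : ed * e' != 0 by rewrite mulf_neq0.
have u_nz : ~ (\forall x \near (0 : V), u x = 0).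
  move=> u0; apply: (has_value_nonzero a_gt1 vT T0).
  move/near_join : u0 => u0; apply: filterS2 tw u0 => x [_ <-] ux.
  rewrite (nbhs_singleton ux) mulr0 mul0r subr0 /vder big1 ?mulr0// => p _.
  have -> : pd (sigma p) u x = 0; last by rewrite mulr0.
  by rewrite -(pdC (sigma p) 0 x); exact: pd_near.
have [m [e [e0 Hm]]] := germ_lead a_gt1 a_coprime gu u_nz.
exists m, e; split=> //.
suff : (weight m <= amax * weight (madd md m'))%N.
  move=> /leq_trans; apply; rewrite weightD expnS mulnA.
  apply: leq_mul => //; rewrite /beta leq_pmulr//.
apply: (bounded_weight_le vT T0 amax0).
(* each [x_l * d/dx_l u] decays at the rate of [u], and dividing by the
   coordinate [l] costs a factor [a l ^ s <= amax ^ s] *)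
pose z s := H (curve s) * (\sum_p adj p (curve s) *
     ((curve s 0 (sigma p) * pd (sigma p) u (curve s) * (weight m)%:R ^+ s) *
      (amax%:R^-1 * (a (sigma p))%:R) ^+ s))
   - D.+1%:R * (u (curve s) * (weight m)%:R ^+ s) * (amax%:R^-1) ^+ s *
      vder sigma (adj^~ (curve s)) H (curve s).
apply: (@seq_bounded_near z).
  apply: filterS (near_curve a_gt1 tw) => s [_ <-]; rewrite /z mulrBl exprMn.
  congr (_ - _); last by ring.
  rewrite -[RHS]mulrA; congr (_ * _).
  rewrite /vder mulr_suml; apply: eq_bigr => p _.
  rewrite mxE !exprMn exprVn; field.
  by rewrite !expf_neq0 ?pnatr_eq0 -?lt0n// ltnW.
have bq l : seq_bounded (fun s => (amax%:R^-1 * (a l)%:R) ^+ s).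
  exists 1; apply: nearW => s; rewrite nrmX nrmM nrmV !nrm_nat.
  by rewrite exprn_ile1 ?mulr_ge0 ?invr_ge0// mulrC ler_pdivrMr ?ltr0n// mul1r ler_nat.
have bcst (b : C) : seq_bounded (fun=> b) by apply: seq_bounded_cvg; exact: cvg_cst.
apply: seq_boundedB; apply: seq_boundedM.
- exact: germ_curve_bounded.
- apply: seq_bounded_sum => p; apply: seq_boundedM.
    by apply: germ_curve_bounded; exact: germ_wronskian_adj.
  by apply: seq_boundedM => //; have [_ /(_ (sigma p))] := Hm; exact: seq_bounded_cvg.
- apply: seq_boundedM; first apply: seq_boundedM => //.
    by have [+ _] := Hm; exact: seq_bounded_cvg.
  exists 1; apply: nearW => s; rewrite nrmX nrmV nrm_nat exprn_ile1 ?invr_ge0//.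
  by rewrite invf_le1 ?ltr0n// ler1n.
- apply: (@germ_curve_bounded (fun x => vder sigma (adj^~ x) H x)).
  apply: germ_sum => p _; apply: germM; first exact: germ_wronskian_adj.
  exact: germ_pd.
Qed.

End ZeroEstimate.

(** * Resonant leading exponents and their number *)

Section TaylorLinear.
Variables (R : realType) (n : nat).
Local Notation C := (CC R).
Local Notation V := 'rV[C]_n.
Local Notation multi := {ffun 'I_n -> nat}.

Lemma expansion_derivable K p (g : V -> C) d (x : V) :
  expansion K p g -> derivable_at (p d) x.
Proof.
move=> [_ fp _]; have [_ _ H _] := hform_grad (fp d).
exact: has_grad_derivable (H x).
Qed.

Lemma taylor0 : taylor (fun _ : multi => 0) (fun _ : V => 0 : C).
Proof.
exists (1 + nrm (0 : C)), (fun d _ => if d == 0%N then 0 else 0).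
split; first exact: expansionC.
  by move=> d x; rewrite big1 => [|m _]; rewrite ?mul0r//; case: eqP.
move=> d i x; rewrite big1 => [|m _]; last by rewrite !mul0r.
by case: eqP => _; rewrite pdC mulr0.
Qed.

Lemma taylorD c c' (g g' : V -> C) : taylor c g -> taylor c' g' ->
  taylor (fun m => c m + c' m) (fun x => g x + g' x).
Proof.
move=> [K [p [Hp pE dE]]] [K' [p' [Hp' pE' dE']]].
exists (K + K'), (fun d x => p d x + p' d x); split; first exact: expansionD.
  move=> d x; rewrite pE pE' -big_split; apply: eq_bigr => m _.
  by rewrite mulrDl.
move=> d i x.
rewrite (pdD i (expansion_derivable Hp) (expansion_derivable Hp')).
rewrite mulrDr dE dE' -big_split; apply: eq_bigr => m _.
by rewrite !mulrDl.
Qed.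

Lemma expansionZ b K p (g : V -> C) : expansion K p g ->
  expansion ((1 + nrm b) * K) (fun d x => b * p d x) (fun x => b * g x).
Proof.
move=> [K1 fp Hg]; have K0 : 0 <= K by exact: le_trans K1.
have b0 : 0 <= nrm b by exact: nrm_ge0.
have b1 : 1 <= 1 + nrm b by rewrite lerDl.
have bX d : nrm b * K ^+ d.+1 <= ((1 + nrm b) * K) ^+ d.+1.
  rewrite exprMn ler_wpM2r ?exprn_ge0// exprS.
  apply: (@le_trans _ _ (1 + nrm b)); first by rewrite lerDr.
  by rewrite ler_peMr ?addr_ge0// exprn_ege1.
split=> [|d|rho x N r0 Kr xr]; first exact: mulr_ege1.
  apply: hform_le (bX d) _; exact: hformZ.
rewrite -mulr_sumr -mulrBr nrmM.
apply: (@le_trans _ _ (nrm b * K ^+ N.+1 * rho ^+ N)); last first.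
  by rewrite ler_wpM2r ?exprn_ge0//; exact: bX.
rewrite -mulrA ler_wpM2l//; apply: Hg => //.
by apply: le_trans Kr; rewrite ler_wpM2r// ler_peMl.
Qed.

Lemma taylorZ b c (g : V -> C) : taylor c g ->
  taylor (fun m => b * c m) (fun x => b * g x).
Proof.
move=> [K [p [Hp pE dE]]].
exists ((1 + nrm b) * K), (fun d x => b * p d x); split; first exact: expansionZ.
  by move=> d x; rewrite pE mulr_sumr; apply: eq_bigr => m _; rewrite mulrA.
move=> d i x.
rewrite (pdM i (@derivable_atC R n b x) (expansion_derivable Hp)).
rewrite pdC mulr0 addr0 mulrCA dE mulr_sumr; apply: eq_bigr => m _.
by rewrite !mulrA.
Qed.

Lemma taylor_sum (J : Type) (s : seq J) (P : pred J) (b : J -> C)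
    (c : J -> multi -> C) (g : J -> V -> C) : (forall j, taylor (c j) (g j)) ->
  taylor (fun m => \sum_(j <- s | P j) b j * c j m)
         (fun x => \sum_(j <- s | P j) b j * g j x).
Proof.
move=> H; elim: s => [|j s IH].
  have -> : (fun m : multi => \sum_(j <- [::] | P j) b j * c j m) = (fun=> 0).
    by apply/funext => m; rewrite big_nil.
  have -> : (fun x : V => \sum_(j <- [::] | P j) b j * g j x) = (fun=> 0).
    by apply/funext => x; rewrite big_nil.
  exact: taylor0.
have -> : (fun m : multi => \sum_(l <- j :: s | P l) b l * c l m) = (fun m =>
    if P j then b j * c j m + \sum_(l <- s | P l) b l * c l m
    else \sum_(l <- s | P l) b l * c l m).
  by apply/funext => m; rewrite big_cons.
have -> : (fun x : V => \sum_(l <- j :: s | P l) b l * g l x) = (fun x =>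
    if P j then b j * g j x + \sum_(l <- s | P l) b l * g l x
    else \sum_(l <- s | P l) b l * g l x).
  by apply/funext => x; rewrite big_cons.
case: (P j); last exact: IH.
exact: (taylorD (taylorZ (b j) (H j)) IH).
Qed.

End TaylorLinear.

(** The matrix of a basis of [W] has an invertible square submatrix; its
    columns are the coordinates sought. *)
Lemma vspace_coordinates (K : fieldType) n (W : {vspace 'rV[K]_n}) :
  exists iota : 'I_(\dim W) -> 'I_n,
    forall w, w \in W -> (forall p, w 0 (iota p) = 0) -> w = 0.
Proof.
pose B := \matrix_(p < \dim W) (vbasis W)`_p.
have mulB (v : 'rV[K]_(\dim W)) : v *m B = \sum_p v 0 p *: (vbasis W)`_p.
  by rewrite mulmx_sum_row; apply: eq_bigr => p _; rewrite rowK.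
have Bfree : row_free B.
  apply: inj_row_free => v; rewrite mulB => v0; apply/rowP => p; rewrite mxE.
  by have /freeP/(_ (fun p => v 0 p) v0) := basis_free (vbasisP W).
have Afull : row_full B^T by rewrite /row_full mxrank_tr.
exists (fullrankfun Afull) => w wW w0.
have wE : w = (\row_p coord (vbasis W) p w) *m B.
  rewrite mulB {1}(coord_vbasis wW); apply: eq_bigr => p _; by rewrite mxE.
set c := \row_p _ in wE.
suff c0 : c^T = 0 by rewrite wE -[c]trmxK c0 trmx0 mul0mx.
pose A := rowsub (fullrankfun Afull) B^T; have Ac : A *m c^T = 0.
  apply/matrixP => p j; rewrite mxE [RHS]mxE ord1 -[RHS](w0 p) wE [RHS]mxE.
  by apply: eq_bigr => q _; rewrite !mxE mulrC.
have Au : A \in unitmx by exact: fullrowsub_unit.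
by rewrite -(mulKmx Au c^T) Ac mulmx0.
Qed.

(** If [r < k], the choice [d = (b + 1) ^ r + 1] violates the bound. *)
Lemma exp_growth (b k r : nat) :
  (forall d, (0 < d)%N -> (d ^ k <= (b * d).+1 ^ r)%N) -> (k <= r)%N.
Proof.
move=> H; rewrite leqNgt; apply/negP => rk.
pose d := (b.+1 ^ r).+1; have := H d isT; rewrite leqNgt => /negP; apply.
apply: (@leq_ltn_trans ((b.+1 * d) ^ r)).
  by case: (r) => // r'; rewrite leq_exp2r// mulSn -addn1 addnC leq_add2r.
apply: (@leq_trans (d ^ r.+1)); last by rewrite leq_exp2l// ltnS expn_gt0.
by rewrite expnMn expnS ltn_pmul2r ?expn_gt0.
Qed.

Section Counting.
Variables (R : realType) (n : nat) (a : 'I_n -> nat).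
Local Notation C := (CC R).
Local Notation V := 'rV[C]_n.
Local Notation multi := {ffun 'I_n -> nat}.
Hypothesis a_gt1 : forall i, (1 < a i)%N.
Hypothesis a_coprime : forall i j, i != j -> coprime (a i) (a j).
Local Notation curve := (curve R a).
Local Notation weight := (weight a).
Variables (k : nat) (G : 'I_k -> V -> C) (H : V -> C) (sigma : 'I_k -> 'I_n).
Hypotheses (gG : forall j, germ (G j)) (gH : germ H).
Variable amax : nat.
Hypotheses (amax0 : (0 < amax)%N) (a_le : forall i, (a i <= amax)%N).
Hypotheses (H_nz : ~ (\forall x \near (0 : V), H x = 0))
  (det_nz : ~ (\forall x \near (0 : V), \det (wronskian_minor G H sigma x) = 0)).
Variables (f : V -> V) (ev : 'I_n -> C).
Hypothesis f_curve : forall i,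
  (fun s => f (curve s) 0 i / curve s 0 i) @ \oo --> ev i.
Hypothesis f_integral : \forall x \near (0 : V), H x != 0 ->
  forall j, \sum_l f x 0 l * wronskian G H j l x = 0.

Lemma curve_neq0 s i : curve s 0 i != 0.
Proof. by rewrite mxE expf_neq0// invr_eq0 pnatr_eq0 -lt0n ltnW. Qed.

(** Since [f_i / x_i] tends to [ev i], the vector field multiplies the leading
    coefficient by the pairing of [ev] with the leading exponent. *)
Lemma vder_value g m e : has_lead a g m e ->
  (fun s => vder id (fun l => f (curve s) 0 l) g (curve s) * (weight m)%:R ^+ s) @ \oo
     --> (\sum_i ev i * (m i)%:R) * e.
Proof.
move=> [_ Hg]; pose t i s := (f (curve s) 0 i / curve s 0 i) *
  (curve s 0 i * pd i g (curve s) * (weight m)%:R ^+ s).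
have tE i : true -> t i @ \oo --> ev i * ((m i)%:R * e).
  by move=> _; exact: (cvgM (@f_curve i) (Hg i)).
have -> : (\sum_i ev i * (m i)%:R) * e = \sum_i ev i * ((m i)%:R * e).
  by rewrite mulr_suml; apply: eq_bigr => i _; rewrite mulrA.
apply: (eq_cvg_seq _ (cvg_bigsum (s := index_enum 'I_n) tE)) => s.
rewrite /vder mulr_suml; apply: eq_bigr => i _; rewrite /t.
by field; exact: curve_neq0.
Qed.

(** The fraction [u / H ^+ D] is a first integral, that is
    [H * X u = D * u * X H]; the leading coefficients of the two sides are
    computed by [vder_value]. *)
Lemma hpolynomial_resonant mH eH (J : finType) (A : pred J)
    (q : J -> {ffun 'I_k -> nat}) c D m e : (0 < k)%N ->
  (forall j, A j -> mdeg (q j) <= D)%N -> has_lead a H mH eH -> eH != 0 ->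
  has_lead a (hpolynomial G H A q c D) m e -> e != 0 ->
  \sum_i ev i * (m i)%:R = D%:R * \sum_i ev i * (mH i)%:R.
Proof.
move=> k0 qD leadH eH0 leadu e0; pose i0 : 'I_k := Ordinal k0.
set u := hpolynomial _ _ _ _ _ _ in leadu.
have tw : \forall x \near (0 : V), H x != 0 ->
    twisted id H x (fun l => f x 0 l) D u 0.
  have dG : \forall x \near (0 : V), forall j, derivable_at (G j) x.
    exact: (@filter_forall V 'I_k (fun j => [set x | derivable_at (G j) x])
      (nbhs (0 : V)) _ (fun j => germ_derivable (gG j))).
  apply: filterS3 dG (germ_derivable gH) f_integral => x dG dH fx Hx.
  have tG j : twisted id H x (fun l => f x 0 l) 1 (G j) (if j == i0 then 0 else 0).
    split; first exact: dG.
    rewrite -[RHS](_ : \sum_l f x 0 l * wronskian G H j l x = _); last first.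
      by rewrite fx//; case: eqP.
    rewrite /vder !mulr_sumr mul1r -sumrB; apply: eq_bigr => l _.
    by rewrite /wronskian; ring.
  have tq j : A j -> twisted id H x (fun l => f x 0 l) D (hmonomial G H D (q j)) 0.
    move=> Aj; have := twisted_hmonomial dH tG (qD j Aj).
    by rewrite mulr0 mul0r.
  have := twisted_sum (index_enum J) c tq.
  by rewrite [X in twisted _ _ _ _ _ _ X]big1// => j _; rewrite mulr0.
have [vH _] := leadH; have [vu _] := leadu.
pose X g s := vder id (fun l => f (curve s) 0 l) g (curve s).
pose z1 s := H (curve s) * (weight mH)%:R ^+ s * (X u s * (weight m)%:R ^+ s).
pose z2 s := D%:R * (u (curve s) * (weight m)%:R ^+ s) * (X H s * (weight mH)%:R ^+ s).
have L1 : z1 @ \oo --> eH * ((\sum_i ev i * (m i)%:R) * e).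
  exact: (cvgM vH (vder_value leadu)).
have cD : (fun _ : nat => D%:R : C) @ \oo --> (D%:R : C) by exact: cvg_cst.
have L2 : z2 @ \oo --> D%:R * e * ((\sum_i ev i * (mH i)%:R) * eH).
  exact: (cvgM (cvgM cD vu) (vder_value leadH)).
have : eH * ((\sum_i ev i * (m i)%:R) * e) =
    D%:R * e * ((\sum_i ev i * (mH i)%:R) * eH).
  suff E : \forall s \near \oo, z2 s = z1 s.
    have L2' : z1 @ \oo --> D%:R * e * ((\sum_i ev i * (mH i)%:R) * eH).
      exact: cvg_trans (near_eq_cvg E) L2.
    exact: etrans (esym (cvg_lim (@norm_hausdorff _ _) L1))
                  (cvg_lim (@norm_hausdorff _ _) L2').
  apply: filterS2 (near_curve a_gt1 tw) (has_value_neq0 vH eH0) => s /[apply] -[_].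
  move=> /eqP; rewrite subr_eq0 => /eqP E.
  by rewrite /z1 mulrACA /X E /z2 /X; ring.
move=> E; have ee : eH * e != 0 by rewrite mulf_neq0.
apply: (mulIf ee).
by transitivity (eH * ((\sum_i ev i * (m i)%:R) * e)); [ring|rewrite E; ring].
Qed.

Variable W : {vspace 'rV[R]_n}.
Hypothesis W_resonances : forall z : 'I_n -> int,
  \sum_i ev i * (z i)%:~R = 0 -> \row_i (z i)%:~R \in W.

(** The [d ^ k] monomials of degree less than [d] in each fraction span a
    space of numerators whose leading exponents are resonant, hence determined
    by [\dim W] of their entries, and whose entries are at most linear in [d] by
    the zero estimate. If there were fewer such exponents than monomials, some
    nontrivial combination would have vanishing Taylor coefficients at all of
    them, in particular at its own leading exponent. *)
Lemma integrals_le_dim : (k <= \dim W)%N.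
Proof.
have [->//|k0] := posnP k.
have [mH [eH [eH0 leadH]]] := germ_lead a_gt1 a_coprime gH H_nz.
have [beta Hbeta] := zero_estimate a_gt1 a_coprime gG gH amax0 a_le H_nz det_nz.
have [iota iotaP] := vspace_coordinates W.
apply: (@exp_growth (beta * k)%N) => d d0.
pose J := {ffun 'I_k -> 'I_d}; pose D := (k * d)%N; pose N := (beta * k * d)%N.
pose K := {ffun 'I_(\dim W) -> 'I_N.+1}.
have cardJ : #|{: J}| = (d ^ k)%N by rewrite card_ffun !card_ord.
have cardK : #|{: K}| = (N.+1 ^ \dim W)%N by rewrite card_ffun !card_ord.
rewrite -cardJ -cardK leqNgt; apply/negP => KJ.
pose q (j : J) : {ffun 'I_k -> nat} := [ffun i => (j i : nat)].
have qinj : injective q.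
  by move=> j j' /ffunP E; apply/ffunP => i; apply/val_inj; have := E i; rewrite !ffunE.
have qD j : (mdeg (q j) <= D)%N.
  have -> : D = (\sum_(i < k) d)%N by rewrite sum_nat_const card_ord.
  by apply: leq_sum => i _; rewrite ffunE ltnW.
have [tc tcP] := choice (fun j => germ_taylor (germ_hmonomial D (q j) gG gH)).
pose resonant (m : multi) :=
  \sum_i ev i * (m i)%:R = D%:R * \sum_i ev i * (mH i)%:R.
have key_inj m m' : resonant m -> resonant m' ->
    (forall p, m (iota p) = m' (iota p)) -> m = m'.
  move=> rm rm' mm'.
  have /W_resonances/iotaP z0 : \sum_i ev i * ((m i)%:Z - (m' i)%:Z)%:~R = 0.
    have -> : \sum_i ev i * ((m i)%:Z - (m' i)%:Z)%:~R =
        \sum_i ev i * (m i)%:R - \sum_i ev i * (m' i)%:R.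
      by rewrite -sumrB; apply: eq_bigr => i _; rewrite intrB mulrBr.
    by rewrite rm rm' subrr.
  apply/ffunP => i; have /rowP/(_ i) : \row_i ((m i)%:Z - (m' i)%:Z)%:~R = 0 :> 'rV[R]_n.
    by apply: z0 => p; rewrite mxE mm' subrr.
  rewrite !mxE => /eqP; rewrite intr_eq0 subr_eq0 => /eqP; by case.
(* the resonant exponent with prescribed entries [kap]; the default value is
   taken when there is none *)
pose expo (kap : K) : multi := xget [ffun=> 0%N]
  [set m | resonant m /\ forall p, m (iota p) = kap p].
have expoP m (kap : K) : resonant m -> (forall p, m (iota p) = kap p) -> expo kap = m.
  move=> rm mk; have [r1 r2] : resonant (expo kap) /\ forall p, expo kap (iota p) = kap p.
    by apply: (@xgetPex _ _ [set m | resonant m /\ forall p, m (iota p) = kap p]); exists m.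
  by apply: key_inj => // p; rewrite r2 mk.
pose E : 'M[C]_(#|{: J}|, #|{: K}|) :=
  \matrix_(x, y) tc (enum_val x) (expo (enum_val y)).
have kerE : kermx E != 0.
  rewrite kermx_eq0 /row_free; apply/negP => /eqP rk.
  by have := rank_leq_col E; rewrite rk leqNgt KJ.
pose Q := nz_row (kermx E).
have QE : Q *m E = 0 by apply/eqP; rewrite -sub_kermx nz_row_sub.
have Q0 : Q != 0 by rewrite nz_row_eq0.
pose c j := Q 0 (enum_rank j).
pose A j := c j != 0.
have exA : exists j, A j.
  have /rV0Pn[x Qx] := Q0; exists (enum_val x).
  by rewrite /A /c enum_valK.
have [m [e [e0 lead wm]]] := Hbeta D J A q c exA (fun j => id)
  (in2W qinj) (fun j _ => qD j).
have rm : resonant m := hpolynomial_resonant k0 (fun j _ => qD j) leadH eH0 lead e0.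
have mN i : (m i <= N)%N.
  apply: leq_trans (leq_mdeg m i) _.
  rewrite -(leq_exp2l _ _ (ltnSn 1)); apply: leq_trans (expn2_mdeg_weight a_gt1 m) _.
  apply: leq_trans wm _; rewrite /N /D -mulnA [leqRHS]expnM.
  by case: (k * d)%N => // D'; rewrite leq_exp2r// ltnW// ltn_expl.
(* the leading coefficient is a Taylor coefficient at an exponent counted
   by [K], where the linear combination was chosen to vanish *)
have tu : taylor (fun m' => \sum_(j | A j) c j * tc j m') (hpolynomial G H A q c D).
  exact: taylor_sum.
have [v _] := lead.
have [m' cm' [v' _]] := taylor_lead a_gt1 a_coprime tu (has_value_nonzero a_gt1 v e0).
have mm' : m = m'.
  apply: (weight_inj a_gt1 a_coprime); apply/eqP; rewrite eqn_leq.
  rewrite (has_value_weight_le v v' cm').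
  by rewrite (has_value_weight_le v' v e0).
case/eqP: cm'; rewrite -mm'.
pose kap : K := [ffun p => inord (m (iota p))].
have -> : m = expo kap.
  by apply/esym/expoP => // p; rewrite ffunE inordK// ltnS.
transitivity ((Q *m E) 0 (enum_rank kap)); last by rewrite QE mxE.
rewrite [RHS]mxE; rewrite [LHS](_ : _ = \sum_j c j * tc j (expo kap)); last first.
  rewrite [RHS](bigID A)/= [X in _ = _ + X]big1 ?addr0//.
  by move=> j; rewrite /A negbK => /eqP ->; rewrite mul0r.
rewrite (reindex_onto enum_val enum_rank) => [|j _]; last exact: enum_rankK.
apply: eq_big => [x|x _]; first by rewrite enum_valK eqxx.
by rewrite mxE enum_rankK /c enum_valK.
Qed.

End Counting.

(** * Sets of full measure are dense *)

Section Bisection.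
Variables (R : realType) (K : finType).
Implicit Types c d lo hi : K -> R.

Definition overlap lo hi c d (k : K) : R :=
  Num.max 0 (Num.min (hi k) (d k) - Num.max (lo k) (c k)).

Definition overlap_volume lo hi c d : R := \prod_k overlap lo hi c d k.

Definition upd (c : K -> R) k0 e : K -> R := fun k => if k == k0 then e else c k.

Lemma overlap_ge0 lo hi c d k : 0 <= overlap lo hi c d k.
Proof. by rewrite le_max lexx. Qed.

Lemma overlap_volume_ge0 lo hi c d : 0 <= overlap_volume lo hi c d.
Proof. by apply: prodr_ge0 => k _; exact: overlap_ge0. Qed.

Lemma overlap_split (l h c d e : R) : c <= e <= d ->
  Num.max 0 (Num.min h d - Num.max l c) =
  Num.max 0 (Num.min h e - Num.max l c) + Num.max 0 (Num.min h d - Num.max l e).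
Proof.
move=> /andP[ce ed].
case: (leP h d) => ?; case: (leP h e) => ?; case: (leP l c) => ?; case: (leP l e) => ?;
repeat match goal with |- context [Order.max 0 ?x] => case: (leP 0 x) => ? end; lra.
Qed.

Lemma overlap_volume_split lo hi c d k e : c k <= e <= d k ->
  overlap_volume lo hi c d =
  overlap_volume lo hi c (upd d k e) + overlap_volume lo hi (upd c k e) d.
Proof.
move=> /(overlap_split (lo k) (hi k)) ced.
rewrite /overlap_volume [LHS](bigD1 k)//= [X in _ = X + _](bigD1 k)//= [X in _ = _ + X](bigD1 k)//=
  [overlap lo hi c d k]ced mulrDl /overlap /upd eqxx.
by congr (_ * _ + _ * _); apply: eq_bigr => l /negPf ->.
Qed.

Lemma volume_bisect c d k :
  \prod_l (d l - c l) =
  \prod_l (upd d k ((c k + d k) / 2) l - c l) +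
  \prod_l (d l - upd c k ((c k + d k) / 2) l).
Proof.
rewrite [LHS](bigD1 k)//= [X in _ = X + _](bigD1 k)//= [X in _ = _ + X](bigD1 k)//= /upd eqxx.
have -> : \prod_(l | l != k) ((if l == k then (c k + d k) / 2 else d l) - c l) =
   \prod_(l | l != k) (d l - c l) by apply: eq_bigr => l /negPf ->.
have -> : \prod_(l | l != k) (d l - (if l == k then (c k + d k) / 2 else c l)) =
   \prod_(l | l != k) (d l - c l) by apply: eq_bigr => l /negPf ->.
by rewrite -mulrDl; congr (_ * _); field.
Qed.

Variables (lo hi : nat -> K -> R).

Definition undercovered (cd : (K -> R) * (K -> R)) :=
  (forall k, cd.1 k < cd.2 k) /\
  (\sum_(0 <= j <oo) (overlap_volume (lo j) (hi j) cd.1 cd.2)%:E <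
     (\prod_k (cd.2 k - cd.1 k))%:E)%E.

(** Overlap volumes add up over the two halves of the box, so the total
    overlap cannot reach the volume of the half on both sides. *)
Lemma undercovered_bisect cd k0 : undercovered cd -> exists cd',
  [/\ undercovered cd', forall k, cd.1 k <= cd'.1 k, forall k, cd'.2 k <= cd.2 k &
    forall k, cd'.2 k - cd'.1 k = (cd.2 k - cd.1 k) / (if k == k0 then 2 else 1)].
Proof.
move: cd => [c d] [/= cd]; set e := (c k0 + d k0) / 2.
have ce : c k0 < e by have := cd k0; rewrite /e; lra.
have ed : e < d k0 by have := cd k0; rewrite /e; lra.
have ced : c k0 <= e <= d k0 by rewrite !ltW.
rewrite (volume_bisect c d k0) -/e EFinD.
under eq_eseriesr do rewrite (overlap_volume_split _ _ ced) EFinD.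
rewrite nneseriesD; last 2 first.
- by move=> j _; rewrite lee_fin overlap_volume_ge0.
- by move=> j _; rewrite lee_fin overlap_volume_ge0.
move=> H; have [H1|H1] := ltP (\sum_(0 <= j <oo)
    (overlap_volume (lo j) (hi j) c (upd d k0 e))%:E)%E
   (\prod_l (upd d k0 e l - c l))%:E.
  exists (c, upd d k0 e); split=> //=.
  - by split=> //= k; rewrite /upd; case: eqP => [->|].
  - by move=> k; rewrite /upd; case: eqP => [->|//]; exact: ltW.
  - by move=> k; rewrite /upd; case: eqP => [->|_]; rewrite /e; field.
have [H2|H2] := ltP (\sum_(0 <= j <oo)
    (overlap_volume (lo j) (hi j) (upd c k0 e) d)%:E)%E
   (\prod_l (d l - upd c k0 e l))%:E; last first.
  by have := leeD H1 H2; rewrite leNgt H.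
exists (upd c k0 e, d); split=> //=.
- by split=> //= k; rewrite /upd; case: eqP => [->|].
- by move=> k; rewrite /upd; case: eqP => [->|//]; exact: ltW.
- by move=> k; rewrite /upd; case: eqP => [->|_]; rewrite /e; field.
Qed.

Lemma undercovered_halve cd : undercovered cd -> exists cd',
  [/\ undercovered cd', forall k, cd.1 k <= cd'.1 k, forall k, cd'.2 k <= cd.2 k &
    forall k, cd'.2 k - cd'.1 k = (cd.2 k - cd.1 k) / 2].
Proof.
move=> ucd; suff H (s : seq K) : uniq s -> exists cd',
    [/\ undercovered cd', forall k, cd.1 k <= cd'.1 k, forall k, cd'.2 k <= cd.2 k &
    forall k, cd'.2 k - cd'.1 k = (cd.2 k - cd.1 k) / (if k \in s then 2 else 1)].
  have [cd' [? ? ? H']] := H (enum K) (enum_uniq _); exists cd'; split=> // k.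
  by rewrite H' mem_enum.
elim: s => [_|k0 s IH /= /andP[k0s /IH[cd1 [u1 l1 h1 w1]]]].
  by exists cd; split=> // k; rewrite divr1.
have [cd2 [u2 l2 h2 w2]] := undercovered_bisect k0 u1.
exists cd2; split=> // [k|k|k]; first exact: le_trans (l1 k) (l2 k).
  exact: le_trans (h2 k) (h1 k).
rewrite w2 w1 inE; case: eqP => [->|_] /=; last by rewrite divr1.
by rewrite (negPf k0s) divr1.
Qed.

(** Halving repeatedly gives boxes shrinking to a point. An open box of the
    family around this point would contain one of them, and its overlap alone
    would be the whole volume. *)
Lemma undercovered_point cd : undercovered cd -> exists p : K -> R,
  (forall k, cd.1 k <= p k <= cd.2 k) /\
  forall j, ~ (forall k, lo j k < p k < hi j k).
Proof.
move=> ucd.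
have halve (X : (K -> R) * (K -> R)) : exists Y, undercovered X ->
    [/\ undercovered Y, forall k, X.1 k <= Y.1 k, forall k, Y.2 k <= X.2 k &
      forall k, Y.2 k - Y.1 k = (X.2 k - X.1 k) / 2].
  have [/undercovered_halve[Y HY]|nX] := pselect (undercovered X); first by exists Y.
  by exists X.
have [step stepP] := choice halve.
pose X t := iter t step cd.
have uX t : undercovered (X t) by elim: t => //= t /stepP[].
have wX t k : (X t).2 k - (X t).1 k = (cd.2 k - cd.1 k) / 2 ^+ t.
  elim: t => [|t IH]; first by rewrite expr0 divr1.
  have [_ _ _ ->] := stepP _ (uX t).
  by rewrite IH exprS invfM mulrA mulrAC.
have lX t t' k : (t <= t')%N -> (X t).1 k <= (X t').1 k.
  move=> /subnKC <-; elim: (t' - t)%N => [|u IH]; first by rewrite addn0.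
  by rewrite addnS; apply: le_trans IH _; have [_ H _ _] := stepP _ (uX (t + u)%N).
have hX t t' k : (t <= t')%N -> (X t').2 k <= (X t).2 k.
  move=> /subnKC <-; elim: (t' - t)%N => [|u IH]; first by rewrite addn0.
  by rewrite addnS; apply: le_trans IH; have [_ _ H _] := stepP _ (uX (t + u)%N).
have lh t t' k : (X t).1 k <= (X t').2 k.
  have [/(lX _ _ k) H|/ltnW/(hX _ _ k) H] := leqP t t'.
    by apply: le_trans H _; apply: ltW; have [] := uX t'.
  by apply: le_trans H; apply: ltW; have [] := uX t.
pose p k := sup [set (X t).1 k | t in [set: nat]].
have supX k : has_sup [set (X t).1 k | t in [set: nat]].
  split; first by exists ((X 0%N).1 k); exists 0%N.
  by exists ((X 0%N).2 k) => _ [t _ <-]; exact: lh.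
have pl t k : (X t).1 k <= p k by apply: sup_upper_bound => //; exists t.
have ph t k : p k <= (X t).2 k.
  by apply: ge_sup; [case: (supX k)|move=> _ [t' _ <-]; exact: lh].
exists p; split=> [k|j Hj].
  by have := pl 0%N k; have := ph 0%N k => /= -> ->.
(* a box around the limit point contains a box of the sequence *)
have [t Ht] : exists t, forall k, (cd.2 k - cd.1 k) / 2 ^+ t < p k - lo j k /\
    (cd.2 k - cd.1 k) / 2 ^+ t < hi j k - p k.
  have small (B e : R) : 0 < e -> \forall t \near \oo, B / 2 ^+ t < e.
    move=> e0; have /cvgr0Pnorm_lt/(_ _ e0) := halfX_cvg B.
    by apply: filterS => t; apply: le_lt_trans; exact: ler_norm.
  have : \forall t \near \oo, forall k, (cd.2 k - cd.1 k) / 2 ^+ t < p k - lo j k /\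
      (cd.2 k - cd.1 k) / 2 ^+ t < hi j k - p k.
    apply: (@filter_forall nat K (fun k => [set t |
      (cd.2 k - cd.1 k) / 2 ^+ t < p k - lo j k /\
      (cd.2 k - cd.1 k) / 2 ^+ t < hi j k - p k]) \oo _) => k.
    have /andP[H1 H2] := Hj k.
    by apply: filterI; apply: small; rewrite subr_gt0.
  by move=> [t _ H]; exists t => k; exact: (H t (leqnn t) k).
have [_] := uX t; rewrite ltNge => /negP; apply.
have -> : \prod_k ((X t).2 k - (X t).1 k) =
    overlap_volume (lo j) (hi j) (X t).1 (X t).2.
  apply: eq_bigr => k _; have [H1 H2] := Ht k; rewrite /overlap.
  have := wX t k; have := pl t k; have := ph t k; move: (_ / 2 ^+ t) H1 H2 => w.
  case: (leP (hi j k) _) => ?; case: (leP (lo j k) _) => ?; try lra.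
  by case: (leP 0 _) => ?; lra.
rewrite (nneseriesD1 (n := j))//; last by move=> i _; rewrite lee_fin overlap_volume_ge0.
by rewrite leeDl// nneseries_ge0// => i _ _; rewrite lee_fin overlap_volume_ge0.
Qed.

End Bisection.

Section FullMeasure.
Variables (R : realType) (n : nat).
Local Notation C := (CC R).
Local Notation V := 'rV[C]_n.

Definition real_coord (z : V) (k : 'I_n * bool) : R :=
  if k.2 then complex.Im (z 0 k.1) else complex.Re (z 0 k.1).

Lemma box_volumeE (a b : V) : box_volume a b =
  \prod_k Num.max 0 (real_coord b k - real_coord a k).
Proof.
rewrite /box_volume.
transitivity (\prod_i \prod_(e : bool) Num.max 0 (real_coord b (i, e) - real_coord a (i, e))).
  by apply: eq_bigr => i _; rewrite big_bool mulrC.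
by rewrite pair_big; apply: eq_bigr => -[].
Qed.

(** An open set missing [A] contains a closed box, which the open boxes of a
    cover of [U `\` A] of smaller total volume cannot cover. *)
Lemma full_measure_dense (A U O : set V) : full_measure_subset A U ->
  open O -> O `<=` U -> O !=set0 -> A `&` O !=set0.
Proof.
move=> [_ null] oO OU [x Ox].
apply: contrapT => AO.
have {}AO : O `<=` U `\` A.
  by move=> y Oy; split; [exact: OU|move=> Ay; apply: AO; exists y].
have /nbhs_rVP[e e0 He] : nbhs x O by exact: open_nbhs_nbhs.
pose c k := real_coord x k - e / 4; pose d k := real_coord x k + e / 4.
have cd k : c k < d k by rewrite /c /d; lra.
have v0 : (0 < (\prod_k (d k - c k))%:E)%E.
  by rewrite lte_fin prodr_gt0// => k _; rewrite subr_gt0.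
move: v0; rewrite -null => /ereal_inf_lt[_ [a [b [cov ->]]] small].
pose lo j := real_coord (a j); pose hi j := real_coord (b j).
have uc : undercovered lo hi (c, d).
  split=> //=; apply: le_lt_trans small.
  apply: lee_nneseries => j _; first by rewrite lee_fin overlap_volume_ge0.
  rewrite lee_fin box_volumeE; apply: ler_prod => k _.
  rewrite overlap_ge0 /overlap ge_max le_max lexx /= le_max.
  apply/orP; right; rewrite lerB// ?ge_min ?le_max ?lexx ?orbT//.
have [p [pB pj]] := undercovered_point uc.
pose y : V := \row_i (Complex (p (i, false)) (p (i, true)) : C).
have yp k : real_coord y k = p k by case: k => i []; rewrite /real_coord mxE.
have Oy : O y.
  apply: He => i; apply: le_lt_trans (nrm_le_ReIm _) _.
  have H1 := pB (i, false); have H2 := pB (i, true).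
  have -> : complex.Re (y 0 i - x 0 i) = p (i, false) - real_coord x (i, false).
    by rewrite -yp /real_coord /=; case: (y 0 i) (x 0 i) => ? ? [].
  have -> : complex.Im (y 0 i - x 0 i) = p (i, true) - real_coord x (i, true).
    by rewrite -yp /real_coord /=; case: (y 0 i) (x 0 i) => ? ? [].
  have : `|p (i, false) - real_coord x (i, false)| <= e / 4.
    by rewrite ler_norml; move: H1; rewrite /c /d /= => /andP[? ?]; apply/andP; split; lra.
  have : `|p (i, true) - real_coord x (i, true)| <= e / 4.
    by rewrite ler_norml; move: H2; rewrite /c /d /= => /andP[? ?]; apply/andP; split; lra.
  by lra.
have [j _ yj] := cov _ (AO _ Oy); apply: (pj j) => -[i []].
- by have [_] := yj i; rewrite -yp.
- by have [+ _] := yj i; rewrite -yp.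
Qed.

End FullMeasure.

(** * Multiplicatively independent scales, and triangularization *)

Section Scales.

(** The moduli of Gödel's beta function are pairwise coprime; they also lie
    within a factor [n] of each other, and are larger than [n], so that each is
    less than the square of any other. *)
Definition scale n (i : 'I_n) : nat := (1 + i.+1 * n.+1`!)%N.

Lemma scale_gt1 n (i : 'I_n) : (1 < scale i)%N.
Proof. by rewrite /scale add1n ltnS muln_gt0 fact_gt0. Qed.

Lemma scale_lt n (i j : 'I_n) : (i < j)%N -> (scale i < scale j)%N.
Proof. by move=> ij; rewrite /scale !add1n ltnS ltn_pmul2r ?fact_gt0. Qed.

Lemma scale_le n (i : 'I_n) : (scale i <= 1 + n * n.+1`!)%N.
Proof. by rewrite /scale leq_add2l leq_mul2r ltn_ord orbT. Qed.

Lemma scale_lt_sqr n (i j : 'I_n) : (scale j < scale i ^ 2)%N.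
Proof.
apply: leq_ltn_trans (scale_le j) _.
have Hn : (n <= n.+1`!)%N by rewrite factS mulSn; apply: leq_trans (leq_addl _ _); rewrite leq_pmulr ?fact_gt0.
have H : (1 + n.+1`! <= scale i)%N by rewrite /scale leq_add2l leq_pmull.
apply: leq_trans (_ : (1 + n.+1`!) ^ 2 <= _)%N; last by rewrite leq_exp2r.
have := fact_gt0 n.+1; move: Hn; move: (n.+1`!)%N => B; nia.
Qed.

(** A common prime factor divides [(j - i) * n.+1`!]; it is a factor of the
    factorial in any case, hence of 1. *)
Lemma scale_coprime n (i j : 'I_n) : i != j -> coprime (scale i) (scale j).
Proof.
wlog ij : i j / (i < j)%N.
  move=> W ne; have [|/W|/val_inj E] := ltngtP i j; first by move=> /W; exact.
    by rewrite coprime_sym eq_sym; exact.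
  by rewrite E eqxx in ne.
move=> _; rewrite /coprime -dvdn1; apply/negPn/negP => g1.
have g_gt1 : (1 < gcdn (scale i) (scale j))%N.
  by rewrite ltn_neqAle gcdn_gt0 /scale add1n ltnS andbT eq_sym -dvdn1.
pose p := pdiv (gcdn (scale i) (scale j)).
have p_pr : prime p by exact: pdiv_prime.
have /andP[pi pj] : ((p %| scale i) && (p %| scale j))%N.
  by rewrite -dvdn_gcd pdiv_dvd.
have pB : (p %| n.+1`!)%N.
  have : (p %| (j - i) * n.+1`!)%N.
    have E : (scale j = scale i + (j - i) * n.+1`!)%N.
      by rewrite /scale -addnA -mulnDl; congr (1 + _ * _)%N; lia.
    by rewrite E dvdn_addr in pj.
  rewrite Euclid_dvdM// => /orP[pji|//].
  apply: dvdn_fact; rewrite prime_gt0//=.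
  apply: leq_trans (dvdn_leq _ pji) _; first by rewrite subn_gt0.
  by apply: leq_trans (leq_subr _ _) _; rewrite ltnW// ltnW// ltnS.
move: pi; rewrite /scale (dvdn_addl 1%N (dvdn_mull i.+1 pB)) dvdn1 => /eqP p1.
by rewrite p1 in p_pr.
Qed.

End Scales.

Lemma char_poly_conj (F : fieldType) n (P A : 'M[F]_n) : P \in unitmx ->
  char_poly (P *m A *m invmx P) = char_poly A.
Proof.
move=> uP; rewrite /char_poly /char_poly_mx.
pose f := @polyC F; pose Q := map_mx f P; pose Q' := map_mx f (invmx P).
have QQ' : Q *m Q' = 1%:M by rewrite -map_mxM mulmxV// map_mx1.
have -> : 'X%:M - map_mx f (P *m A *m invmx P) = Q *m ('X%:M - map_mx f A) *m Q'.
  by rewrite !map_mxM mulmxBr mulmxBl scalar_mxC -[_%:M *m Q *m Q']mulmxA QQ' mulmx1.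
by rewrite !det_mulmx mulrAC -det_mulmx QQ' det1 mul1r.
Qed.

Lemma prod_XsubC_perm_eq (F : idomainType) (s t : seq F) :
  \prod_(x <- s) ('X - x%:P) = \prod_(x <- t) ('X - x%:P) -> perm_eq s t.
Proof.
elim: s t => [|x s IH] t.
  move=> E; have := congr1 (fun p : {poly F} => size p) E.
  by rewrite big_nil size_poly1 size_prod_XsubC => -[/esym/size0nil ->].
move=> E; have xt : x \in t.
  by rewrite -root_prod_XsubC -E root_prod_XsubC mem_head.
rewrite perm_sym; apply: perm_trans (perm_to_rem xt) _.
rewrite perm_cons perm_sym; apply: IH.
move: E; rewrite (perm_big _ (perm_to_rem xt)) !big_cons.
by apply: mulfI; rewrite polyXsubC_eq0.
Qed.

(** Schur's theorem provides the triangular form, and the characteristic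
    polynomial, which conjugation preserves, identifies its diagonal up to a
    permutation. *)
Lemma triangularize (C : numClosedFieldType) n (A : 'M[C]_n) (lambda : 'rV[C]_n) :
  (0 < n)%N -> char_poly A = \prod_(i < n) ('X - (lambda 0 i)%:P) ->
  exists (P : 'M[C]_n) (pi : 'S_n), [/\ P \in unitmx,
    forall i j : 'I_n, (i < j)%N -> (P *m A *m invmx P) i j = 0 &
    forall i, (P *m A *m invmx P) i i = lambda 0 (pi i)].
Proof.
move=> n0 Alambda; have [P Pu PA] := Schur A n0.
have uP := unitarymx_unit Pu; exists P.
move: PA; rewrite /similar_to conjumx// => T_trig.
set T := _ *m _ *m _ in T_trig *.
have : perm_eq [tuple T i i | i < n] [tuple lambda 0 i | i < n].
  apply: prod_XsubC_perm_eq; rewrite !big_map -!enumT !big_enum /=.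
  by rewrite -(char_poly_trig T_trig) char_poly_conj.
move=> /tuple_permP[pi piE]; exists pi; split=> //.
  by move=> i j ij; exact: (is_trig_mxP T_trig).
move=> i.
have : tnth [tuple T i i | i < n] i =
    tnth [tuple tnth [tuple lambda 0 i | i < n] (pi i) | i < n] i.
  by congr tnth; exact: val_inj.
by rewrite !tnth_mktuple.
Qed.

(** * Linear changes of coordinates and the linear part *)

Section LinearChange.
Variables (R : realType) (n : nat).
Local Notation C := (CC R).
Local Notation V := 'rV[C]_n.
Local Notation polydisc := (@polydisc R n).

Lemma near_subst (P : 'M[C]_n) (Q : set V) :
  (\forall x \near (0 : V), Q x) -> \forall y \near (0 : V), Q (y *m P).
Proof.
move=> /nbhs_rVP[e e0 H]; apply/nbhs_rVP.
pose L := 1 + \sum_i \sum_j nrm (P i j).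
have S0 : 0 <= \sum_i \sum_j nrm (P i j).
  by do 2![apply: sumr_ge0 => ? _]; exact: nrm_ge0.
have L0 : 0 < L by rewrite ltr_pwDl.
exists (e / L); first by rewrite divr_gt0.
move=> y Hy; apply: H => i; rewrite [X in _ - X]mxE subr0 mxE.
apply: le_lt_trans (nrm_sum _ _ _) _.
apply: (@le_lt_trans _ _ ((e / L) * \sum_j nrm (P j i))).
  rewrite mulr_sumr; apply: ler_sum => j _; rewrite nrmM ler_wpM2r ?nrm_ge0//.
  by have := Hy j; rewrite mxE subr0 => /ltW.
rewrite -[ltRHS](divfK (lt0r_neq0 L0)) ltr_pM2l ?divr_gt0//.
apply: (@le_lt_trans _ _ (\sum_i \sum_j nrm (P i j))); last by rewrite /L ltrDr.
apply: ler_sum => j _; rewrite (bigD1 i)//= lerDl.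
by apply: sumr_ge0 => ? _; exact: nrm_ge0.
Qed.

Lemma pd_subst (P : 'M[C]_n) g (y : V) a i : has_grad g (y *m P) a ->
  pd i (fun y => g (y *m P)) y = \sum_l P i l * a l.
Proof.
move=> ga; have [_ H] := has_grad_derive (row i P) ga.
rewrite -[RHS](_ : 'D_(row i P) g (y *m P) = _); last first.
  by rewrite H; apply: eq_bigr => l _; rewrite mxE.
rewrite pdE /derive.
have -> : (fun h : C => h^-1 *: (((fun y => g (y *m P)) \o shift y)
    (h *: delta_mx 0 i) - g (y *m P))) =
  (fun h : C => h^-1 *: ((g \o shift (y *m P)) (h *: row i P) - g (y *m P))).
  by apply/funext => h /=; rewrite mulmxDl -scalemxAl -rowE.
by [].
Qed.

Lemma le_nrm_norm (x : V) i : nrm (x 0 i) <= nrm `|x|.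
Proof.
apply/ler_addgt0Pr => e e0.
have : ball (0 : V) (`|x| + ofR e) x.
  by rewrite mx_norm_ball /ball_ /= sub0r normrN ltrDl -ofR0 lt_ofR.
move=> [_ /(_ 0 i)]; rewrite /ball /= mxE sub0r normrN nrmE.
have -> : `|x| = ofR (nrm `|x|) by rewrite -nrmE normr_id.
by rewrite -ofRD lt_ofR nrm_ofR ger0_norm ?nrm_ge0// => /ltW.
Qed.

Lemma norm_attained (x : V) : nrm `|x| = 0 \/ exists i, nrm `|x| = nrm (x 0 i).
Proof.
have [->|x0] := eqVneq `|x| 0; first by left; rewrite nrm0.
right; have [[i j] /= xE] := mx_norm_neq0 x0.
exists j; have -> : `|x| = `|x 0 j| :> C by rewrite -[LHS]/(mx_norm x) xE ord1.
by apply: (@ofR_inj R); rewrite -nrmE normr_id nrmE.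
Qed.

(** The quadratic remainders of the components show that [f] is
    differentiable, without which ['d f 0] would carry no information. *)
Lemma jacobian_pd (f : V -> V) : (forall i, germ (fun x => f x 0 i)) -> f 0 = 0 ->
  'J f 0 = \matrix_(l, i) pd l (fun x => f x 0 i) 0.
Proof.
move=> gf f0; pose J : 'M[C]_n := \matrix_(l, i) pd l (fun x => f x 0 i) 0.
suff dJ : 'd f 0 = mulmxr J :> (V -> V).
  by apply/row_matrixP => l; rewrite !rowE /jacobian mul_rV_lin1 dJ.
apply: diff_unique.
  move=> x N /nbhs_rVP[e e0 HN].
  have : \forall h \near (0 : V), forall i, nrm ((h *m J) 0 i) < e.
    apply: (near_subst J (Q := [set h | forall i, nrm (h 0 i) < e])).
    by apply/nbhs_rVP; exists e => // h Hh i; have := Hh i; rewrite mxE subr0.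
  move=> /nbhs_rVP[d d0 Hd]; apply/nbhs_rVP; exists d => // y Hy; apply: HN => i.
  have := Hd (y - x) _ i; rewrite mulmxBl !mxE; apply => k.
  by rewrite !mxE subr0; exact: Hy.
apply/eqaddoP => _ /gt0_ofR[e e0 ->].
have : \forall h \near (0 : V), forall i, nrm (f h 0 i - (h *m J) 0 i) <= e * nrm `|h|.
  apply: (@filter_forall V 'I_n
    (fun i => [set h | nrm (f h 0 i - (h *m J) 0 i) <= e * nrm `|h|]) (nbhs (0 : V)) _) => i.
  have [s [B [s0 H]]] := nbhs_singleton (germ_has_grad (gf i)).
  have B0 : 0 <= B.
    have := H 1 0; rewrite ler01 lexx expr1n mulr1 => H1.
    apply: le_trans (H1 _ _) => //; first exact: nrm_ge0.
    by move=> k; rewrite mxE nrm0 mul1r ltW.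
  have d0 : 0 < e * s ^+ 2 / (B + 1).
    by rewrite divr_gt0 ?mulr_gt0 ?exprn_gt0// ltr_pwDr.
  apply/nbhs_rVP; exists (Num.min s (e * s ^+ 2 / (B + 1))).
    by rewrite lt_min s0 d0.
  move=> h Hh /=; set rho := nrm `|h|.
  have r0 : 0 <= rho by exact: nrm_ge0.
  have [rs rd] : rho <= s /\ rho <= e * s ^+ 2 / (B + 1).
    rewrite /rho; have [->|[k ->]] := norm_attained h; first by rewrite !ltW.
    by have := Hh k; rewrite [X in _ - X]mxE subr0 lt_min => /andP[/ltW ? /ltW ?].
  have := H (rho / s) h; rewrite divr_ge0 ?(ltW s0)//= ler_pdivrMr// mul1r rs.
  rewrite divfK ?gt_eqF// add0r f0 [X in _ - X - _]mxE subr0 => /(_ isT (le_nrm_norm h)).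
  have -> : \sum_k h 0 k * pd k (fun x => f x 0 i) 0 = (h *m J) 0 i.
    by rewrite mxE; apply: eq_bigr => k _; rewrite mxE.
  move=> /le_trans; apply.
  have -> : B * (rho / s) ^+ 2 = B * rho / s ^+ 2 * rho by field; rewrite gt_eqF.
  rewrite ler_wpM2r// ler_pdivrMr ?exprn_gt0//.
  move: rd; rewrite ler_pdivlMr ?ltr_pwDr// => rd; apply: le_trans rd.
  by rewrite mulrC ler_wpM2l// lerDl.
apply: filterS => h Hh.
have -> : (f \o shift 0 - (cst (f 0) + mulmxr J)) h = f h - h *m J.
  by rewrite /= !fctE /= f0 addr0 add0r.
set z := f h - h *m J.
have -> : `|z| = ofR (nrm `|z|) by rewrite -nrmE normr_id.
have -> : `|h| = ofR (nrm `|h|) by rewrite -nrmE normr_id.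
rewrite -ofRM le_ofR; have [->|[i ->]] := norm_attained z.
  by rewrite mulr_ge0 ?nrm_ge0 ?ltW.
by rewrite !mxE; have := Hh i; rewrite !mxE.
Qed.

(** Along the curve, [x_j / x_i] tends to 0 for [j > i] because the scales
    increase, the derivatives with [j < i] vanish by triangularity, and the
    quadratic remainder is negligible before [x_i] because
    [a i < a i0 ^ 2]. *)
Lemma germ_curve_triangular (a : 'I_n -> nat) (i0 i : 'I_n) (g : V -> C) :
  (forall j, 1 < a j)%N -> (forall j, a i0 <= a j)%N -> (a i < a i0 ^ 2)%N ->
  (forall j : 'I_n, (i < j)%N -> (a i < a j)%N) ->
  germ g -> g 0 = 0 -> (forall j : 'I_n, (j < i)%N -> pd j g 0 = 0) ->
  (fun s => g (curve R a s) / curve R a s 0 i) @ \oo --> pd i g 0.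
Proof.
move=> a1 a0 ai0 aij gg g0 pd0.
have [s0 [B [s00 H]]] := nbhs_singleton (germ_has_grad gg).
have pj (j : 'I_n) : (a j)%:R != 0 :> C by rewrite pnatr_eq0 -lt0n ltnW.
pose t j (s : nat) : C := pd j g 0 * ((a j)%:R^-1 * (a i)%:R) ^+ s.
pose r s := (g (curve R a s) - \sum_j curve R a s 0 j * pd j g 0) * (a i)%:R ^+ s.
have -> : (fun s => g (curve R a s) / curve R a s 0 i) = (fun s => \sum_j t j s + r s).
  apply/funext => s; rewrite /r mulrBl mxE exprVn invrK.
  have -> : \sum_j t j s = (\sum_j curve R a s 0 j * pd j g 0) * (a i)%:R ^+ s.
    rewrite mulr_suml; apply: eq_bigr => j _; rewrite /t mxE exprMn; ring.
  by rewrite addrC subrK.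
have tE j : true -> t j @ \oo --> (if j == i then pd i g 0 else 0).
  move=> _; case: eqP => [->|/eqP ji].
    rewrite /t mulVf//; apply: (@eq_cvg_seq _ (fun=> pd i g 0)); last exact: cvg_cst.
    by move=> s; rewrite expr1n mulr1.
  have [ij|ji'|/val_inj E] := ltngtP i j; last by rewrite E eqxx in ji.
    have cc : (fun _ : nat => pd j g 0) @ \oo --> pd j g 0 by exact: cvg_cst.
    have tj : t j @ \oo --> pd j g 0 * 0.
      exact: (eq_cvg_seq _ (cvgM cc (@cvg_ratio R _ _ (aij j ij)))).
    by rewrite mulr0 in tj.
  apply: (@eq_cvg_seq _ (fun=> 0)); last exact: cvg_cst.
  by move=> s; rewrite /t pd0// mul0r.
have rE : r @ \oo --> (0 : C).
  pose mu := a i0; have mu1 : (1 < mu)%N by exact: a1.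
  have m0 : (0 : R) < mu%:R by rewrite ltr0n ltnW.
  have : (fun s => B / s0 ^+ 2 * ((mu ^ 2)%:R^-1 * (a i)%:R) ^+ s) @ \oo --> (0 : R).
    rewrite -(mulr0 (B / s0 ^+ 2)); apply: cvgM (@cvg_ratioR R _ _ ai0); exact: cvg_cst.
  move=> /cvgr0Pnorm_lt H1; have := @cvg_ratioR R _ _ mu1.
  move=> /cvgr0Pnorm_lt /(_ _ s00) H2; apply/nrm_cvgP => e e0.
  apply: filterS2 H2 (H1 e e0) => s; rewrite mulr1 ger0_norm ?exprn_ge0 ?invr_ge0 ?ltW//.
  move=> /ltW mus; apply: le_lt_trans; rewrite subr0; apply: le_trans (ler_norm _).
  rewrite /r nrmM nrmX nrm_nat [(_ * (a i)%:R) ^+ s]exprMn mulrA ler_wpM2r ?exprn_ge0//.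
  have := H (mu%:R^-1 ^+ s / s0) (curve R a s).
  rewrite divr_ge0 ?exprn_ge0 ?invr_ge0 ?(ltW m0) ?(ltW s00)//= ler_pdivrMr// mul1r mus.
  rewrite divfK ?gt_eqF// add0r g0 subr0 => /(_ isT) /(_ _)/le_trans; apply.
    move=> j; rewrite mxE nrmX nrmV nrm_nat lerXn2r ?nnegrE ?invr_ge0 ?(ltW m0)//.
    by rewrite lef_pV2 ?posrE ?ltr0n ?ler_nat// ltnW.
  rewrite expr_div_n natrX -[(_ ^+ 2)^-1]exprVn -!exprM mulnC mulrA mulrAC.
  exact: lexx.
have -> : pd i g 0 = \sum_j (if j == i then pd i g 0 else 0) + 0.
  by rewrite addr0 -big_mkcond big_pred1_eq.
exact: (cvgD (cvg_bigsum (s := index_enum 'I_n) tE) rE).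
Qed.

End LinearChange.

(** * First integrals with a common denominator *)

Section CommonDenominator.
Variables (R : realType) (n : nat).
Local Notation C := (CC R).
Local Notation V := 'rV[C]_n.

Lemma germ_prod_nonzero (I : Type) (s : seq I) (g : I -> V -> C) :
  (forall i, germ (g i)) -> (forall i, ~ (\forall x \near (0 : V), g i x = 0)) ->
  ~ (\forall x \near (0 : V), \prod_(i <- s) g i x = 0).
Proof.
move=> gg gnz; elim: s => [/nbhs_singleton|i s IH].
  by rewrite big_nil => /eqP; rewrite oner_eq0.
have := germM_nonzero (@scale_gt1 n) (@scale_coprime n) (gg i)
  (germ_prod s (P := xpredT) (fun j _ => gg j)) (gnz i) IH.
by apply: contra_not; apply: filterS => x; rewrite big_cons.
Qed.

Lemma has_grad_near_neq0 (g : V -> C) (x : V) a : has_grad g x a -> g x != 0 ->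
  \forall y \near x, g y != 0.
Proof.
move=> [s [B [s0 H]]] gx0; have ng : 0 < nrm (g x) by rewrite nrm_gt0.
pose S := \sum_i nrm (a i).
have S0 : 0 <= S by apply: sumr_ge0 => ? _; exact: nrm_ge0.
pose D := `|B| + s * S + 1.
have D0 : 0 < D by rewrite ltr_pwDr// addr_ge0// mulr_ge0// ltW.
pose tau := Num.min 1 (nrm (g x) / (2 * D)).
have t0 : 0 < tau by rewrite lt_min ltr01 divr_gt0// mulr_gt0.
have t1 : tau <= 1 by rewrite ge_min lexx.
apply/nbhs_rVP; exists (tau * s); first by rewrite mulr_gt0.
move=> y Hy; apply/eqP => gy.
have hp : polydisc (tau * s) (y - x) by move=> i; have := Hy i; rewrite !mxE => /ltW.
have := H tau (y - x); rewrite (ltW t0) t1 subrKC gy sub0r => /(_ isT hp) H1.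
have : nrm (g x) <= tau * D.
  have -> : g x = - (- g x - \sum_i (y - x) 0 i * a i) - \sum_i (y - x) 0 i * a i by ring.
  apply: (le_trans (nrmB _ _)); rewrite nrmN.
  have H2 : nrm (\sum_i (y - x) 0 i * a i) <= tau * s * S.
    apply: (le_trans (nrm_sum _ _ _)); rewrite mulr_sumr; apply: ler_sum => i _.
    by rewrite nrmM ler_wpM2r ?nrm_ge0//; exact: hp.
  apply: le_trans (lerD H1 H2) _.
  have -> : tau * D = tau * `|B| + (tau * s * S + tau) by rewrite /D; ring.
  apply: lerD; last by rewrite lerDl ltW.
  rewrite expr2 mulrCA; apply: ler_wpM2l; first exact: ltW.
  apply: le_trans (ler_wpM2r (ltW t0) (ler_norm B)) _.
  by rewrite ler_piMr.
rewrite leNgt => /negP; apply.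
apply: (@le_lt_trans _ _ (nrm (g x) / (2 * D) * D)).
  by rewrite ler_wpM2r ?(ltW D0)// ge_min lexx orbT.
have -> : nrm (g x) / (2 * D) * D = nrm (g x) / 2 by field; rewrite gt_eqF.
by rewrite ltr_pdivrMr// ltr_pMr// ltr1n.
Qed.

Lemma wronskian_quotient k (G : 'I_k -> V -> C) (H F : V -> C) j l (x : V) :
  derivable_at (G j) x -> derivable_at H x ->
  (\forall y \near x, G j y = F y * H y) ->
  (\forall y \near x, F y = G j y / H y) -> H x != 0 ->
  wronskian G H j l x = H x ^+ 2 * pd l F x.
Proof.
move=> dG dH GF FG Hx.
have dF : derivable_at F x.
  move=> v; apply: (near_eq_derivable (f := fun y => G j y / H y)).
    by apply: filterS FG => y ->.
  by apply: derivableM; [exact: dG|apply: derivableV => //; exact: dH].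
have -> : wronskian G H j l x = H x * pd l (G j) x - G j x * pd l H x by [].
rewrite (pd_near l GF) (pdM l dF dH) (nbhs_singleton GF); ring.
Qed.

Variables (U : set V) (U_open : open U) (U0 : U 0) (f : V -> V).
Variables (k : nat) (F : 'I_k -> V -> C).
Hypothesis F_integral : forall j, generalized_rational_first_integral U f (F j).
Hypothesis F_indep : functionally_independent U F.

(** Independence holds on a set of full measure, hence dense; it therefore
    meets the open set of points arbitrarily close to 0 where the common
    denominator does not vanish, and there the gradients of the fractions
    are those of the [F j]. *)
Lemma common_denominator : exists (G : 'I_k -> V -> C) (H : V -> C),
  [/\ forall j, germ (G j), germ H, ~ (\forall x \near (0 : V), H x = 0),
    \forall x \near (0 : V), H x != 0 ->
      forall j, \sum_l f x 0 l * wronskian G H j l x = 0 &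
    forall N : set V, nbhs (0 : V) N ->
      exists2 x, N x & row_free (\matrix_(j, l) wronskian G H j l x)].
Proof.
have quot j : exists GH : (V -> C) * (V -> C),
    [/\ analytic_on U GH.1, analytic_on U GH.2,
      ~ (\forall x \near (0 : V), GH.2 x = 0),
      forall x, U x -> GH.2 x != 0 -> F j x = GH.1 x / GH.2 x &
      forall x, U x -> GH.2 x != 0 -> pairing (f x) (gradient (F j) x) = 0].
  by have [G [H HGH]] := F_integral j; exists (G, H).
have [GH GHP] := choice quot.
pose D j := (GH j).2; pose E j (x : V) := \prod_(i | i != j) D i x.
pose G j (x : V) := (GH j).1 x * E j x; pose H (x : V) := \prod_j D j x.
have gN j : germ (GH j).1 by have [+ _ _ _ _] := GHP j => /(_ 0 U0)/analytic_at_germ.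
have gD j : germ (D j) by have [_ + _ _ _] := GHP j => /(_ 0 U0)/analytic_at_germ.
have gE j : germ (E j) by apply: germ_prod => i _; exact: gD.
have gG j : germ (G j) by exact: germM (gN j) (gE j).
have gH : germ H by apply: germ_prod => i _; exact: gD.
have H_nz : ~ (\forall x \near (0 : V), H x = 0).
  by apply: germ_prod_nonzero => // j; have [_ _ + _ _] := GHP j.
have HDE j x : H x = D j x * E j x by rewrite /H (bigD1 j).
(* the points where everything below can be differentiated *)
pose good x := [/\ U x, derivable_at H x, forall j, derivable_at (G j) x &
  forall j, has_grad (D j) x (fun i => pd i (D j) x)].
have near_good : \forall x \near (0 : V), good x.
  have n1 : \forall x \near (0 : V), U x by exact: open_nbhs_nbhs.
  have n2 : \forall x \near (0 : V), forall j, derivable_at (G j) x.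
    exact: (@filter_forall V 'I_k (fun j => [set x | derivable_at (G j) x])
      (nbhs (0 : V)) _ (fun j => germ_derivable (gG j))).
  have n3 : \forall x \near (0 : V), forall j, has_grad (D j) x (fun i => pd i (D j) x).
    exact: (@filter_forall V 'I_k (fun j => [set x | has_grad (D j) x (fun i => pd i (D j) x)])
      (nbhs (0 : V)) _ (fun j => germ_has_grad (gD j))).
  by apply: filterS2 (filterI n1 n2) (filterI n3 (germ_derivable gH)) => x [? ?] [? ?].
have D_neq0 j x : H x != 0 -> D j x != 0.
  by apply: contraNneq => Dj; rewrite (HDE j) Dj mul0r.
have wE x j l : good x -> H x != 0 -> wronskian G H j l x = H x ^+ 2 * pd l (F j) x.
  move=> [Ux dH dG dD] Hx.
  have Hnear : \forall y \near x, U y /\ forall j, D j y != 0.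
    apply: filterI; first exact: open_nbhs_nbhs.
    apply: (@filter_forall V 'I_k (fun j => [set y | D j y != 0]) (nbhs x) _) => i.
    by apply: has_grad_near_neq0 (dD i) _; exact: D_neq0.
  have FE : \forall y \near x, F j y = (GH j).1 y / D j y /\ H y != 0.
    apply: filterS Hnear => y [Uy Dy]; have [_ _ _ FjE _] := GHP j.
    by split; [exact: (FjE y Uy (Dy j))|apply/prodf_neq0 => i _; exact: Dy].
  have GF : \forall y \near x, G j y = F j y * H y.
    apply: filterS FE => y [-> Hy]; rewrite /G (HDE j) mulrA divfK//.
    exact: D_neq0.
  have FG : \forall y \near x, F j y = G j y / H y.
    apply: filterS FE => y [-> Hy]; rewrite /G (HDE j).
    by move: Hy; rewrite (HDE j) mulf_eq0 negb_or => /andP[? ?]; field; apply/andP.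
  exact: (wronskian_quotient l (dG j) dH GF FG Hx).
exists G, H; split=> //.
  apply: filterS near_good => x gx Hx j.
  under eq_bigr do rewrite wE// mulrCA.
  rewrite -mulr_sumr; have [_ _ _ _ /(_ x)] := GHP j.
  case: (gx) => Ux _ _ _ => /(_ Ux (D_neq0 j x Hx)); rewrite /pairing => pE.
  rewrite (eq_bigr (fun l => f x 0 l * gradient (F j) x 0 l)) ?pE ?mulr0// => l _.
  by rewrite mxE pdE.
move=> N N0; have [A [full Arank]] := F_indep.
pose O := [set x | [/\ N x, good x & H x != 0]]°.
have [x [Ax Ox]] : A `&` O !=set0.
  apply: full_measure_dense full _ _ _; first exact: open_interior.
    by move=> x /interior_subset[_ [Ux]].
  apply: contrapT => O0; apply: H_nz.
  have near2 : \forall x \near (0 : V), \forall y \near x, N y /\ good y.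
    by apply: near_join; exact: filterI.
  apply: filterS2 near2 near_good => x Nx [_ _ _ dD].
  apply/eqP/negPn/negP => Hx; apply: O0; exists x.
  have nD : \forall y \near x, forall j, D j y != 0.
    apply: (@filter_forall V 'I_k (fun j => [set y | D j y != 0]) (nbhs x) _) => i.
    by apply: has_grad_near_neq0 (dD i) _; exact: D_neq0.
  apply: filterS2 Nx nD => y [Ny gy] Dy; split=> //.
  by apply/prodf_neq0 => i _; exact: Dy.
have [Nx gx Hx] := interior_subset Ox; exists x => //.
have -> : \matrix_(j, l) wronskian G H j l x = H x ^+ 2 *: \matrix_j gradient (F j) x.
  by apply/matrixP => j l; rewrite !mxE wE// pdE.
rewrite /row_free; apply/eqP.
by rewrite (eqmx_scale _ (expf_neq0 2 Hx)); exact: Arank.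
Qed.

End CommonDenominator.

(** * The bound on the number of first integrals *)

Theorem theorem1 (R : realType) (n : nat) (n_ge1 : (1 <= n)%N)
  (U : set 'rV[CC R]_n) (U_open : open U) (U0 : U 0)
  (f : 'rV[CC R]_n -> 'rV[CC R]_n)
  (f_analytic : forall i : 'I_n, analytic_on U (fun x => f x 0 i))
  (f0 : f 0 = 0)
  (lambda : 'rV[CC R]_n)
  (lambda_eigen :
     char_poly ('J f 0) = \prod_(i < n) ('X - (lambda 0 i)%:P))
  (k : nat) (F : 'I_k -> 'rV[CC R]_n -> CC R)
  (F_integral :
     forall j, generalized_rational_first_integral U f (F j))
  (F_indep : functionally_independent U F) :
  (k <= \dim (minimal_subspace
     [set map_mx (intr : int -> R) m | m in resonances lambda]))%N.
Proof.
have [G [H [gG gH H_nz f_int G_indep]]] := common_denominator U_open U0 F_integral F_indep.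
have [P [pi [uP T0 Tpi]]] := triangularize n_ge1 lambda_eigen.
have gf i : germ (fun x => f x 0 i) by exact: analytic_at_germ (f_analytic i 0 U0).
set Q := invmx P in T0 Tpi; set J := 'J f 0 in T0 Tpi.
have QP : Q *m P = 1%:M by rewrite mulVmx.
pose Gt j y := G j (y *m P); pose Ht y := H (y *m P); pose ft y := f (y *m P) *m Q.
have gGt j : germ (Gt j) by exact: germ_subst.
have gHt : germ Ht by exact: germ_subst.
have Ht_nz : ~ (\forall y \near (0 : 'rV[CC R]_n), Ht y = 0).
  apply: contra_not H_nz => /(near_subst Q); apply: filterS => x.
  by rewrite /Ht -mulmxA QP mulmx1.
(* chain rule for the change of coordinates [x = y *m P] *)
have wt : \forall y \near (0 : 'rV[CC R]_n),
    \matrix_(j, i) wronskian Gt Ht j i y =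
    \matrix_(j, l) wronskian G H j l (y *m P) *m P^T.
  have n1 : \forall y \near (0 : 'rV[CC R]_n), forall j,
      has_grad (G j) (y *m P) (fun i => pd i (G j) (y *m P)).
    apply: (near_subst P (Q := [set x | forall j, has_grad (G j) x (fun i => pd i (G j) x)])).
    exact: (@filter_forall _ 'I_k (fun j => [set x | has_grad (G j) x (fun i => pd i (G j) x)])
      (nbhs (0 : 'rV[CC R]_n)) _ (fun j => germ_has_grad (gG j))).
  have n2 := near_subst P (germ_has_grad gH).
  apply: filterS2 n1 n2 => y dG dH; apply/matrixP => j i; rewrite !mxE.
  rewrite /wronskian (pd_subst i (dG j)) (pd_subst i dH) !mulr_sumr -sumrB.
  by apply: eq_bigr => l _; rewrite !mxE /wronskian /Gt /Ht; ring.
have ft_int : \forall y \near (0 : 'rV[CC R]_n), Ht y != 0 ->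
    forall j, \sum_i ft y 0 i * wronskian Gt Ht j i y = 0.
  apply: filterS2 wt (near_subst P f_int) => y wty fy Hy j.
  have : (ft y *m (\matrix_(j, i) wronskian Gt Ht j i y)^T) 0 j = 0.
    rewrite wty trmx_mul trmxK /ft -mulmxA (mulmxA Q) QP mul1mx mxE.
    by rewrite -[RHS](fy Hy j); apply: eq_bigr => l _; rewrite !mxE.
  by rewrite mxE => E; rewrite -[RHS]E; apply: eq_bigr => i _; rewrite !mxE.
(* if all the maximal minors were zero as germs, they would vanish together
   near 0, where some wronskian matrix has full rank *)
have [sigma det_nz] : exists sigma : 'I_k -> 'I_n,
    ~ (\forall y \near (0 : 'rV[CC R]_n), \det (wronskian_minor Gt Ht sigma y) = 0).
  apply: contrapT => all0.
  have : \forall y \near (0 : 'rV[CC R]_n), forall sigma : {ffun 'I_k -> 'I_n},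
      \det (wronskian_minor Gt Ht sigma y) = 0.
    apply: (@filter_forall _ {ffun 'I_k -> 'I_n} (fun sigma : {ffun 'I_k -> 'I_n} =>
      [set y | \det (wronskian_minor Gt Ht sigma y) = 0]) (nbhs (0 : 'rV[CC R]_n)) _) => sigma.
    by apply: contrapT => nz; apply: all0; exists sigma.
  move=> /(filterI wt)/(near_subst Q)/G_indep[x [wx det0] freeW].
  set y := x *m Q in wx det0.
  have yP : y *m P = x by rewrite /y -mulmxA QP mulmx1.
  set W := \matrix_(j, i) wronskian Gt Ht j i y in wx.
  have Wfull : row_full W^T.
    rewrite /row_full mxrank_tr wx yP mxrankMfree; first exact: freeW.
    by rewrite row_free_unit unitmx_tr.
  have := fullrowsub_unit Wfull; rewrite unitmxE -det_tr.
  have -> : (rowsub (fullrankfun Wfull) W^T)^T = wronskian_minor Gt Ht (fullrankfun Wfull) y.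
    by apply/matrixP => j p; rewrite !mxE.
  by rewrite det0 unitr0.
set M := minimal_subspace _.
(* the diagonal of the triangular matrix lists [lambda] in another order *)
pose perm : 'Hom('rV[R]_n, 'rV[R]_n) := linfun (mulmxr (perm_mx pi^-1)).
have permE (v : 'rV[R]_n) i : perm v 0 i = v 0 (pi i).
  by rewrite lfunE /= -col_permE mxE.
apply: (@leq_trans (\dim (perm @: M)%VS)); last first.
  by rewrite -[leqRHS](limg_ker_dim perm) leq_addl.
have gft i : germ (fun y => ft y 0 i).
  have -> : (fun y => ft y 0 i) = (fun y => \sum_l f (y *m P) 0 l * Q l i).
    by apply/funext => y; rewrite mxE.
  by apply: germ_sum => l _; apply: germM (germC _ _); exact: (germ_subst P (gf l)).
have pd_ft i j : pd j (fun y => ft y 0 i) 0 = (P *m J *m Q) j i.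
  have -> : (fun y => ft y 0 i) = (fun y => \sum_l f (y *m P) 0 l * Q l i).
    by apply/funext => y; rewrite mxE.
  have dfP l : has_grad (fun x => f x 0 l) (0 *m P) (fun i => pd i (fun x => f x 0 l) 0).
    by rewrite mul0mx; exact: nbhs_singleton (germ_has_grad (gf l)).
  have df l : derivable_at (fun y => f (y *m P) 0 l) 0.
    exact: nbhs_singleton (germ_derivable (germ_subst P (gf l))).
  rewrite pd_sum; last by move=> l _; exact: (derivable_atM (df l) (@derivable_atC R n (Q l i) 0)).
  rewrite mxE; apply: eq_bigr => l _.
  rewrite (pdM j (df l) (@derivable_atC R n (Q l i) 0)) pdC mulr0 add0r mulrC.
  rewrite (pd_subst j (dfP l)) mxE; congr (_ * _); apply: eq_bigr => m _.
  by rewrite /J jacobian_pd// mxE.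
have ft0 i : ft 0 0 i = 0 by rewrite /ft mul0mx f0 mul0mx mxE.
pose i0 : 'I_n := Ordinal n_ge1.
apply: (integrals_le_dim (@scale_gt1 n) (@scale_coprime n) gGt gHt (amax := 1 + n * n.+1`!)
  _ (@scale_le n) Ht_nz det_nz (f := ft) (ev := fun i => lambda 0 (pi i)) _ ft_int) => //.
  move=> i; rewrite -Tpi -pd_ft.
  apply: (germ_curve_triangular (i0 := i0)) => //.
  - exact: scale_gt1.
  - by move=> j; rewrite /scale leq_add2l leq_mul2r orbC.
  - exact: scale_lt_sqr.
  - exact: scale_lt.
  - by move=> j ji; rewrite pd_ft T0.
move=> z lz; pose z' : 'rV[int]_n := \row_l z ((pi^-1)%g l).
have -> : \row_i (z i)%:~R = perm (map_mx intr z').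
  by apply/rowP => i; rewrite permE !mxE permK.
apply: memv_img; have [z'0|z'0] := eqVneq z' 0.
  by rewrite z'0 map_mx0 mem0v.
have [+ _] := minimal_subspaceP [set map_mx (intr : int -> R) m | m in resonances lambda].
apply; exists z' => //; split=> //.
rewrite /pairing (reindex_inj (@perm_inj _ pi)) -[RHS]lz; apply: eq_bigr => i _.
by rewrite !mxE permK mulrC.
Qed.
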